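(* Let $L>0$ and let $g\in L^2((0,L)\times(0,L);\mathbb{C})$ satisfy $g\in H^1(\mathcal{T}_-)\cap H^1(\mathcal{T}_+)$. Then the control system $$u_t(t,x)-u_x(t,x)=\int_0^L g(x,y)u(t,y)\,dy,\quad u(t,L)=U(t),\quad u(0,x)=u^0(x)$$ is stabilizable in finite time $L$ if and only if it is exactly controllable at time $L$.
   Context: $\mathcal{T}_-=\{(x,y)\in(0,L)^2: x>y\}$, $\mathcal{T}_+=\{(x,y)\in(0,L)^2: x<y\}$; $g\in H^1(\mathcal{T}_-)\cap H^1(\mathcal{T}_+)$ means the restrictions of $g$ to $\mathcal{T}_-$ and to $\mathcal{T}_+$ belong to $H^1$ of these triangles (a jump across the diagonal is allowed). For $T>0$, $u^0\in L^2(0,L)$, $U\in L^2(0,T)$, a (weak) solution of the system on $(0,T)\times(0,L)$ is a function $u\in C^0([0,T];L^2(0,L))$ such that for every $\tau\in[0,T]$ and every $\phi\in C^1([0,\tau]\times[0,L])$ with $\phi(\cdot,0)=0$, $$\int_0^\tau\!\!\int_0^L u(t,x)\overline{\Big(-\phi_t+\phi_x-\int_0^L\overline{g(y,x)}\phi(t,y)dy\Big)}\,dx\,dt+\int_0^L u(\tau,x)\overline{\phi(\tau,x)}dx-\int_0^L u^0\overline{\phi(0,x)}dx-\int_0^\tau U(t)\overline{\phi(t,L)}dt=0;$$ it exists and is unique. The system is exactly controllable at time $T$ if for all $u^0,u^1\in L^2(0,L)$ there is $U\in L^2(0,T)$ whose solution satisfies $u(T)=u^1$. It is stabilizable in finite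 time $T$ if there exists a bounded linear map $\Gamma:L^2(0,L)\to\mathbb{C}$ such that for every $u^0\in L^2(0,L)$ the (unique, well-posed) solution $u\in C^0([0,+\infty);L^2(0,L))$ of the closed-loop system (same equation for $t\in(0,\infty)$ with boundary condition $u(t,L)=\Gamma u(t)$, understood in the same weak sense on every $[0,\tau]$ with $U(t)=\Gamma u(t)$) satisfies $u(t)=0$ for all $t\ge T$. *)

(* Defs.v *)
From HB Require Import structures.
From mathcomp Require Import all_boot all_order all_algebra.
From mathcomp Require Import all_classical all_reals all_analysis.
From mathcomp Require Import complex.

Set Implicit Arguments.
Unset Strict Implicit.
Unset Printing Implicit Defensive.

Import Order.TTheory GRing.Theory Num.Theory.
Import numFieldNormedType.Exports.
Local Open Scope classical_set_scope.
Local Open Scope ring_scope.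

Section Defs.
Variable R : realType.
Local Notation mu := (@lebesgue_measure R).
Local Notation mu2 := ((@lebesgue_measure R) \x (@lebesgue_measure R))%E.

Definition cnorm2 (z : R[i]) : R := complex.Re z ^+ 2 + complex.Im z ^+ 2.

Definition cint (D : set R) (f : R -> R[i]) : R[i] :=
  Complex (Rintegral mu D (fun x => complex.Re (f x))) (Rintegral mu D (fun x => complex.Im (f x))).

Definition L2_2 (D : set (R * R)) (f : R * R -> R) : Prop :=
  measurable_fun D f /\ mu2.-integrable D (fun p => (f p ^+ 2)%:E).

Definition cL2 (D : set R) (f : R -> R[i]) : Prop :=
  measurable_fun D (fun x => complex.Re (f x)) /\ measurable_fun D (fun x => complex.Im (f x)) /\
  mu.-integrable D (fun x => (cnorm2 (f x))%:E).

Definition l2n (L : R) (f : R -> R[i]) : R := Rintegral mu `]0, L[%classic (fun x => cnorm2 (f x)).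

Definition ae_eq (L : R) (f h : R -> R[i]) : Prop :=
  {ae mu, forall x, `]0, L[%classic x -> f x = h x}.

Definition pd1 (f : R * R -> R) : R * R -> R := fun p => derive1 (fun s => f (s, p.2)) p.1.
Definition pd2 (f : R * R -> R) : R * R -> R := fun p => derive1 (fun s => f (p.1, s)) p.2.

Fixpoint ipd (w : seq bool) (f : R * R -> R) : R * R -> R :=
  match w with
  | [::] => f
  | b :: w' => let g := ipd w' f in if b then pd2 g else pd1 g
  end.

Definition smooth2 (f : R * R -> R) : Prop :=
  forall w : seq bool, continuous (ipd w f) /\
    (forall p : R * R, derivable (fun s => ipd w f (s, p.2)) p.1 1 /\
                       derivable (fun s => ipd w f (p.1, s)) p.2 1).

Definition test_fun (T : set (R * R)) (phi : R * R -> R) : Prop :=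
  smooth2 phi /\ exists K : set (R * R), compact K /\ K `<=` T /\
    (forall p, ~ K p -> phi p = 0).

Definition H1 (T : set (R * R)) (f : R * R -> R) : Prop :=
  L2_2 T f /\ exists h1 h2 : R * R -> R, L2_2 T h1 /\ L2_2 T h2 /\
    forall phi, test_fun T phi ->
      Rintegral mu2 T (fun p => f p * pd1 phi p) = - Rintegral mu2 T (fun p => h1 p * phi p) /\
      Rintegral mu2 T (fun p => f p * pd2 phi p) = - Rintegral mu2 T (fun p => h2 p * phi p).

Definition cH1 (T : set (R * R)) (g : R -> R -> R[i]) : Prop :=
  H1 T (fun p => complex.Re (g p.1 p.2)) /\ H1 T (fun p => complex.Im (g p.1 p.2)).

Definition square (L : R) : set (R * R) := [set p | 0 < p.1 < L /\ 0 < p.2 < L].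
Definition Tminus (L : R) : set (R * R) := [set p | square L p /\ p.2 < p.1].
Definition Tplus (L : R) : set (R * R) := [set p | square L p /\ p.1 < p.2].

Definition cL2_sq (L : R) (g : R -> R -> R[i]) : Prop :=
  L2_2 (square L) (fun p => complex.Re (g p.1 p.2)) /\ L2_2 (square L) (fun p => complex.Im (g p.1 p.2)).

Definition C1_2 (f : R -> R -> R) : Prop :=
  (forall t x, derivable (fun s => f s x) t 1) /\
  (forall t x, derivable (fun s => f t s) x 1) /\
  continuous (pd1 (fun p => f p.1 p.2)) /\ continuous (pd2 (fun p => f p.1 p.2)).

(* complex C^1 on R^2 (a C^1 function on the closed rectangle is the restriction of such a function) *)
Definition cC1 (phi : R -> R -> R[i]) : Prop :=
  C1_2 (fun t x => complex.Re (phi t x)) /\ C1_2 (fun t x => complex.Im (phi t x)).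

Definition dt (phi : R -> R -> R[i]) (t x : R) : R[i] :=
  Complex (derive1 (fun s => complex.Re (phi s x)) t) (derive1 (fun s => complex.Im (phi s x)) t).
Definition dx (phi : R -> R -> R[i]) (t x : R) : R[i] :=
  Complex (derive1 (fun s => complex.Re (phi t s)) x) (derive1 (fun s => complex.Im (phi t s)) x).

Definition C0L2 (L T : R) (u : R -> R -> R[i]) : Prop :=
  (forall t, `[0, T]%classic t -> cL2 `]0, L[%classic (u t)) /\
  forall t0, `[0, T]%classic t0 -> forall e : R, 0 < e -> exists2 d : R, 0 < d &
    forall t, `[0, T]%classic t -> `|t - t0| < d -> l2n L (fun x => u t x - u t0 x) < e.

(* weak solution on (0,T)x(0,L) of
     u_t - u_x = \int_0^L g(x,y) u(t,y) dy,  u(t,L) = U(t),  u(0,x) = u0(x) *)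
Definition weak_sol (L : R) (g : R -> R -> R[i]) (T : R) (u0 : R -> R[i])
    (U : R -> R[i]) (u : R -> R -> R[i]) : Prop :=
  C0L2 L T u /\
  forall tau, `[0, T]%classic tau -> forall phi : R -> R -> R[i], cC1 phi ->
    (forall t, `[0, tau]%classic t -> phi t 0 = 0) ->
    cint `]0, tau[%classic (fun t => cint `]0, L[%classic (fun x =>
        u t x * conjc (- dt phi t x + dx phi t x
                       - cint `]0, L[%classic (fun y => conjc (g y x) * phi t y))))
    + cint `]0, L[%classic (fun x => u tau x * conjc (phi tau x))
    - cint `]0, L[%classic (fun x => u0 x * conjc (phi 0 x))
    - cint `]0, tau[%classic (fun t => U t * conjc (phi t L)) = 0.

Definition exactly_controllable (L : R) (g : R -> R -> R[i]) (T : R) : Prop :=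
  forall u0 u1 : R -> R[i], cL2 `]0, L[%classic u0 -> cL2 `]0, L[%classic u1 ->
    exists U : R -> R[i], cL2 `]0, T[%classic U /\
      exists u, weak_sol L g T u0 U u /\ ae_eq L (u T) u1.

Definition bounded_linear_functional (L : R) (Gam : (R -> R[i]) -> R[i]) : Prop :=
  (forall f h, cL2 `]0, L[%classic f -> cL2 `]0, L[%classic h -> Gam (fun x => f x + h x) = Gam f + Gam h) /\
  (forall (c : R[i]) f, cL2 `]0, L[%classic f -> Gam (fun x => c * f x) = c * Gam f) /\
  exists M : R, forall f, cL2 `]0, L[%classic f -> cnorm2 (Gam f) <= M * l2n L f.

Definition closed_loop_sol (L : R) (g : R -> R -> R[i]) (Gam : (R -> R[i]) -> R[i])
    (u0 : R -> R[i]) (u : R -> R -> R[i]) : Prop :=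
  forall T, 0 <= T -> weak_sol L g T u0 (fun t => Gam (u t)) u.

Definition stabilizable_in_finite_time (L : R) (g : R -> R -> R[i]) (T : R) : Prop :=
  exists Gam : (R -> R[i]) -> R[i], bounded_linear_functional L Gam /\
    forall u0, cL2 `]0, L[%classic u0 ->
      (exists u, closed_loop_sol L g Gam u0 u) /\
      (forall u v, closed_loop_sol L g Gam u0 u -> closed_loop_sol L g Gam u0 v ->
         forall t, 0 <= t -> ae_eq L (u t) (v t)) /\
      (forall u, closed_loop_sol L g Gam u0 u ->
         forall t, T <= t -> ae_eq L (u t) (fun _ => 0)).

End Defs.

(* Main.v *)
Require Import Defs.
From HB Require Import structures.
From mathcomp Require Import all_boot all_order all_algebra.
From mathcomp Require Import all_classical all_reals all_analysis.
From mathcomp Require Import measurable_realfun complex ring lra.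

Set Implicit Arguments.
Unset Strict Implicit.
Unset Printing Implicit Defensive.

Import Order.TTheory GRing.Theory Num.Theory.
Import numFieldNormedType.Exports.
Local Open Scope classical_set_scope.
Local Open Scope ring_scope.

(** Along the characteristics [x + t = c] the equation reads [u (t, x) = d c + E f 0 t c], where
    [f] is the integral term, [E f a b c] is the integral of [f (s, c - s)] over [a < s < b] and [d]
    carries the initial state on [(0, L)] and the control on [(L, L + T)]; testing the weak form
    with functions of [x + t] shows that weak and mild solutions coincide.  The same formula can be
    solved backwards from time [L] by Picard iteration, with arbitrary data
    [b = d + E f 0 L] on [(0, 2L)].

    If a feedback annihilates every state in time [L], the backward solution with final state [u1]
    plus the closed-loop solution that corrects its initial state steers [u0] to [u1].

    Conversely, the trajectories reaching [0] at time [L] are the backward solutions whose data [be]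
    vanish on [(L, 2L)], and their initial state is [be + K be] with [K] Hilbert-Schmidt.  Exact
    controllability makes [1 + K] surjective, hence boundedly invertible, and the control of such a
    trajectory at time [t] is a bounded linear functional of the state at time [t], because the
    class of these trajectories is invariant under time translation.  This functional is the
    feedback.  A preliminary change of [g] on a null set makes every row square integrable. *)

(** Controllability only says that [1 + K] is onto, while a feedback needs the state to determine
    its datum: two data with the same initial state could ask for different controls. Compactness
    closes this gap, in finite form: the sum of [|K e_i|^2] over orthonormal families is bounded, so
    [K] keeps only finitely many orthonormal vectors long. This bound comes from a smoothing effect.
    Integrating the source along characteristics turns square integrable states into bounded
    functions, so [K be] at a fixed [c] is a bounded functional of [be]; Bessel's inequality then
    applies at each [c] and is integrated. Smoothing also replaces completeness of the state space,
    since limits are taken uniformly, and gives a meaning to single values: the feedback is the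
    value of [K be] at [c = L], the characteristic that enters the domain at the current time.
    States are functions, not classes, so scalar products are only semidefinite. Integrals over a
    single characteristic still depend only on the classes of the states, because the rows of the
    modified kernel are all square integrable, not just almost all. *)

Section RealIntegrals.
Variable R : realType.
Local Notation mu := (@lebesgue_measure R).

(** * Integrals over the whole line with interval weights *)

Definition RI (f : R -> R) : R := Rintegral mu setT f.
Definition Li (f : R -> R) : Prop := mu.-integrable setT (EFin \o f).
Definition mf (f : R -> R) : Prop := measurable_fun setT f.
(** Integrals over intervals become integrals over the line against this weight, so that
    translations, reflections and Fubini apply without tracking domains. *)
Definition ind (a b x : R) : R := ((a < x < b)%R)%:R.

Lemma aeS (P Q : R -> Prop) : (forall x, P x -> Q x) ->
  {ae mu, forall x, P x} -> {ae mu, forall x, Q x}.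
Proof. exact: (@filterS _ _ (ae_filter_ringOfSetsType mu)). Qed.

Lemma aeI (P Q : R -> Prop) : {ae mu, forall x, P x} -> {ae mu, forall x, Q x} ->
  {ae mu, forall x, P x /\ Q x}.
Proof. exact: (@filterI _ _ (ae_filter_ringOfSetsType mu)). Qed.

Lemma aeW (P : R -> Prop) : (forall x, P x) -> {ae mu, forall x, P x}.
Proof. exact: (@filterE _ _ (ae_filter_ringOfSetsType mu)). Qed.

Lemma Li_meas f : Li f -> mf f.
Proof. by move=> /measurable_int /measurable_EFinP. Qed.

Lemma Li_le f h : mf f -> Li h -> (forall x, `|f x| <= h x) -> Li f.
Proof.
move=> f_m h_i fh; apply: (le_integrable measurableT _ _ h_i).
  exact/measurable_EFinP.
by move=> x _; rewrite /= lee_fin (le_trans (fh x))// ler_norm.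
Qed.

Lemma mf_norm f : mf f -> mf (fun x => `|f x|).
Proof. by move=> f_m; apply: measurableT_comp. Qed.

Lemma eq_Li f h : f =1 h -> Li f -> Li h.
Proof. by move=> fh; rewrite (_ : f = h)//; exact/funext. Qed.

Lemma eq_RI f h : f =1 h -> RI f = RI h.
Proof. by move=> fh; rewrite (_ : f = h)//; exact/funext. Qed.

Lemma LiD f h : Li f -> Li h -> Li (fun x => f x + h x).
Proof. by move=> fi hi; exact: (integrableD measurableT fi hi). Qed.

Lemma LiZ k f : Li f -> Li (fun x => k * f x).
Proof. by move=> fi; exact: (integrableZl measurableT k fi). Qed.

Lemma LiN f : Li f -> Li (fun x => - f x).
Proof. by move=> /(LiZ (-1)); apply: eq_Li => x; rewrite mulN1r. Qed.

Lemma LiB f h : Li f -> Li h -> Li (fun x => f x - h x).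
Proof. by move=> fi /LiN hi; exact: LiD. Qed.

Lemma Li0 : Li (fun=> 0).
Proof. exact: integrable0. Qed.

Lemma Li_norm f : Li f -> Li (fun x => `|f x|).
Proof. exact: integrable_norm. Qed.

Lemma RID f h : Li f -> Li h -> RI (fun x => f x + h x) = RI f + RI h.
Proof. exact: RintegralD. Qed.

Lemma RIB f h : Li f -> Li h -> RI (fun x => f x - h x) = RI f - RI h.
Proof. exact: RintegralB. Qed.

Lemma RIZ k f : Li f -> RI (fun x => k * f x) = k * RI f.
Proof. exact: RintegralZl. Qed.

Lemma RI0 : RI (fun=> 0) = 0.
Proof. by rewrite /RI /Rintegral integral0. Qed.

Lemma RIN f : Li f -> RI (fun x => - f x) = - RI f.
Proof.
by move=> fi; rewrite -[RHS]mulN1r -RIZ//; apply: eq_RI => x; rewrite mulN1r.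
Qed.

Lemma RI_ge0 f : (forall x, 0 <= f x) -> 0 <= RI f.
Proof. by move=> f0; apply: Rintegral_ge0. Qed.

Lemma RI_le f h : Li f -> Li h -> (forall x, f x <= h x) -> RI f <= RI h.
Proof. by move=> fi hi fh; apply: le_Rintegral. Qed.

Lemma RI_norm f : Li f -> `|RI f| <= RI (fun x => `|f x|).
Proof. exact: le_normr_Rintegral. Qed.

Lemma RI_norm_le f h : Li f -> Li h -> (forall x, `|f x| <= h x) -> `|RI f| <= RI h.
Proof.
move=> fi hi fh; apply: le_trans (RI_norm fi) _.
by apply: RI_le => //; exact: Li_norm.
Qed.

Lemma RI_ae f h : mf f -> mf h -> {ae mu, forall x, f x = h x} -> RI f = RI h.
Proof.
move=> f_m h_m fh; rewrite /RI /Rintegral; congr fine.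
apply: ae_eq_integral => //; [exact/measurable_EFinP|exact/measurable_EFinP|].
by apply: aeS fh => x /= -> _.
Qed.

Lemma measurable_ind a b : mf (ind a b).
Proof.
apply: (eq_measurable_fun (\1_(`]a, b[%classic : set R) : R -> R)).
  by move=> x _; rewrite indicE /ind mem_setE in_itv.
exact: measurable_indic.
Qed.

Lemma ind_ge0 a b x : 0 <= ind a b x.
Proof. by rewrite /ind; case: (_ && _). Qed.

Lemma ind_le1 a b x : ind a b x <= 1.
Proof. by rewrite /ind; case: (_ && _). Qed.

Lemma indE a b x : a < x < b -> ind a b x = 1.
Proof. by rewrite /ind => ->. Qed.

Lemma ind0 a b x : ~~ (a < x < b) -> ind a b x = 0.
Proof. by rewrite /ind => /negbTE ->. Qed.

Lemma ind_ifE a b x : ind a b x = if a < x < b then 1 else 0.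
Proof. by rewrite /ind; case: (_ && _). Qed.

Lemma Li_ind a b : Li (ind a b).
Proof.
have := integrable_indic_itv a b false true.
apply: eq_integrable => // x _ /=; rewrite indicE /ind mem_setE in_itv.
by [].
Qed.

Lemma RI_ind a b : a <= b -> RI (ind a b) = b - a.
Proof.
move=> ab; rewrite (eq_RI (h := \1_(`]a, b[%classic : set R))); last first.
  by move=> x; rewrite indicE /ind mem_setE in_itv.
rewrite /RI /Rintegral integral_indic// setIT.
apply: (etrans (congr1 fine (lebesgue_measure_itv `]a, b[))).
by rewrite /= lte_fin; case: ltgtP ab => //= [->]; rewrite subrr.
Qed.

Lemma Rintegral_ind a b f :
  Rintegral mu `]a, b[%classic f = RI (fun x => ind a b x * f x).
Proof.
rewrite Rintegral_mkcond; apply: eq_RI => x.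
rewrite patchE /ind mem_setE in_itv /=.
by case: ifP; rewrite ?mul1r ?mul0r.
Qed.

Lemma integrable_ind a b f :
  mu.-integrable `]a, b[%classic (EFin \o f) <-> Li (fun x => ind a b x * f x).
Proof.
rewrite integrable_mkcond//.
suff -> : (EFin \o f) \_ `]a, b[ = EFin \o (fun x => ind a b x * f x) by [].
apply/funext => x; rewrite patchE /ind mem_setE in_itv /=.
by case: ifP; rewrite ?mul1r ?mul0r.
Qed.

Lemma measurable_fun_ind a b (f : R -> R) :
  measurable_fun (`]a, b[%classic : set R) f <-> mf (fun x => ind a b x * f x).
Proof.
rewrite (_ : (fun x => _) = f \_ `]a, b[%classic); last first.
  apply/funext => x; rewrite patchE /ind mem_setE in_itv /=.
  by case: ifP; rewrite ?mul1r ?mul0r.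
exact: measurable_restrictT.
Qed.

End RealIntegrals.

(** * Translations and Fubini *)

Section translation.
Variable R : realType.
Local Notation mu := (@lebesgue_measure R).
Local Open Scope ereal_scope.

Definition shiftm (a : R) : measurableTypeR R -> measurableTypeR R := fun x => (x + a)%R.

Lemma measurable_shiftm a : measurable_fun setT (shiftm a).
Proof. exact: measurable_funD. Qed.

HB.instance Definition _ a := isMeasurableFun.Build _ _ _ _ (shiftm a) (@measurable_shiftm a).

(** By uniqueness of the Lebesgue measure it is enough that the translated measure gives half-open
    intervals their length. *)
Lemma measure_shiftm (a : R) (A : set R) : measurable A ->
  pushforward mu (shiftm a) A = mu A.
Proof.
move=> mA; apply/esym/lebesgue_measure_unique => //= _ [[x y]] _ <-.
rewrite /pushforward (_ : shiftm a @^-1` _ = `](x - a)%R, (y - a)%R]%classic); last first.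
  by apply/seteqP; split => z /=; rewrite /shiftm !in_itv/= ltrBlDr lerBrDr.
rewrite !lebesgue_measure_itv/= !lte_fin ltrD2r; case: ifP => //= _.
by rewrite -!EFinB; congr EFin; ring.
Qed.

Lemma ge0_integral_shift (a : R) (f : R -> \bar R) : measurable_fun setT f ->
  (forall x, 0 <= f x) -> \int[mu]_x f (x + a)%R = \int[mu]_x f x.
Proof.
move=> f_m f0.
have := @ge0_integral_pushforward _ _ _ _ R _ (@measurable_shiftm a) mu setT f measurableT f_m.
rewrite preimage_setT => <- //.
by apply: eq_measure_integral => //= A mA AS; exact/measure_shiftm.
Qed.

Lemma ge0_integral_opp (f : R -> \bar R) : measurable_fun setT f ->
  (forall x, 0 <= f x) -> \int[mu]_x f (- x)%R = \int[mu]_x f x.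
Proof.
move=> f_m f0.
have oppm : measurable_fun [set: measurableTypeR R] (-%R : R -> measurableTypeR R).
  exact: oppr_measurable.
have := @ge0_integral_pushforward _ _ _ _ R _ oppm mu setT f measurableT f_m.
rewrite preimage_setT => <- //.
by apply: eq_measure_integral => //= A mA AS; exact/lebesgue_measureN.
Qed.

Lemma mf_comp (f h : R -> R) : mf f -> mf h -> mf (fun x => f (h x)).
Proof. by move=> f_m h_m; apply: (measurableT_comp f_m h_m). Qed.

Lemma mf_shift a (f : R -> R) : mf f -> mf (fun x => f (x + a)%R).
Proof. by move=> /mf_comp; apply; exact: measurable_shiftm. Qed.

Lemma mf_opp (f : R -> R) : mf f -> mf (fun x => f (- x)%R).
Proof. by move=> /mf_comp; apply; exact: oppr_measurable. Qed.

Section transfer.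
Variable phi : R -> R.
Hypothesis mphi : forall f : R -> R, mf f -> mf (fun x => f (phi x)).
Hypothesis iphi : forall f : R -> \bar R, measurable_fun setT f ->
  (forall x, 0 <= f x) -> \int[mu]_x f (phi x)%R = \int[mu]_x f x.

Let Li_transfer f : Li f -> Li (fun x => f (phi x)).
Proof.
move=> fi; have /integrableP[_ foo] := fi; apply/integrableP; split.
  by apply/measurable_EFinP; apply: mphi; exact: Li_meas.
rewrite /=; rewrite (iphi (f := fun x => `|(f x)%:E|))//.
by apply: measurableT_comp => //; apply/measurable_EFinP; exact: Li_meas.
Qed.

Let RI_transfer f : mf f -> RI (fun x => f (phi x)) = RI f.
Proof.
move=> f_m; rewrite /RI /Rintegral; congr fine.
rewrite [LHS]integralE [RHS]integralE; congr (_ - _).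
  rewrite -[RHS]iphi//; last by apply: measurable_funepos; exact/measurable_EFinP.
  by apply: eq_integral => x _; rewrite !funeposE.
rewrite -[RHS]iphi//; last by apply: measurable_funeneg; exact/measurable_EFinP.
by apply: eq_integral => x _; rewrite !funenegE.
Qed.

(** Invariance of nonnegative integrals passes to real ones through positive and negative parts. The
    substitutions are the translations and the reflection. *)
Lemma transfer : (forall f, Li f -> Li (fun x => f (phi x))) /\
  (forall f, mf f -> RI (fun x => f (phi x)) = RI f).
Proof. by []. Qed.
End transfer.

Lemma Li_shift a (f : R -> R) : Li f -> Li (fun x => f (x + a)%R).
Proof. exact: (transfer (@mf_shift a) (@ge0_integral_shift a)).1. Qed.

Lemma RI_shift a (f : R -> R) : mf f -> RI (fun x => f (x + a)%R) = RI f.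
Proof. exact: (transfer (@mf_shift a) (@ge0_integral_shift a)).2. Qed.

Lemma Li_opp (f : R -> R) : Li f -> Li (fun x => f (- x)%R).
Proof. exact: (transfer (@mf_opp) (@ge0_integral_opp)).1. Qed.

Lemma RI_opp (f : R -> R) : mf f -> RI (fun x => f (- x)%R) = RI f.
Proof. exact: (transfer (@mf_opp) (@ge0_integral_opp)).2. Qed.

Lemma mf_refl c (f : R -> R) : mf f -> mf (fun s => f (c - s)%R).
Proof.
by move=> fi; have := mf_opp (mf_shift c fi); under eq_fun do rewrite addrC.
Qed.

Lemma Li_refl c (f : R -> R) : Li f -> Li (fun s => f (c - s)%R).
Proof.
by move=> fi; have := Li_opp (Li_shift c fi); apply: eq_Li => x; rewrite addrC.
Qed.

Lemma RI_refl c (f : R -> R) : mf f -> RI (fun s => f (c - s)%R) = RI f.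
Proof.
move=> fi; rewrite -(RI_shift c fi) -(RI_opp (mf_shift c fi)).
by apply: eq_RI => x; rewrite addrC.
Qed.

End translation.

Section fubini.
Variable R : realType.
Local Notation mu := (@lebesgue_measure R).
Local Notation mu2 := ((@lebesgue_measure R) \x (@lebesgue_measure R))%E.

Definition Li2 (f : R -> R -> R) := mu2.-integrable setT (fun p => (f p.1 p.2)%:E).
Definition mf2 (f : R -> R -> R) := measurable_fun setT (fun p : R * R => f p.1 p.2).

Lemma mf2_comp d (T : measurableType d) (f : R -> R -> R) (a b : T -> R) : mf2 f ->
  measurable_fun setT a -> measurable_fun setT b -> measurable_fun setT (fun t => f (a t) (b t)).
Proof.
move=> f_m a_m b_m.
have ab_m : measurable_fun setT (fun t => (a t, b t)) by exact: measurable_fun_pair.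
exact: (measurableT_comp f_m ab_m).
Qed.

Lemma RI_fineE (f : R -> R) : Li f -> (RI f)%:E = (\int[mu]_x (f x)%:E)%E.
Proof. by move=> fi; rewrite /RI /Rintegral fineK// ; exact: integrable_fin_num. Qed.

(** Tonelli's criterion in the form used below: the majorant is integrated section by section, and
    [a] bounds the outer integrand. *)
Lemma Li2_dom (f h : R -> R -> R) (a : R -> R) : mf2 f ->
  (forall x y, `|f x y| <= h x y) -> (forall x, Li (h x)) -> (forall x, RI (h x) <= a x) ->
  Li a -> Li2 f.
Proof.
move=> f_m fh hi ha ai; have mfE : measurable_fun setT (fun p : R * R => (f p.1 p.2)%:E) by exact/measurable_EFinP.
apply/(integrable12ltyP mu mu mfE).
have mfx x : mf (f x).
  by apply: (@mf2_comp _ _ f (fun=> x) id f_m).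
apply: (@le_lt_trans _ _ (\int[mu]_x (a x)%:E)%E); last first.
  by rewrite -RI_fineE// ltry.
apply: ge0_le_integral => //=.
- by move=> x _; apply: integral_ge0.
- apply: (measurable_fun_fubini_tonelli_F (m2 := mu) (fun p => `|(f p.1 p.2)%:E|)%E) => //.
  by apply: measurableT_comp => //; exact/measurable_EFinP.
- by apply/measurable_EFinP; exact: Li_meas.
- move=> x _; apply: (@le_trans _ _ (\int[mu]_y (h x y)%:E)%E).
    apply: ge0_le_integral => //=.
    + by apply/measurable_EFinP; exact: (mf_norm (mfx x)).
    + by apply/measurable_EFinP; exact: Li_meas.
    + by move=> y _; rewrite lee_fin.
  by rewrite -RI_fineE// lee_fin.
Qed.

Lemma Li2_swap f : Li2 f -> Li2 (fun y x => f x y).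
Proof.
move=> fi.
have f_m : mf2 f by move: (measurable_int _ fi) => /measurable_EFinP.
have f_m' : mf2 (fun y x => f x y).
  by apply: (@mf2_comp _ _ f snd fst f_m).
have mfE : measurable_fun setT (fun p : R * R => (f p.1 p.2)%:E) by exact/measurable_EFinP.
have mfE' : measurable_fun setT (fun p : R * R => (f p.2 p.1)%:E) by exact/measurable_EFinP.
by apply/(integrable21ltyP mu mu mfE'); move: fi => /(integrable12ltyP mu mu mfE).
Qed.

(** The integrals of the positive and negative parts are measurable in the parameter by Tonelli, and
    [fine] is measurable. This covers parameters where the integral is infinite and [RI] takes a
    default value. *)
Lemma mf_RI d (T : measurableType d) (f : T -> R -> R) :
  measurable_fun setT (fun p : T * R => f p.1 p.2) -> measurable_fun setT (fun x => RI (f x)).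
Proof.
move=> f_m.
apply: measurableT_comp; first exact: fine_measurable.
under eq_fun do rewrite integralE.
apply: emeasurable_funB.
  apply: (measurable_fun_fubini_tonelli_F (m2 := mu) (fun p : T * R => ((fun y => (f p.1 y)%:E)^\+ p.2))%E) => //=.
  rewrite (_ : (fun p => _) = (fun p : T * R => (f p.1 p.2)%:E)^\+%E); last first.
    by apply/funext => p; rewrite !funeposE.
  by apply: measurable_funepos; exact/measurable_EFinP.
apply: (measurable_fun_fubini_tonelli_F (m2 := mu) (fun p : T * R => ((fun y => (f p.1 y)%:E)^\- p.2))%E) => //=.
rewrite (_ : (fun p => _) = (fun p : T * R => (f p.1 p.2)%:E)^\-%E); last first.
  by apply/funext => p; rewrite !funenegE.
by apply: measurable_funeneg; exact/measurable_EFinP.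
Qed.

(** [RI] replaces non-finite section integrals by a default, which can only decrease absolute
    values, so integrability of the extended-valued marginal passes to it. *)
Lemma Li2_Li f : Li2 f -> Li (fun x => RI (f x)).
Proof.
move=> fi; have Fi := integrable_fubini_F fi.
have := @integrable_ae _ _ _ mu setT measurableT _ Fi => Fae.
have f_m : mf2 f by move: (measurable_int _ fi) => /measurable_EFinP.
have Fm : mf (fun x => RI (f x)) by exact: mf_RI.
apply/integrableP; split; first exact/measurable_EFinP.
have /integrableP[_] := Fi; apply: le_lt_trans.
apply: ge0_le_integral => //=.
- by apply/measurable_EFinP; exact: mf_norm.
- by apply: measurableT_comp => //; exact: (measurable_fubini_F fi).
move=> x _; rewrite /fubini_F /=.
suff H (z : \bar R) : (`|fine z|%:E <= `|z|)%E by exact: H.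
by case: z => [r| |] //=; rewrite normr0 leey.
Qed.

Lemma RI_Li2 f : Li2 f -> RI (fun x => RI (f x)) = fine (\int[mu2]_p (f p.1 p.2)%:E).
Proof.
move=> fi; have Fi := integrable_fubini_F fi.
have := @integrable_ae _ _ _ mu setT measurableT _ Fi => Fae.
rewrite -(integral12_prod_meas1 fi); congr fine.
apply: ae_eq_integral => //.
- by apply/measurable_EFinP; apply: Li_meas; exact: Li2_Li.
- exact: (measurable_fubini_F fi).
- by apply: aeS Fae => x /= /(_ I) H _; rewrite /RI /Rintegral fineK.
Qed.

Lemma RI_fubini f : Li2 f ->
  RI (fun x => RI (fun y => f x y)) = RI (fun y => RI (fun x => f x y)).
Proof.
move=> fi; rewrite (RI_Li2 fi) (RI_Li2 (Li2_swap fi)).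
by rewrite -(integral12_prod_meas1 fi) -(integral21_prod_meas1 (Li2_swap fi)).
Qed.

End fubini.

(** Nonnegativity of the form at its minimiser [b = C / B]. It serves both Cauchy-Schwarz
    inequalities, for [ip] and for [RI]. *)
Lemma discriminant_le (R : realType) (A B C : R) : 0 <= B ->
  (forall a b : R, 0 <= a ^+ 2 * A - 2 * a * b * C + b ^+ 2 * B) -> C ^+ 2 <= A * B.
Proof.
move=> B0 q; have [b0|b0] := eqVneq B 0.
  rewrite b0 mulr0; have [->|c0] := eqVneq C 0; first by rewrite expr0n.
  (* For [B = 0] and [a = 1] the form is affine in [b], and this [b] gives it the value [-1]. *)
  have := q 1 ((A + 1) / (2 * C)).
  rewrite b0 mulr0 addr0 expr1n mul1r mulr1.
  rewrite (_ : 2 * _ * _ = A + 1); first by lra.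
  by field.
have B0' : 0 < B by rewrite lt_neqAle eq_sym b0.
have := q 1 (C / B).
rewrite (_ : _ + _ = (A * B - C ^+ 2) / B).
  by rewrite ler_pdivlMr// mul0r subr_ge0.
by field.
Qed.

(** * Perturbations of the identity by Hilbert-Schmidt operators *)

Section fredholm.
(** [S] carves the square integrable functions out of all functions, and [ip] behaves as a
    semidefinite scalar product on [S] only. Scalars are real; complex functions enter through their
    real structure. *)
Variables (R : realType) (V : lmodType R) (S : V -> Prop) (ip : V -> V -> R).
Hypothesis SD : forall x y, S x -> S y -> S (x + y).
Hypothesis SZ : forall a x, S x -> S (a *: x).
Hypothesis ipC : forall x y, ip x y = ip y x.
Hypothesis ipDl : forall x y z, S x -> S y -> S z -> ip (x + y) z = ip x z + ip y z.
Hypothesis ipZl : forall a x z, S x -> S z -> ip (a *: x) z = a * ip x z.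
Hypothesis ip_ge0 : forall x, S x -> 0 <= ip x x.

Lemma SN x : S x -> S (- x).
Proof. by rewrite -scaleN1r; exact: SZ. Qed.

Lemma SB x y : S x -> S y -> S (x - y).
Proof. by move=> xS /SN; exact: SD. Qed.

Lemma ipDr x y z : S x -> S y -> S z -> ip x (y + z) = ip x y + ip x z.
Proof. by move=> *; rewrite ipC ipDl// !(ipC x). Qed.

Lemma ipZr a x z : S x -> S z -> ip x (a *: z) = a * ip x z.
Proof. by move=> *; rewrite ipC ipZl// (ipC x). Qed.

Lemma ipNl x z : S x -> S z -> ip (- x) z = - ip x z.
Proof. by move=> *; rewrite -scaleN1r ipZl// mulN1r. Qed.

Lemma ipBl x y z : S x -> S y -> S z -> ip (x - y) z = ip x z - ip y z.
Proof. by move=> xS yS zS; rewrite ipDl ?ipNl//; exact: SN. Qed.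

Lemma ipBr x y z : S x -> S y -> S z -> ip z (x - y) = ip z x - ip z y.
Proof. by move=> xS yS zS; rewrite ipC ipBl// !(ipC z). Qed.

Lemma ip_cauchy x y : S x -> S y -> ip x y ^+ 2 <= ip x x * ip y y.
Proof.
move=> xS yS.
have q (a b : R) : 0 <= a ^+ 2 * ip x x - 2 * a * b * ip x y + b ^+ 2 * ip y y.
  have := ip_ge0 (SB (SZ a xS) (SZ b yS)).
  have aS := SZ a xS; have bS := SZ b yS; have abS := SB aS bS.
  rewrite ipBl// !ipBr// !ipZl// !ipZr// (ipC y x).
  by rewrite (_ : _ - _ = a ^+ 2 * ip x x - 2 * a * b * ip x y + b ^+ 2 * ip y y)//; ring.
exact: discriminant_le (ip_ge0 yS) q.
Qed.

Lemma ip_normD x y : S x -> S y -> ip (x + y) (x + y) <= 2 * ip x x + 2 * ip y y.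
Proof.
move=> xS yS; have xyS := SD xS yS.
have := ip_ge0 (SB xS yS).
rewrite ipBl ?ipBr//; last exact: SB.
rewrite ipDl// !ipDr// (ipC y x).
by move: (ip x x) (ip y y) (ip x y) => a b c; lra.
Qed.

Lemma ip_normB x y : S x -> S y -> ip (x - y) (x - y) <= 2 * ip x x + 2 * ip y y.
Proof.
move=> xS yS; have := ip_normD xS (SN yS).
by rewrite [ip (- y) _]ipNl ?[ip y _]ipC ?ipNl ?opprK//; exact: SN.
Qed.

(** Stands in for definiteness: a vector of norm zero may differ from [0], but Cauchy-Schwarz makes
    it invisible to [ip]. *)
Lemma ip_null x y : S x -> S y -> ip x x = 0 -> ip x y = 0.
Proof.
move=> xS yS x0; apply/eqP; rewrite -sqrf_eq0; apply/eqP/le_anti.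
by rewrite sqr_ge0 (le_trans (ip_cauchy xS yS))// x0 mul0r.
Qed.

Lemma ip_normZ a x : S x -> ip (a *: x) (a *: x) = a ^+ 2 * ip x x.
Proof. by move=> xS; rewrite ipZl ?ipZr//; [ring|exact: SZ]. Qed.

Variables (K : V -> V) (kappa : R).
Hypothesis KS : forall x, S x -> S (K x).
Hypothesis KD : forall x y, S x -> S y -> K (x + y) = K x + K y.
Hypothesis KZ : forall a x, S x -> K (a *: x) = a *: K x.
Hypothesis K_bounded : forall x, S x -> ip (K x) (K x) <= kappa * ip x x.
Let T x := x + K x.

Definition orthonormal (e : nat -> V) n := (forall i, (i < n)%N -> S (e i)) /\
  (forall i j, (i < n)%N -> (j < n)%N -> ip (e i) (e j) = (i == j)%:R).

Hypothesis K_hs : forall n e, orthonormal e n -> \sum_(i < n) ip (K (e i)) (K (e i)) <= kappa.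

Let TS x : S x -> S (T x). Proof. by move=> xS; apply: SD => //; exact: KS. Qed.
Let TD x y : S x -> S y -> T (x + y) = T x + T y.
Proof. by move=> xS yS; rewrite /T KD// addrACA. Qed.
Let TZ a x : S x -> T (a *: x) = a *: T x.
Proof. by move=> xS; rewrite /T KZ// scalerDr. Qed.
Let TB x y : S x -> S y -> T (x - y) = T x - T y.
Proof. by move=> xS yS; have yS' := SN yS; rewrite TD// -[in LHS](scaleN1r y) TZ// scaleN1r. Qed.

Let T_bounded x : S x -> ip (T x) (T x) <= (2 + 2 * kappa) * ip x x.
Proof.
move=> xS; apply: le_trans (ip_normD xS (KS xS)) _.
by have := K_bounded xS; move: (ip x x) (ip (K x) _) => a b; lra.
Qed.

Let ip_T_null x y : S x -> S y -> ip x x = 0 -> ip (T x) y = 0.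
Proof.
move=> xS yS x0; apply: ip_null => //; first exact: TS.
by apply/le_anti; rewrite (ip_ge0 (TS xS)) (le_trans (T_bounded xS))// x0 mulr0.
Qed.

(** The component orthogonal to the family, not the one in its span. *)
Definition proj (e : nat -> V) n x := x - \sum_(i < n) ip x (e i) *: e i.

Lemma sumS n (e : nat -> V) (c : nat -> R) : (forall i, (i < n)%N -> S (e i)) -> S 0 ->
  S (\sum_(i < n) c i *: e i).
Proof.
move=> eS S0; elim: n eS => [|n IH] eS; first by rewrite big_ord0.
rewrite big_ord_recr /=; apply: SD; last by apply: SZ; exact: eS.
by apply: IH => i ni; apply: eS; exact: ltnW.
Qed.

Lemma ip_suml n (e : nat -> V) (c : nat -> R) z : (forall i, (i < n)%N -> S (e i)) -> S 0 -> S z ->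
  ip (\sum_(i < n) c i *: e i) z = \sum_(i < n) c i * ip (e i) z.
Proof.
move=> eS S0 zS; elim: n eS => [|n IH] eS.
  by rewrite !big_ord0 -(scale0r (0 : V)) ipZl// mul0r.
have eS' i : (i < n)%N -> S (e i) by move=> ni; apply: eS; exact: ltnW.
rewrite !big_ord_recr /= ipDl// ?IH// ?ipZl//; try exact: eS.
  exact: sumS.
by apply: SZ; exact: eS.
Qed.

Lemma T_sum n (e : nat -> V) (c : nat -> R) : (forall i, (i < n)%N -> S (e i)) -> S 0 ->
  T (\sum_(i < n) c i *: e i) = \sum_(i < n) c i *: T (e i).
Proof.
move=> eS S0; elim: n eS => [|n IH] eS.
  by have := TZ 0 S0; rewrite !big_ord0 !scale0r.
have eS' i : (i < n)%N -> S (e i) by move=> ni; apply: eS; exact: ltnW.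
rewrite !big_ord_recr /= TD// ?IH// ?TZ//; try exact: eS.
  exact: sumS.
by apply: SZ; exact: eS.
Qed.

Lemma sum_delta n (c : nat -> R) j : (j < n)%N -> \sum_(i < n) c i * (i == j :> nat)%:R = c j.
Proof.
move=> jn; rewrite (bigD1 (Ordinal jn))//= eqxx mulr1 big1 ?addr0// => i ij.
have /negbTE -> : (i != j :> nat) by move: ij; rewrite -val_eqE.
by rewrite mulr0.
Qed.

Lemma projP e n x : S 0 -> S x -> orthonormal e n ->
  S (proj e n x) /\ (forall j, (j < n)%N -> ip (proj e n x) (e j) = 0).
Proof.
move=> S0 xS [eS eo]; have sS := sumS (fun i => ip x (e i)) eS S0.
split; first exact: SB.
move=> j jn; rewrite ipBl//; last exact: eS.
rewrite (@ip_suml _ _ (fun i => ip x (e i)))//; last exact: eS.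
rewrite (eq_bigr (fun i : 'I_n => ip x (e i) * (i == j :> nat)%:R)); last first.
  by move=> i _; rewrite eo.
by rewrite (sum_delta (fun i => ip x (e i)) jn) subrr.
Qed.

Definition extend (e : nat -> V) n x := fun i => if i == n then x else e i.

Lemma orthonormal_extend e n p : S 0 -> orthonormal e n -> S p ->
  (forall j, (j < n)%N -> ip p (e j) = 0) -> ip p p = 1 -> orthonormal (extend e n p) n.+1.
Proof.
move=> S0 [eS eo] pS pe p1; split.
  by move=> i; rewrite ltnS /extend; case: eqP => // ine; rewrite leq_eqVlt => /orP[/eqP//|]; exact: eS.
move=> i j; rewrite /extend ltnS (leq_eqVlt i) ltnS (leq_eqVlt j).
move=> /orP[/eqP ->|ilt] /orP[/eqP ->|jlt].
- by rewrite eqxx p1.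
- by rewrite eqxx (ltn_eqF jlt) pe// eq_sym (ltn_eqF jlt).
- by rewrite eqxx (ltn_eqF ilt) ipC pe.
- by rewrite (ltn_eqF ilt) (ltn_eqF jlt) eo.
Qed.

Lemma normalize p : S p -> ip p p != 0 ->
  ip ((Num.sqrt (ip p p))^-1 *: p) ((Num.sqrt (ip p p))^-1 *: p) = 1.
Proof.
move=> pS p0; rewrite ip_normZ// exprVn sqr_sqrtr ?mulVf//; exact: ip_ge0.
Qed.

(** The form in which compactness of [K] is used: both arguments below construct more orthonormal
    vectors with long images than this count allows. *)
Lemma HS_bound n e c : orthonormal e n -> 0 <= c ->
  (forall i, (i < n)%N -> c <= ip (K (e i)) (K (e i))) -> n%:R * c <= kappa.
Proof.
move=> eo c0 H; apply: le_trans (K_hs eo).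
rewrite mulr_natl -[X in _ *+ X]card_ord -sumr_const; apply: ler_sum => i _; exact: H.
Qed.

Lemma archi_gt (x : R) : exists n : nat, x < n%:R.
Proof. by exists (Num.trunc `|x|).+1; rewrite (le_lt_trans (ler_norm _))// truncnS_gt. Qed.

Section injective.
Hypothesis T_surj : forall h, S h -> exists f, S f /\ ip (T f - h) (T f - h) = 0.

(* A nonzero kernel vector of [T] and surjectivity produce an infinite Jordan chain, i.e. an
   orthonormal sequence with [T e_i] orthogonal to [e_i], whence [|K e_i| >= 1]. *)
Lemma T_injective f : S f -> ip (T f) (T f) = 0 -> ip f f = 0.
Proof.
move=> fS Tf0; apply/eqP/negPn/negP => f0.
have S0 : S 0 by rewrite -(scale0r f); exact: SZ.
(* The second clause says weakly that [T (e i)] lies in the span of the earlier vectors, up to null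
   vectors: it is orthogonal to everything orthogonal to them. *)
pose chain e n := orthonormal e n /\
  forall i, (i < n)%N -> forall w, S w -> (forall j, (j < i)%N -> ip w (e j) = 0) -> ip (T (e i)) w = 0.
suff H n : exists e, chain e n.+1.
  have [N kN] := archi_gt kappa; have [e [eo Te]] := H N.
  have : N.+1%:R * 1 <= kappa.
    apply: (HS_bound eo) => // i iN; have eS := eo.1 _ iN.
    have eii : ip (e i) (e i) = 1 by rewrite eo.2// eqxx.
    have : ip (T (e i)) (e i) = 0.
      apply: Te => // j ji; rewrite eo.2//; last exact: ltn_trans iN.
      by rewrite (gtn_eqF ji).
    rewrite /T ipDl//; last exact: KS.
    rewrite eii => Kee; have := ip_cauchy (KS eS) eS; rewrite eii mulr1.
    by rewrite (_ : ip _ _ = -1); [rewrite sqrrN expr1n|lra].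
  by move: kN; rewrite mulr1 -natr1; lra.
elim: n => [|n [e [eo Te]]].
  exists (fun=> (Num.sqrt (ip f f))^-1 *: f); split.
    split; first by move=> i _; exact: SZ.
    by move=> i j; rewrite !ltnS !leqn0 => /eqP -> /eqP ->; rewrite eqxx normalize.
  move=> i _ w wS _; rewrite TZ// ipZl//; last exact: TS.
  by rewrite (ip_null (TS fS))// mulr0.
have enS : S (e n) by exact: eo.1.
(* The next vector is a preimage of [e n] made orthogonal to the chain. This correction changes its
   image only within the span of [e 0, ..., e (n - 1)], up to null vectors. *)
have [f' [f'S Tf']] := T_surj enS.
have [pS pe] := projP S0 f'S eo; set p := proj e n.+1 f' in pS pe.
have Tp w : S w -> (forall j, (j < n)%N -> ip w (e j) = 0) -> ip (T p) w = ip (e n) w.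
  move=> wS we; have sS := sumS (fun i => ip f' (e i)) eo.1 S0.
  rewrite /p /proj TB// ipBl//; try exact: TS.
  rewrite (@T_sum _ e (fun i => ip f' (e i)))//; last exact: eo.1.
  rewrite (@ip_suml _ (fun i => T (e i)) (fun i => ip f' (e i)))//; last first.
    by move=> i ni; apply: TS; exact: eo.1.
  rewrite big1 ?subr0; last first.
    move=> i _; rewrite Te ?mulr0// => j ji; apply: we.
    by apply: leq_trans ji _; rewrite -ltnS.
  have := ip_null (SB (TS f'S) enS) wS Tf'; rewrite ipBl//; last exact: TS.
  by move=> /eqP; rewrite subr_eq0 => /eqP.
(* A null [p] would have a null image, whereas [T p] has scalar product 1 with [e n]. *)
have p0 : ip p p != 0.
  apply/eqP => p0; have := ip_T_null pS enS p0; rewrite Tp//.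
    by rewrite eo.2// eqxx => /eqP; rewrite oner_eq0.
  by move=> j jn; rewrite eo.2 ?(gtn_eqF jn)//; exact: ltnW.
exists (extend e n.+1 ((Num.sqrt (ip p p))^-1 *: p)); split.
  apply: orthonormal_extend => //; first exact: SZ.
    by move=> j jn; rewrite ipZl ?pe ?mulr0//; exact: eo.1.
  exact: normalize.
move=> i; rewrite ltnS leq_eqVlt /extend => /orP[/eqP ->|ilt] w wS we.
  rewrite eqxx TZ// ipZl//; last exact: TS.
  have we' j : (j < n.+1)%N -> ip w (e j) = 0.
    by move=> jn; have := we _ jn; rewrite (ltn_eqF jn).
  rewrite Tp//; last by move=> j jn; apply: we'; exact: ltnW.
  by rewrite ipC we'// mulr0.
rewrite (ltn_eqF ilt); apply: Te => // j ji.
by have := we _ ji; rewrite (ltn_eqF (ltn_trans ji ilt)).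
Qed.

End injective.

Section lower_bound.
Hypothesis T_inj : forall f, S f -> ip (T f) (T f) = 0 -> ip f f = 0.
(** Completeness is asked only of images under [K]. This is enough because [v = T v - K v] recovers
    the convergence of [v] from that of [T v] and [K v]. *)
Hypothesis K_complete : forall v : nat -> V, (forall n, S (v n)) ->
  (forall eps : R, 0 < eps -> exists N : nat, forall m n, (N <= m)%N -> (N <= n)%N ->
    ip (v m - v n) (v m - v n) < eps) ->
  exists2 h, S h & forall eps : R, 0 < eps -> exists N : nat, forall n, (N <= n)%N ->
    ip (K (v n) - h) (K (v n) - h) < eps.

Definition below e n c := forall x, S x -> (forall j, (j < n)%N -> ip x (e j) = 0) ->
  c * ip x x <= ip (T x) (T x).

(** Otherwise unit vectors with [|T e|^2] at most [1/4] can be chosen one after another, each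
    orthogonal to the previous ones. For each of them [1 = |T e - K e|^2 <= 2 |T e|^2 + 2 |K e|^2]
    forces [|K e|^2 >= 1/4], against the count of [HS_bound]. *)
Lemma below_some (S0 : S 0) : exists n e, orthonormal e n /\ below e n 4^-1.
Proof.
apply: contrapT => H.
suff H2 n : exists e, orthonormal e n /\ forall i, (i < n)%N -> ip (T (e i)) (T (e i)) <= 4^-1.
  have [N kN] := archi_gt (4 * kappa); have [e [eo Te]] := H2 N.
  have : N%:R * 4^-1 <= kappa; last by lra.
  apply: (HS_bound eo) => // i iN; have eS := eo.1 _ iN.
  have eii : ip (e i) (e i) = 1 by rewrite eo.2// eqxx.
  have := ip_normB (TS eS) (KS eS); rewrite {1 2}/T addrK eii.
  by have := Te _ iN; lra.
elim: n => [|n [e [eo Te]]]; first by exists (fun=> 0).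
have /existsNP[x /not_implyP[xS /not_implyP[xe /negP]]] : ~ below e n 4^-1.
  by move=> b; apply: H; exists n, e.
rewrite -ltNge => Tx; have x0 : ip x x != 0.
  by apply/eqP => x0; move: Tx; rewrite x0 mulr0 ltNge ip_ge0//; exact: TS.
exists (extend e n ((Num.sqrt (ip x x))^-1 *: x)); split.
  apply: orthonormal_extend => //; first exact: SZ.
    by move=> j jn; rewrite ipZl ?xe ?mulr0//; exact: eo.1.
  exact: normalize.
move=> i; rewrite ltnS leq_eqVlt /extend => /orP[/eqP ->|ilt].
  rewrite eqxx TZ// ip_normZ; last exact: TS.
  rewrite exprVn sqr_sqrtr ?ip_ge0// mulrC ler_pdivrMr; first exact: ltW.
  by rewrite lt_neqAle eq_sym x0 ip_ge0.
by rewrite (ltn_eqF ilt) Te.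
Qed.

(** Let [W] be the orthogonal complement of [e 0, ..., e n]. If [T (e n)] stays at positive distance
    from [T W], the components of [x] along [e n] and in [W] are both controlled by [T x]. Otherwise
    [T (e n + v k)] tends to zero for some [v k] in [W], and [e n + v k] converges to a kernel
    vector whose scalar product with [e n] is 1, against injectivity. *)
Lemma below_drop e n c : S 0 -> orthonormal e n.+1 -> 0 < c -> below e n.+1 c ->
  exists2 c', 0 < c' & below e n c'.
Proof.
move=> S0 eo c0 b; have enS : S (e n) by exact: eo.1.
have enn : ip (e n) (e n) = 1 by rewrite eo.2// eqxx.
pose q v := ip (T (e n + v)) (T (e n + v)).
have [[d d0 dq]|H] := pselect (exists2 d, 0 < d &
    forall v, S v -> (forall j, (j < n.+1)%N -> ip v (e j) = 0) -> d <= q v).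
  pose tau := ip (T (e n)) (T (e n)).
  have tau0 : 0 <= tau by apply: ip_ge0; exact: TS.
  (* With [t] for [ip (T x) (T x)], found by inserting [d * a ^+ 2 <= t] and
     [c * ip v v <= 2 * t + 2 * (a ^+ 2 * tau)] into [ip x x <= 2 * ip v v + 2 * a ^+ 2]. *)
  pose M := (4 + 4 * tau / d) / c + 2 / d.
  have td : 0 <= tau / d by rewrite divr_ge0// ltW.
  have M0 : 0 < M.
    by rewrite /M addr_gt0 ?divr_gt0//; move: td; rewrite -mulrA; lra.
  exists M^-1; rewrite ?invr_gt0// => x xS xe.
  rewrite mulrC ler_pdivrMr//.
  pose a := ip x (e n); pose v := x - a *: e n.
  have aS : S (a *: e n) by exact: SZ.
  have vS : S v by exact: SB.
  have ve j : (j < n.+1)%N -> ip v (e j) = 0.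
    move=> jn; have ejS := eo.1 _ jn; rewrite ipBl// ipZl//.
    move: jn; rewrite ltnS leq_eqVlt => /orP[/eqP ->|jn]; first by rewrite enn mulr1 subrr.
    by rewrite xe// eo.2 ?(gtn_eqF jn) ?mulr0 ?subrr//; exact: ltnW.
  have xE : x = a *: e n + v by rewrite /v addrCA subrr addr0.
  set t := ip (T x) (T x).
  have dt : d * a ^+ 2 <= t.
    have [a0|a0] := eqVneq a 0; first by rewrite a0 expr0n mulr0; apply: ip_ge0; exact: TS.
    have -> : t = a ^+ 2 * q (a^-1 *: v).
      have avS : S (a^-1 *: v) by exact: SZ.
      rewrite /q -ip_normZ; last by apply: TS; exact: SD.
      have E : a *: (e n + a^-1 *: v) = x by rewrite scalerDr scalerA divff// scale1r -xE.
      by rewrite -TZ ?E//; exact: SD.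
    rewrite mulrC ler_wpM2l ?sqr_ge0//; apply: dq; first exact: SZ.
    by move=> j jn; rewrite ipZl ?ve ?mulr0//; exact: eo.1.
  have cv : c * ip v v <= 2 * t + 2 * (a ^+ 2 * tau).
    apply: le_trans (b _ vS ve) _; rewrite /v TB// TZ//.
    apply: le_trans (ip_normB (TS xS) (SZ a (TS enS))) _.
    by rewrite (ip_normZ a (TS enS)).
  have xx : ip x x <= 2 * ip v v + 2 * a ^+ 2.
    have := ip_normD aS vS; rewrite -xE ip_normZ// enn mulr1; lra.
  have ad : a ^+ 2 <= t / d by rewrite ler_pdivlMr// mulrC.
  have vv : ip v v <= (2 * t + 2 * (t / d * tau)) / c.
    rewrite ler_pdivlMr// mulrC (le_trans cv)// lerD2l ler_wpM2l//.
    by rewrite ler_wpM2r.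
  apply: le_trans xx _.
  have -> : t * M = 2 * ((2 * t + 2 * (t / d * tau)) / c) + 2 * (t / d).
    by rewrite /M; field; rewrite !gt_eqF.
  lra.
have {}H d : 0 < d -> exists v, [/\ S v, (forall j, (j < n.+1)%N -> ip v (e j) = 0) & q v < d].
  move=> d0; apply: contrapT => H2; apply: H; exists d => // v vS ve.
  by rewrite leNgt; apply/negP => qd; apply: H2; exists v.
exfalso.
have [v Hv] := choice (fun k : nat => H k.+1%:R^-1 (ltac:(by rewrite invr_gt0 ltr0Sn))).
have vS k : S (v k) by have [] := Hv k.
have ve k j : (j < n.+1)%N -> ip (v k) (e j) = 0 by have [_ + _] := Hv k; apply.
have qv k : q (v k) < k.+1%:R^-1 by have [] := Hv k.
have evS k : S (e n + v k) by exact: SD.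
have small (eps : R) : 0 < eps -> exists N : nat, forall k, (N <= k)%N -> q (v k) < eps.
  move=> eps0; have [N HN] := archi_gt eps^-1; exists N => k Nk.
  rewrite (lt_trans (qv k))// invf_plt ?posrE// (lt_trans HN)// ltr_nat ltnS.
  exact: Nk.
have Tm m k : ip (v m - v k) (v m - v k) <= (2 * q (v m) + 2 * q (v k)) / c.
  rewrite ler_pdivlMr// mulrC; apply: le_trans (b _ (SB (vS m) (vS k)) _) _.
    by move=> j jn; rewrite ipBl ?ve ?subrr//; exact: eo.1.
  have -> : v m - v k = (e n + v m) - (e n + v k) by rewrite opprD addrACA subrr add0r.
  by rewrite TB//; exact: ip_normB (TS (evS m)) (TS (evS k)).
have [h hS Hh] : exists2 h, S h & forall eps : R, 0 < eps -> exists N : nat, forall n, (N <= n)%N ->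
    ip (K (v n) - h) (K (v n) - h) < eps.
  apply: K_complete => // eps eps0.
  have [N HN] := small (eps * c / 4) (ltac:(by rewrite divr_gt0// mulr_gt0)).
  exists N => m k Nm Nk; apply: le_lt_trans (Tm m k) _.
  by rewrite ltr_pdivrMr//; have := HN m Nm; have := HN k Nk; lra.
(* The limit of [v k], read off from [v k = T (e n + v k) - T (e n) - K (v k)], whose first term
   tends to zero. *)
pose w := - T (e n) - h.
have wS : S w by apply: SB => //; apply: SN; exact: TS.
have ewS : S (e n + w) by exact: SD.
have vw k : v k - w = T (e n + v k) - (K (v k) - h).
  rewrite TD// /w (_ : T (v k) = v k + K (v k))//; move: (T (e n)) (v k) (K (v k)) => A B C.
  by rewrite !opprD !opprK !addrA addrK (addrC B).
have kap0 : 0 <= kappa by have := @K_hs 0 e; rewrite big_ord0; apply; split.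
have vw_small (eps : R) : 0 < eps -> exists k, ip (v k - w) (v k - w) < eps /\ q (v k) < eps.
  move=> eps0; have [N1 H1] := small (eps / 4) (ltac:(by rewrite divr_gt0)).
  have [N2 H2] := Hh (eps / 4) (ltac:(by rewrite divr_gt0)).
  exists (maxn N1 N2); have := H1 _ (leq_maxl N1 N2); have := H2 _ (leq_maxr N1 N2).
  set k := maxn N1 N2 => Hk1 Hk2; split; last by lra.
  rewrite vw; apply: le_lt_trans (ip_normB (TS (evS k)) (SB (KS (vS k)) hS)) _.
  by move: Hk2; rewrite /q; lra.
have Tw : ip (T (e n + w)) (T (e n + w)) = 0.
  apply/le_anti; rewrite (ip_ge0 (TS ewS)) andbT leNgt; apply/negP => pos.
  set p := ip _ _ in pos.
  (* The sum of the constants with which [q (v k)] and the square norm of [v k - w] bound [p];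
     making both smaller than [p / B] gives [p < p]. *)
  pose B := 2 + 2 * (2 + 2 * kappa) : R; have B0 : 0 < B by rewrite /B; lra.
  have [k [Hk1 Hk2]] := vw_small (p / B) (divr_gt0 pos B0).
  have : p < p; last by rewrite ltxx.
  have vkwS := SB (vS k) wS.
  have {1}-> : p = ip (T (e n + v k) - T (v k - w)) (T (e n + v k) - T (v k - w)).
    have E : e n + v k - (v k - w) = e n + w by rewrite opprB addrA addrAC addrK.
    by rewrite -TB// E.
  apply: le_lt_trans (ip_normB (TS (evS k)) (TS vkwS)) _.
  have := T_bounded vkwS; move: Hk1 Hk2; rewrite /q !ltr_pdivlMr// /B.
  move: (ip (v k - w) _) (ip (T (v k - w)) _) (ip (T (e n + v k)) _) => X Y Z H1 H2 H3.
  have : 2 * Y <= 2 * (2 + 2 * kappa) * X by lra.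
  have : X * kappa >= 0 \/ X * kappa < 0 by case: (lerP 0 (X * kappa)); [left|right].
  nra.
have ew0 : ip (e n + w) (e n) = 0 by apply: ip_null => //; exact: T_inj.
have [k [Hk _]] := vw_small 1 ltr01.
(* The [v k] are orthogonal to [e n], so they stay at distance at least 1 from [w], whose scalar
   product with [e n] is [-1]. *)
have := ip_cauchy (SB (vS k) wS) enS; rewrite enn mulr1 ipBl// ve// sub0r sqrrN.
move: ew0; rewrite ipDl// enn => ew0.
by rewrite (_ : ip w (e n) = -1) ?sqrrN ?expr1n; lra.
Qed.

(** The estimate known on the complement of finitely many vectors is extended by dropping them one
    at a time. *)
Lemma T_bounded_below : S 0 -> exists M : R, forall x, S x -> ip x x <= M * ip (T x) (T x).
Proof.
move=> S0; have [n [e [eo b]]] := below_some S0.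
suff [c c0 {}b] : exists2 c, 0 < c & below e 0 c.
  exists c^-1 => x xS; rewrite mulrC ler_pdivlMr// mulrC.
  exact: b.
have : exists2 c : R, 0 < c & below e n c by exists 4^-1 => //; rewrite invr_gt0.
elim: n eo {b} => // n IH eo [c c0 b]; apply: IH; last exact: (below_drop S0 eo c0 b).
split=> [i ni|i j ni nj]; [apply: eo.1|apply: eo.2]; exact: ltnW.
Qed.

End lower_bound.
End fredholm.

(** * Square integrable real functions *)

Section square_integrable.
Variable R : realType.
Local Notation mu := (@lebesgue_measure R).

Definition L2r (f : R -> R) := mf f /\ Li (fun x => f x ^+ 2).

Lemma mfD (f h : R -> R) : mf f -> mf h -> mf (fun x => f x + h x).
Proof. exact: measurable_funD. Qed.
Lemma mfB (f h : R -> R) : mf f -> mf h -> mf (fun x => f x - h x).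
Proof. exact: measurable_funB. Qed.
Lemma mfM (f h : R -> R) : mf f -> mf h -> mf (fun x => f x * h x).
Proof. exact: measurable_funM. Qed.
Lemma mf_sqr (f : R -> R) : mf f -> mf (fun x => f x ^+ 2).
Proof. exact: measurable_funX. Qed.
Lemma mf_cst (k : R) : mf (fun=> k).
Proof. exact: measurable_cst. Qed.
Lemma mf_id : mf (@id R).
Proof. exact: measurable_id. Qed.
Lemma eq_mf (f h : R -> R) : f =1 h -> mf f -> mf h.
Proof. by move=> fh; rewrite (_ : f = h)//; exact/funext. Qed.
Lemma continuous_mf (f : R -> R) : continuous f -> mf f.
Proof. exact: continuous_measurable_fun. Qed.

Lemma Li_bounded_mul (f h : R -> R) (C : R) : mf f -> (forall x, `|f x| <= C) -> Li h ->
  Li (fun x => f x * h x).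
Proof.
move=> f_m fC hi; apply: (Li_le (h := fun x => C * `|h x|)).
- by apply: mfM => //; exact: Li_meas.
- by apply: LiZ; exact: Li_norm.
- by move=> x; rewrite normrM ler_wpM2r.
Qed.

Lemma Li_indM a b (h : R -> R) : Li h -> Li (fun x => ind a b x * h x).
Proof.
apply: (@Li_bounded_mul _ _ 1); first exact: measurable_ind.
by move=> x; rewrite ger0_norm ?ind_ge0 ?ind_le1.
Qed.

Lemma sqr_absM (a b : R) : `|a * b| <= a ^+ 2 + b ^+ 2.
Proof.
rewrite normrM -(real_normK (num_real a)) -(real_normK (num_real b)).
by have := sqr_ge0 (`|a| - `|b|); have := normr_ge0 a; have := normr_ge0 b; nra.
Qed.

Lemma L2r_Li (f h : R -> R) : L2r f -> L2r h -> Li (fun x => f x * h x).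
Proof.
move=> [f_m fi] [h_m hi]; apply: (Li_le (h := fun x => f x ^+ 2 + h x ^+ 2)).
- exact: mfM.
- exact: LiD.
- by move=> x; exact: sqr_absM.
Qed.

Lemma L2rD (f h : R -> R) : L2r f -> L2r h -> L2r (fun x => f x + h x).
Proof.
move=> fL hL; split; first by apply: mfD; [exact: fL.1|exact: hL.1].
have := LiD (LiD fL.2 hL.2) (LiZ 2 (L2r_Li fL hL)).
by apply: eq_Li => x; ring.
Qed.

Lemma L2rZ k (f : R -> R) : L2r f -> L2r (fun x => k * f x).
Proof.
move=> fL; split; first by apply: mfM; [exact: mf_cst|exact: fL.1].
by have := LiZ (k ^+ 2) fL.2; apply: eq_Li => x; ring.
Qed.

Lemma L2rB (f h : R -> R) : L2r f -> L2r h -> L2r (fun x => f x - h x).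
Proof.
move=> fL /(L2rZ (-1)) hL; have := L2rD fL hL.
by under eq_fun do rewrite mulN1r.
Qed.

Lemma L2r_shift a (f : R -> R) : L2r f -> L2r (fun x => f (x + a)).
Proof. by move=> fL; split; [exact: mf_shift fL.1|exact: (Li_shift a fL.2)]. Qed.

Lemma L2r_refl a (f : R -> R) : L2r f -> L2r (fun x => f (a - x)).
Proof. by move=> fL; split; [exact: mf_refl fL.1|exact: (Li_refl a fL.2)]. Qed.

Lemma eq_L2r (f h : R -> R) : f =1 h -> L2r f -> L2r h.
Proof. by move=> fh; rewrite (_ : f = h)//; exact/funext. Qed.

Lemma L2r_dom (f h : R -> R) : mf f -> L2r h -> (forall x, `|f x| <= `|h x|) -> L2r f.
Proof.
move=> f_m hL fh; split => //; apply: (Li_le _ hL.2); first exact: mf_sqr.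
move=> x; rewrite ger0_norm ?sqr_ge0//.
by rewrite -(real_normK (num_real (f x))) -(real_normK (num_real (h x))) lerXn2r ?nnegrE.
Qed.

Lemma L2r_ind a b : L2r (ind a b).
Proof.
split; first exact: measurable_ind.
by have := Li_ind a b; apply: eq_Li => x; rewrite /ind; case: (_ && _); rewrite ?expr1n ?expr0n.
Qed.

Lemma L2r_indM a b (h : R -> R) : L2r h -> L2r (fun x => ind a b x * h x).
Proof.
move=> hL; apply: (L2r_dom _ hL); first by apply: mfM; [exact: measurable_ind|exact: hL.1].
by move=> x; rewrite normrM ger0_norm ?ind_ge0// ler_piMl// ind_le1.
Qed.

Lemma L2r_bounded a b (h : R -> R) (C : R) : mf h -> (forall x, `|h x| <= C) ->
  L2r (fun x => ind a b x * h x).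
Proof.
move=> h_m hC; apply: (L2r_dom _ (L2rZ C (L2r_ind a b))).
  by apply: mfM => //; exact: measurable_ind.
move=> x; have C0 : 0 <= C by exact: le_trans (hC x).
by rewrite !normrM mulrC ler_wpM2r// (ger0_norm C0).
Qed.

Lemma RI_cauchy (f h : R -> R) : L2r f -> L2r h ->
  RI (fun x => f x * h x) ^+ 2 <= RI (fun x => f x ^+ 2) * RI (fun x => h x ^+ 2).
Proof.
move=> fL hL; apply: discriminant_le; first by apply: RI_ge0 => x; exact: sqr_ge0.
move=> a b; have fhi := L2r_Li fL hL; have [_ fi] := fL; have [_ hi] := hL.
rewrite -!RIZ// -RIB ?(LiZ (a ^+ 2) fi) ?(LiZ (2 * a * b) fhi)//; try exact: LiZ.
rewrite -RID; [|by apply: LiB; exact: LiZ|exact: LiZ].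
apply: RI_ge0 => x.
have -> : a ^+ 2 * f x ^+ 2 - 2 * a * b * (f x * h x) + b ^+ 2 * h x ^+ 2 = (a * f x - b * h x) ^+ 2 by ring.
exact: sqr_ge0.
Qed.

Lemma RI_ae0 (f : R -> R) : L2r f -> RI (fun x => f x ^+ 2) = 0 -> {ae mu, forall x, f x = 0}.
Proof.
move=> fL f0.
have H : (\int[mu]_x `|(f x ^+ 2)%:E|)%E = 0%E.
  transitivity ((RI (fun x => f x ^+ 2))%:E); last by rewrite f0.
  rewrite (RI_fineE fL.2); apply: eq_integral => x _.
  by rewrite /= ger0_norm ?sqr_ge0.
have m2 : measurable_fun setT (fun x => (f x ^+ 2)%:E).
  by apply/measurable_EFinP; exact: mf_sqr fL.1.
have := (ae_eq_integral_abs mu measurableT m2).1 H.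
by apply: aeS => x /= /(_ I) /eqP; rewrite eqe sqrf_eq0 => /eqP.
Qed.

Lemma FTC_ind (F f : R -> R) (a b : R) : a <= b -> continuous f ->
  (forall x : R, is_derive x (1 : R) F (f x)) -> RI (fun x => ind a b x * f x) = F b - F a.
Proof.
rewrite le_eqVlt => /predU1P[<- _ _|ab cf dF].
  rewrite subrr (eq_RI (h := fun=> 0)) ?RI0// => x.
  rewrite ind0 ?mul0r//; apply/negP => /andP[h1 h2]; by have := lt_trans h1 h2; rewrite ltxx.
have cF : continuous F.
  by move=> x; apply: differentiable_continuous; apply/derivable1_diffP; have [] := dF x.
have cfw : {within `[a, b], continuous f} by exact: continuous_subspaceT.
have := @continuous_FTC2 R f F a b ab cfw.
have dLR : derivable_oo_LRcontinuous F a b.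
  split; first by move=> x _; have [] := dF x.
  - by apply: cvg_at_right_filter; exact: cF.
  - by apply: cvg_at_left_filter; exact: cF.
have F'f : {in `]a, b[, F^`()%classic =1 f}.
  by move=> x _; rewrite derive1E; apply: derive_val.
move=> /(_ dLR F'f) H.
have fi : mu.-integrable `[a, b] (EFin \o f).
  by apply: continuous_compact_integrable => //; exact: segment_compact.
rewrite -Rintegral_ind Rintegral_itv_bndo_bndc; last first.
  by apply: integrableS fi => //; exact: subset_itv_oo_cc.
rewrite Rintegral_itv_obnd_cbnd; last first.
  by apply: integrableS fi => //; apply: subset_itvr; rewrite bnd_simp.
by rewrite /Rintegral H.
Qed.

(** The factor [1 / k] is the gain that makes integral terms contractive in norms with exponential
    weights; the reflected version serves the backward problem. *)
Lemma RI_expR (k a b : R) : 0 < k -> a <= b ->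
  RI (fun s => ind a b s * expR (k * s)) <= expR (k * b) / k.
Proof.
move=> k0 ab.
have cE : continuous (fun s : R => expR (k * s)).
  by move=> x; apply: continuous_comp; [exact: mulrl_continuous|exact: continuous_expR].
have dE (x : R) : is_derive x (1 : R) (fun s => expR (k * s) / k) (expR (k * x)).
  have d1 : is_derive x (1 : R) (fun s : R => k * s) k.
    by apply: is_derive_eq; rewrite /GRing.scale/= mulr1.
  have d2 : is_derive (k * x) (1 : R) expR (expR (k * x)) by exact: is_derive_expR.
  have d3 := is_derive1_comp d2 d1.
  have -> : (fun s => expR (k * s) / k) = k^-1 \*: (expR \o (fun s => k * s)).
    by apply/funext => s /=; rewrite mulrC.
  apply: is_derive_eq; rewrite /GRing.scale/=; field.
  by rewrite gt_eqF.
by rewrite (FTC_ind ab cE dE) lerBlDr lerDl divr_ge0 ?expR_ge0// ltW.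
Qed.

Lemma RI_expR_refl (k a b : R) : 0 < k -> a <= b ->
  RI (fun s => ind a b s * expR (k * (b - s))) <= expR (k * (b - a)) / k.
Proof.
move=> k0 ab.
have <- : RI (fun s => ind 0 (b - a) s * expR (k * s)) = RI (fun s => ind a b s * expR (k * (b - s))).
  rewrite -(RI_refl b); last first.
    apply: mfM; first exact: measurable_ind.
    by apply: mf_comp; [exact: measurable_expR|apply: mfM; [exact: mf_cst|exact: mf_id]].
  apply: eq_RI => s; congr (_ * _); rewrite /ind subr_gt0 ltrD2l ltrN2.
  by rewrite andbC.
by apply: RI_expR => //; rewrite subr_ge0.
Qed.

Lemma RI_dominated (f_ : nat -> R -> R) (f h : R -> R) : (forall n, mf (f_ n)) -> mf f ->
  (forall x, f_ n x @[n --> \oo] --> f x) -> Li h -> (forall n x, `|f_ n x| <= h x) ->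
  RI (f_ n) @[n --> \oo] --> RI f.
Proof.
move=> f_m fm cf hi fh.
have [] := @dominated_convergence _ _ R mu setT measurableT (fun n x => (f_ n x)%:E)
    (fun x => (f x)%:E) (fun x => (h x)%:E).
- by move=> n; apply/measurable_EFinP; exact: f_m.
- by apply/measurable_EFinP; exact: fm.
- by apply: aeW => x _; apply: cvg_EFin; [exact: nearW|exact: cf].
- exact: hi.
- by apply: aeW => x n _; rewrite lee_fin.
move=> fi _; rewrite /RI /Rintegral => H; apply: fine_cvg.
by rewrite fineK; [exact: H|exact: integrable_fin_num].
Qed.

(** After [h] is cut off up to [tau], its primitive vanishes identically, while Lebesgue
    differentiation says that its derivative is the cut-off [h] almost everywhere. *)
Lemma ae0_of_tails (h : R -> R) (tau : R) : Li h ->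
  (forall a, tau <= a -> RI (fun x => (a < x)%R%:R * h x) = 0) ->
  {ae mu, forall x, tau < x -> h x = 0}.
Proof.
move=> hi H0; pose k x := (tau < x)%R%:R * h x.
have mt a : mf (fun x : R => (a < x)%R%:R).
  apply: (eq_measurable_fun (\1_(`]a, +oo[%classic : set R) : R -> R)).
    by move=> x _; rewrite indicE mem_setE in_itv/= andbT.
  exact: measurable_indic.
have Lit a (u : R -> R) : Li u -> Li (fun x => (a < x)%R%:R * u x).
  apply: (@Li_bounded_mul _ _ 1) => // x.
  by case: (a < x); rewrite ?normr1 ?normr0.
have ki : Li k by exact: Lit.
have tail a : RI (fun x => (a < x)%R%:R * k x) = 0.
  have [ta|ta] := leP tau a.
    rewrite -(H0 _ ta); apply: eq_RI => x; rewrite /k.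
    by case: ltP => [ax|]; rewrite ?mul0r// (le_lt_trans ta ax) !mul1r.
  rewrite -(H0 _ (lexx tau)); apply: eq_RI => x; rewrite /k.
  by case: (ltP tau x) => [ax|]; rewrite ?mul0r ?mulr0// (lt_trans ta ax) !mul1r.
have kiA (A : set R) : measurable A -> mu.-integrable A (EFin \o k).
  by move=> mA; apply: integrableS ki.
have := @FTC1Ny R k (fun y => kiA `]-oo, y]%classic (measurable_itv _))
  (open_integrable_locally openT ki).
have F0 y : Rintegral mu `]-oo, y]%classic k = 0.
  have -> : Rintegral mu `]-oo, y]%classic k = RI k - RI (fun x => (y < x)%R%:R * k x).
    rewrite -RIB//; last exact: Lit.
    rewrite Rintegral_mkcond; apply: eq_RI => x; rewrite patchE mem_setE in_itv/=.
    by rewrite [y < x]ltNge; case: (x <= y) => /=; rewrite ?mul1r ?mul0r ?subr0 ?subrr.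
  rewrite tail subr0 -(tail tau); apply: eq_RI => x; rewrite /k.
  by case: ltP; rewrite ?mul1r ?mul0r.
have -> : (fun x => Rintegral mu [set` `]-oo, x]] k) = (fun=> 0) by apply/funext.
apply: aeS => x /= [_]; rewrite derive1_cst /k => + tx.
by rewrite tx mul1r.
Qed.

End square_integrable.

(** * Continuity of translations in the mean *)

Section translation_continuity.
Variable R : realType.
Local Notation mu := (@lebesgue_measure R).

(** Dominated convergence speaks of sequences; this turns its conclusion into a modulus of
    continuity. *)
Lemma seq_to_delta (G : R -> R) :
  (forall h : nat -> R, h n @[n --> \oo] --> 0 -> G (h n) @[n --> \oo] --> 0) ->
  forall eps, 0 < eps -> exists2 d : R, 0 < d & forall x, `|x| < d -> `|G x| < eps.
Proof.
move=> H eps eps0; apply: contrapT => /forall2NP Hd.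
have {}Hd (n : nat) : exists x, `|x| < n.+1%:R^-1 /\ eps <= `|G x|.
  have [] := Hd n.+1%:R^-1; first by rewrite invr_gt0 ltr0Sn.
  move=> /existsNP[x /not_implyP[x1 /negP x2]]; exists x; split => //.
  by rewrite leNgt.
have [h Hh] := choice Hd.
have hc : h n @[n --> \oo] --> 0.
  apply/cvgrPdist_lt => e e0; near=> n; rewrite sub0r normrN.
  apply: lt_trans (Hh n).1 _; near: n.
  by have := near_infty_natSinv_lt (PosNum e0).
have /cvgrPdist_lt /(_ _ eps0) [N _ HN] := H _ hc.
have := HN N (leqnn N); rewrite sub0r normrN ltNge.
by rewrite (Hh N).2.
Unshelve. all: by end_near. Qed.

Lemma continuous_bounded (g : R -> R) (N : R) : continuous g ->
  exists C, forall x, `|x| <= N -> `|g x| <= C.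
Proof.
move=> cg.
have cgw : {within `[-N, N], continuous g} by exact: continuous_subspaceT.
have := compact_bounded (continuous_compact cgw (@segment_compact _ _ _)).
move=> [C [_ HC]]; exists (C + 1) => x xN.
by apply: (HC (C + 1)); [rewrite ltrDl|exists x => //=; rewrite in_itv/= -ler_norml].
Qed.

(** On a bounded interval [v] is close in mean to a continuous [g], for which dominated convergence
    applies. The error [e] occurs twice, once translated, with the same integral. *)
Lemma translation_L1 (v : R -> R) (N : R) : 0 < N -> mf v -> (forall x, `|v x| <= N) ->
  (forall x, N < `|x| -> v x = 0) ->
  forall eps, 0 < eps -> exists2 d : R, 0 < d & forall h, `|h| < d ->
    RI (fun x => `|v (x + h) - v x|) < eps.
Proof.
move=> N0 v_m vN v0 eps eps0.
(* Wide enough to contain both [x] and [x + h] when [|x| < N + 1] and [|h| < 1]. *)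
pose E := (`[-(N + 2), N + 2]%classic : set R).
have vi : Li v.
  have := L2r_ind (-(N + 1)) (N + 1).
  move=> [_ /(Li_bounded_mul v_m vN)]; apply: eq_Li => x; rewrite ind_ifE.
  case: ifPn => H /=; first by rewrite expr1n mulr1.
  rewrite expr0n mulr0 v0//; apply: contraNT H; rewrite -leNgt ler_norml => /andP[? ?].
  by apply/andP; split; lra.
have mE : measurable E by exact: measurable_itv.
have muE : (mu E < +oo)%E.
  by rewrite /E [X in (X < _)%E](lebesgue_measure_itv `[-(N + 2), N + 2])/=; case: ifP => _; rewrite -?EFinD ltry.
have viE : mu.-integrable E (EFin \o v) by apply: integrableS vi.
have [g_ [cg gi cvg]] := @approximation_continuous_integrable R E v mE muE viE.
have [n Hn] : exists n, (\int[mu]_(z in E) `|(v z - g_ n z)%:E| < (eps / 4)%:E)%E.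
  have e4 : 0 < eps / 4 by rewrite divr_gt0.
  move/fine_cvgP : cvg => [fin /cvgrPdist_lt /(_ _ e4) H].
  have [n _ Hn] := filterI fin H; exists n; have [/= h1 h2] := Hn n (leqnn n).
  rewrite -(fineK h1) lte_fin; move: h2; rewrite sub0r normrN.
  by apply: le_lt_trans; exact: ler_norm.
set g := g_ n in Hn; have {}cg : continuous g by exact: cg.
have {}gi : mu.-integrable E (EFin \o g) by exact: gi.
pose e := (fun x => `|v x - g x|) \_ E.
have ei : Li e.
  have H : mu.-integrable E (EFin \o (fun x => `|v x - g x|)).
    apply: (@integrable_norm _ _ _ mu E (fun x => v x - g x)).
    have mE' : measurable (E : set (measurableTypeR R)) by exact: mE.
    exact: (integrableB mE' viE gi).
  have /integrable_mkcond -/(_ mE) := H.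
  by rewrite restrict_EFin.
have RIe : RI e < eps / 4.
  by rewrite -lte_fin RI_fineE// (_ : (\int[mu]_x _)%E = (\int[mu]_(z in E) `|(v z - g z)%:E|)%E)//
    [in RHS]integral_mkcond; apply: eq_integral => x _; rewrite /e !patchE; case: ifP.
pose G h := RI (fun x => ind (-(N + 1)) (N + 1) x * `|g (x + h) - g x|).
have mg : mf g by exact: continuous_mf.
have [d d0 Hd] : exists2 d : R, 0 < d & forall h, `|h| < d -> `|G h| < eps / 2.
  apply: (@seq_to_delta G); last by rewrite divr_gt0.
  move=> h hc.
  have [H0 hH] : exists H0, forall n, `|h n| <= H0.
    have /cvg_seq_bounded [M [_ HM]] : cvgn h by apply/cvg_ex; exists 0.
    by exists (M + 1) => k; apply: (HM (M + 1)) => //; rewrite ltrDl.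
  have [C HC] := @continuous_bounded g (N + 1 + H0) cg.
  rewrite -(RI0 R); apply: (@RI_dominated _ _ _ (fun x => 2 * C * ind (-(N + 1)) (N + 1) x)).
  - move=> k; apply: mfM; first exact: measurable_ind.
    by apply: mf_norm; apply: mfB => //; exact: mf_shift.
  - exact: mf_cst.
  - move=> x; rewrite -[X in _ --> X](mulr0 (ind (-(N + 1)) (N + 1) x)) -[X in _ * X](normr0 R) -(subrr (g x)).
    apply: cvgM; first exact: cvg_cst.
    apply: cvg_norm; apply: cvgB; last exact: cvg_cst.
    have : (x + h k) @[k --> \oo] --> x by rewrite -[X in _ --> X]addr0; apply: cvgD => //; exact: cvg_cst.
    move=> xh; exact: (cvg_comp _ _ xh (cg x)).
  - by apply: LiZ; exact: Li_ind.
  - move=> k x; rewrite ind_ifE; case: ifPn => [/andP[x1 x2]|_] /=; last by rewrite !mul0r normr0 mulr0.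
    rewrite mul1r mulr1 normr_id (le_trans (ler_normB _ _))//.
    have xx : `|x| <= N + 1 by rewrite ler_norml; apply/andP; split; lra.
    have h0 : 0 <= H0 by exact: le_trans (hH 0%N).
    have := HC x; have := HC (x + h k).
    have : `|x + h k| <= N + 1 + H0 by rewrite (le_trans (ler_normD _ _))// lerD.
    by move=> A /(_ A) B /(_ _) D; have := D (ltac:(by lra)); lra.
exists (Num.min d 1); first by rewrite lt_min d0 ltr01.
move=> h; rewrite lt_min => /andP[hd h1].
have ei' := Li_shift h ei; have vi' := Li_shift h vi.
have Gi : Li (fun x => ind (-(N + 1)) (N + 1) x * `|g (x + h) - g x|).
  have [C HC] := @continuous_bounded g (N + 2) cg.
  apply: (Li_le (h := fun x => 2 * C * ind (-(N + 1)) (N + 1) x)).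
  - apply: mfM; first exact: measurable_ind.
    by apply: mf_norm; apply: mfB => //; exact: mf_shift.
  - by apply: LiZ; exact: Li_ind.
  - move=> x; rewrite ind_ifE; case: ifPn => [/andP[x1 x2]|_] /=; last by rewrite !mul0r normr0 mulr0.
    rewrite mul1r mulr1 normr_id (le_trans (ler_normB _ _))//.
    have xx : `|x| <= N + 1 by rewrite ler_norml; apply/andP; split; lra.
    have := HC x; have := HC (x + h).
    have : `|x + h| <= N + 2 by rewrite (le_trans (ler_normD _ _))//; lra.
    by move=> A /(_ A) B /(_ _) D; have := D (ltac:(by lra)); lra.
apply: (@le_lt_trans _ _ (RI (fun x => e (x + h) + e x + ind (-(N + 1)) (N + 1) x * `|g (x + h) - g x|))).
  apply: RI_le; [by apply: Li_norm; exact: LiB|by apply: LiD => //; exact: LiD|].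
  move=> x; have e0 y : 0 <= e y by rewrite /e patchE; case: ifP.
  have [xN|xN] := leP (N + 1) `|x|.
    rewrite (v0 x); last by lra.
    rewrite (v0 (x + h)) ?subrr ?normr0 ?addr_ge0 ?mulr_ge0 ?ind_ge0//.
    by have := lerB_normD x h; lra.
  move: xN; rewrite ltr_norml => /andP[x1 x2]; rewrite indE ?x1 ?x2// mul1r.
  move: (h1); rewrite ltr_norml => /andP[h2 h3].
  rewrite /e !patchE !mem_setE !in_itv/= !ifT; [|by apply/andP; split; lra..].
  have -> : v (x + h) - v x = (v (x + h) - g (x + h)) - (v x - g x) + (g (x + h) - g x) by ring.
  by rewrite (le_trans (ler_normD _ _))// lerD2r (le_trans (ler_normB _ _)).
rewrite RID//; last exact: LiD.
rewrite RID// (RI_shift h (Li_meas ei)).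
have := Hd _ hd; rewrite ltr_norml => /andP[_]; rewrite /G; lra.
Qed.

(** Truncating both the variable and the value leaves a bounded function [c] of bounded support.
    There the square of [c (x + h) - c x] is at most [2 * N] times its absolute value, which reduces
    the claim to the mean of order one. *)
Lemma translation_L2 (w : R -> R) : L2r w -> forall eps, 0 < eps ->
  exists2 d : R, 0 < d & forall h, `|h| < d -> RI (fun x => (w (x + h) - w x) ^+ 2) < eps.
Proof.
move=> wL eps eps0; have [w_m wi] := wL.
pose cut n x := ind (- n.+1%:R) n.+1%:R x * ind (- n.+1%:R) n.+1%:R (w x) * w x.
have cut_m n : mf (cut n).
  apply: mfM => //; apply: mfM; first exact: measurable_ind.
  by apply: (mf_comp (f := ind _ _)) => //; exact: measurable_ind.
have cutP n x : cut n x = 0 \/ cut n x = w x.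
  by rewrite /cut !ind_ifE; case: ifP => _; case: ifP => _; rewrite ?(mul0r, mul1r); [right|left|left|left].
have [n Hn] : exists n, RI (fun x => (w x - cut n x) ^+ 2) < eps / 12.
  have : RI (fun x => (w x - cut n x) ^+ 2) @[n --> \oo] --> RI (fun=> 0 : R).
    apply: (@RI_dominated _ _ _ (fun x => w x ^+ 2)) => //.
    - by move=> n; apply: mf_sqr; exact: mfB.
    - exact: mf_cst.
    - move=> x; apply/cvgrPdist_lt => e e0; near=> n.
      have nx : `|x| + `|w x| < n.+1%:R.
        rewrite (lt_le_trans (truncnS_gt _))// ler_nat ltnS.
        by near: n; exact: nbhs_infty_ge.
      have -> : cut n x = w x.
        rewrite /cut !indE ?mul1r// -ltr_norml; apply: le_lt_trans nx.
          by rewrite lerDr.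
        by rewrite lerDl.
      by rewrite subrr expr0n/= subrr normr0.
    - move=> n x; rewrite ger0_norm ?sqr_ge0//.
      by case: (cutP n x) => ->; rewrite ?subr0// subrr expr0n/= sqr_ge0.
  rewrite RI0 => /cvgrPdist_lt /(_ (eps / 12)) [|N _ HN]; first by rewrite divr_gt0.
  by exists N; have := HN N (leqnn N); rewrite sub0r normrN; apply: le_lt_trans; exact: ler_norm.
set c := cut n in Hn; pose N := n.+1%:R : R.
have N0 : 0 < N by rewrite ltr0Sn.
have cN x : `|c x| <= N.
  rewrite /c /cut !ind_ifE; case: ifP => _ /=; last by rewrite !mul0r normr0 ltW.
  case: ifP => /= H; last by rewrite mulr0 mul0r normr0 ltW.
  by rewrite !mul1r ltW// ltr_norml.
have c0 x : N < `|x| -> c x = 0.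
  move=> Nx; rewrite /c /cut ind0 ?mul0r// -ltr_norml -leNgt; exact: ltW.
(* The square of a sum of three terms costs a factor 3, and the bounded term another [2 * N]: it
   takes half of [eps], and the two truncation errors together take the other half. *)
have [d d0 Hd] := @translation_L1 c N N0 (cut_m n) cN c0 (eps / (12 * N)) (ltac:(by rewrite divr_gt0// mulr_gt0)).
exists d => // h hd; have {Hd}Hd := Hd h hd.
have cL : L2r c.
  by apply: (L2r_dom (cut_m n) wL) => x; rewrite /c; case: (cutP n x) => ->; rewrite ?normr0.
have rL := L2rB wL cL; have rL' := L2r_shift h rL.
have dL := L2rB (L2r_shift h cL) cL.
have di : Li (fun x => `|c (x + h) - c x|).
  have ci : Li c.
    have := Li_bounded_mul (cut_m n) cN (L2r_ind (- N) N).2; apply: eq_Li => x.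
    rewrite /c /cut -/N !ind_ifE; case: ifP => _ /=; rewrite ?expr1n ?mulr1// !mul0r.
    by [].
  by apply: Li_norm; apply: LiB => //; exact: Li_shift.
have bi := LiD (LiD (LiZ 3 rL'.2) (LiZ 3 rL.2)) (LiZ (6 * N) di).
apply: le_lt_trans (RI_le (L2rB (L2r_shift h wL) wL).2 bi _) _.
  move=> x.
  have H1 : (c (x + h) - c x) ^+ 2 <= 2 * N * `|c (x + h) - c x|.
    rewrite -(real_normK (num_real _)) expr2 ler_wpM2r//.
    by rewrite (le_trans (ler_normB _ _))//; have := cN x; have := cN (x + h); lra.
  have -> : w (x + h) - w x = (w (x + h) - c (x + h)) - (w x - c x) + (c (x + h) - c x) by ring.
  move: H1; set p := w (x + h) - _; set q := w x - _; set r := c (x + h) - c x.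
  move=> H1.
  have : (p - q + r) ^+ 2 <= 3 * p ^+ 2 + 3 * q ^+ 2 + 3 * r ^+ 2.
    by have := sqr_ge0 (p + q); have := sqr_ge0 (p - r); have := sqr_ge0 (q + r); nra.
  have : 6 * N * `|r| = 3 * (2 * N * `|r|) by ring.
  lra.
rewrite (RID (LiD (LiZ 3 rL'.2) (LiZ 3 rL.2)) (LiZ (6 * N) di)).
rewrite (RID (LiZ 3 rL'.2) (LiZ 3 rL.2)) (RIZ 3 rL'.2) (RIZ 3 rL.2) (RIZ (6 * N) di).
rewrite (@RI_shift _ h (fun x => (w x - c x) ^+ 2)); last exact: mf_sqr rL.1.
have : 6 * N * RI (fun x => `|c (x + h) - c x|) < eps / 2.
  move: Hd; rewrite ltr_pdivlMr ?mulr_gt0//; lra.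
move: Hn; rewrite -/c; lra.
Unshelve. all: by end_near. Qed.

End translation_continuity.

(** * Joint measurability of Caratheodory functions *)

Section caratheodory.
Variable R : realType.

Lemma measurable_step (a b : R) : mf (fun s : R => (a <= s < b)%R%:R : R).
Proof.
apply: (eq_measurable_fun (\1_(`[a, b[%classic : set R) : R -> R)).
  by move=> x _; rewrite indicE mem_setE in_itv.
exact: measurable_indic.
Qed.

(** A pointwise limit of functions that freeze [s] at the grid point of mesh [1 / (n + 1)] to its
    left, each a finite sum of products. It extracts joint measurability of sources from the
    continuity of states in time. *)
Lemma caratheodory (f : R -> R -> R) (T : R) : 0 <= T -> (forall s, mf (f s)) ->
  (forall s x, ~~ (0 <= s <= T) -> f s x = 0) ->
  (forall x s0, 0 <= s0 <= T -> forall eps, 0 < eps -> exists2 d : R, 0 < d &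
    forall s, 0 <= s <= T -> `|s - s0| < d -> `|f s x - f s0 x| < eps) -> mf2 f.
Proof.
move=> T0 f_m f0 fc.
pose pt (n k : nat) := k%:R / n.+1%:R : R.
pose f_ (n : nat) (p : R * R) :=
  \sum_(k < (Num.trunc (T * n.+1%:R)).+1) (pt n k <= p.1 < pt n k.+1)%R%:R * f (pt n k) p.2.
have n0 (n : nat) : 0 < n.+1%:R :> R by rewrite ltr0Sn.
have ptP n k s : 0 <= s -> (pt n k <= s < pt n k.+1) = (k == Num.trunc (s * n.+1%:R)).
  move=> s0; rewrite /pt ler_pdivrMr// ltr_pdivlMr//.
  have sn0 : 0 <= s * n.+1%:R by rewrite mulr_ge0// ltW.
  apply/idP/eqP => [H|->]; last exact: (trunc_itv sn0).
  by apply/esym/trunc_def.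
(* The finite sum can miss the cell of [s] only beyond [T], where [f] vanishes anyway. *)
have f_E n s x : 0 <= s -> f_ n (s, x) = f (pt n (Num.trunc (s * n.+1%:R))) x \/
    (T < s /\ f_ n (s, x) = 0).
  move=> s0; rewrite /f_ /=.
  have [H|H] := ltnP (Num.trunc (s * n.+1%:R)) (Num.trunc (T * n.+1%:R)).+1.
    left; rewrite (bigD1 (Ordinal H))//= ptP// eqxx mul1r big1 ?addr0// => i.
    by rewrite -val_eqE/= ptP// => /negbTE ->; rewrite mul0r.
  right; split.
    rewrite ltNge; apply/negP => sT; move: H; apply/negP; rewrite -leqNgt.
    by apply: le_truncn; rewrite ler_wpM2r// ltW.
  rewrite big1// => i _; rewrite ptP//; case: eqP => [E|_]; last by rewrite mul0r.
  by have := ltn_ord i; rewrite E ltnNge H.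
apply: (@measurable_fun_cvg _ _ R setT f_).
  move=> n; apply: measurable_sum => k; apply: measurable_funM.
    exact: (measurableT_comp (measurable_step _ _) measurable_fst).
  exact: (measurableT_comp (f_m _) measurable_snd).
move=> [s x] _ /=.
have ptc : 0 <= s -> pt n (Num.trunc (s * n.+1%:R)) @[n --> \oo] --> s.
  move=> s0; apply/cvgrPdist_lt => e e0; near=> n.
  have sn0 : 0 <= s * n.+1%:R by rewrite mulr_ge0// ltW.
  have /andP[h1 h2] := trunc_itv sn0.
  rewrite ger0_norm; last by rewrite subr_ge0 /pt ler_pdivrMr.
  apply: (@le_lt_trans _ _ n.+1%:R^-1); last first.
    by near: n; exact: (near_infty_natSinv_lt (PosNum e0)).
  rewrite lerBlDr /pt -[X in X + _]mul1r -mulrDl ler_pdivlMr// addrC natr1.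
  exact: ltW.
have [s0|s0] := ltP s 0.
  rewrite f0 ?leNgt ?s0//; apply/cvgrPdist_lt => e e0; apply: nearW => n.
  rewrite /f_ big1 ?subrr ?normr0// => i _ /=.
  have /lt_geF -> : s < pt n i by rewrite (lt_le_trans s0)// divr_ge0.
  by rewrite mul0r.
have [sT|sT] := leP s T.
  apply/cvgrPdist_lt => e e0.
  have [d d0 Hd] := fc x s (ltac:(by rewrite s0 sT)) e e0.
  near=> n; have [->|[]] := f_E n s x s0; last by rewrite ltNge sT.
  rewrite distrC; apply: Hd.
    have sn0 : 0 <= s * n.+1%:R by rewrite mulr_ge0// ltW.
    have /andP[h1 h2] := trunc_itv sn0.
    by rewrite /pt divr_ge0//= (le_trans _ sT)// ler_pdivrMr.
  by rewrite distrC; near: n; have /cvgrPdist_lt := ptc s0; apply.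
rewrite f0; last by rewrite negb_and -!ltNge sT orbT.
apply/cvgrPdist_lt => e e0; near=> n; have [->|[_ ->]] := f_E n s x s0; last by rewrite subrr normr0.
rewrite f0 ?subrr ?normr0// negb_and -!ltNge; apply/orP; right.
near: n; have sT0 : 0 < s - T by rewrite subr_gt0.
have /cvgrPdist_lt /(_ _ sT0) := ptc s0.
apply: filterS => n; rewrite ltr_norml => /andP[_]; lra.
Unshelve. all: by end_near. Qed.

End caratheodory.

(** * Integration along characteristics *)

Section characteristics.
Variable R : realType.
Local Notation mu := (@lebesgue_measure R).

Lemma measurable_ind_comp d (T : measurableType d) (a b x : T -> R) :
  measurable_fun setT a -> measurable_fun setT b -> measurable_fun setT x ->
  measurable_fun setT (fun t => ind (a t) (b t) (x t)).
Proof.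
move=> a_m b_m x_m.
have -> : (fun t => ind (a t) (b t) (x t)) = (fun t => if (a t < x t) && (x t < b t) then 1 else 0).
  by apply/funext => t; rewrite ind_ifE.
apply: measurable_fun_ifT; [|exact: measurable_cst|exact: measurable_cst].
by apply: measurable_and; exact: measurable_fun_ltr.
Qed.

Lemma ae_neq (b : R) : {ae mu, forall x, x != b}.
Proof.
exists [set b]; split => //; first exact: (lebesgue_measure_set1 b).
by move=> x /= /negP; rewrite negbK => /eqP.
Qed.

(** The space profile dominating a source uniformly in time; in the application [gam x] is the norm
    of the row [g x]. *)
Definition weight (L : R) (gam : R -> R) := [/\ 0 < L, forall x, 0 <= gam x, L2r gam &
  forall x, ~~ (0 < x < L) -> gam x = 0].

Variables (L : R) (gam : R -> R).
Hypothesis wgt : weight L gam.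
Let L0 : 0 < L. Proof. by case: wgt. Qed.
Let gam_ge0 x : 0 <= gam x. Proof. by case: wgt. Qed.
Let gam_L2 : L2r gam. Proof. by case: wgt. Qed.
Let gam_supp x : ~~ (0 < x < L) -> gam x = 0. Proof. by case: wgt => _ _ _; apply. Qed.

Lemma gam_Li : Li gam.
Proof.
have := L2r_Li (L2r_ind 0 L) gam_L2; apply: eq_Li => x.
by rewrite ind_ifE; case: ifPn => [|/gam_supp ->]; rewrite ?mul1r ?mulr0.
Qed.

Definition src (M : R) (f : R -> R -> R) := mf2 f /\ (forall s x, `|f s x| <= M * gam x).

Definition E (f : R -> R -> R) (a b c : R) := RI (fun s => ind a b s * f s (c - s)).

Section one_source.
Variables (M : R) (f : R -> R -> R).
Hypothesis fS : src M f.

Lemma src_supp s x : ~~ (0 < x < L) -> f s x = 0.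
Proof.
move=> /gam_supp g0; have := fS.2 s x; rewrite g0 mulr0 normr_le0 => /eqP //.
Qed.

Lemma src_mf s : mf (f s).
Proof. by apply: (@mf2_comp _ _ _ f (fun=> s) id fS.1). Qed.

Lemma src_mf_char c : mf (fun s => f s (c - s)).
Proof. by apply: (@mf2_comp _ _ _ f id (fun s => c - s) fS.1) => //; exact: measurable_funB. Qed.

Lemma char_Li c : Li (fun s => f s (c - s)).
Proof.
apply: (Li_le (h := fun s => M * gam (c - s))); first exact: src_mf_char.
  by apply: LiZ; apply: (@Li_refl R c gam); exact: gam_Li.
by move=> s; exact: fS.2.
Qed.

Lemma E_Li a b c : Li (fun s => ind a b s * f s (c - s)).
Proof. by apply: Li_indM; exact: char_Li. Qed.

(** Along one characteristic the argument [c - s] meets each point once, so the total mass of [gam]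
    bounds the integral uniformly in [a], [b] and [c]. This is the smoothing effect. *)
Lemma E_bound a b c : `|E f a b c| <= M * RI gam.
Proof.
rewrite -(RI_refl c (Li_meas gam_Li)) -RIZ; last exact: (Li_refl c gam_Li).
apply: RI_norm_le; [exact: E_Li|by apply: LiZ; exact: (Li_refl c gam_Li)|].
move=> s; rewrite normrM ger0_norm ?ind_ge0//.
by rewrite (le_trans _ (fS.2 s (c - s)))// ler_piMl// ind_le1.
Qed.

(** Such a characteristic does not meet [0 < x < L] during [(a, b)]. *)
Lemma E_supp a b c : ~~ (a < c < b + L) -> E f a b c = 0.
Proof.
move=> H; rewrite -(RI0 R); apply: eq_RI => s; rewrite ind_ifE; case: ifPn => [/andP[s1 s2]|_]; last by rewrite mul0r.
rewrite src_supp ?mulr0//; apply: contra H => /andP[c1 c2]; apply/andP; split; lra.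
Qed.

Lemma E_split a b c x : a <= b -> b <= c -> E f a b x + E f b c x = E f a c x.
Proof.
move=> ab bc; rewrite -RID; try exact: E_Li.
apply: RI_ae; [by apply: mfD; apply: Li_meas; exact: E_Li|by apply: Li_meas; exact: E_Li|].
apply: aeS (ae_neq b) => s sb; rewrite -mulrDl; congr (_ * _).
move: sb; rewrite neq_lt !ind_ifE => /orP[sb|sb].
  by rewrite (lt_gtF sb) sb (lt_le_trans sb bc) andbT addr0.
by rewrite (lt_gtF sb) andbF sb (le_lt_trans ab sb) add0r.
Qed.

Lemma E_refl a x : E f a a x = 0.
Proof.
rewrite -(RI0 R); apply: eq_RI => s; rewrite ind0 ?mul0r//.
by apply/negP => /andP[h1 h2]; have := lt_trans h1 h2; rewrite ltxx.
Qed.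

Lemma E_mf a b : mf (E f a b).
Proof.
have H : mf2 (fun c s => ind a b s * f s (c - s)).
  apply: measurable_funM; first exact: measurable_ind_comp.
  have m : measurable_fun setT (fun p : R * R => p.1 - p.2) by exact: measurable_funB.
  exact: (mf2_comp fS.1 measurable_snd m).
exact: (mf_RI H).
Qed.

Lemma E_mf2 a : mf2 (E f a).
Proof.
have m1 : measurable_fun setT (fun q : R * R * R => q.1.1) by exact: (measurableT_comp measurable_fst).
have m2 : measurable_fun setT (fun q : R * R * R => q.1.2) by exact: (measurableT_comp measurable_snd).
have H : measurable_fun setT (fun q : R * R * R => ind a q.1.1 q.2 * f q.2 (q.1.2 - q.2)).
  apply: measurable_funM; first exact: measurable_ind_comp.
  have m : measurable_fun setT (fun q : R * R * R => q.1.2 - q.2) by exact: measurable_funB.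
  exact: (mf2_comp fS.1 measurable_snd m).
exact: (@mf_RI R _ _ (fun (p : R * R) s => ind a p.1 s * f s (p.2 - s)) H).
Qed.

Lemma E_L2r a b : L2r (E f a b).
Proof.
apply: (eq_L2r (f := fun c => ind a (b + L) c * E f a b c)).
  by move=> c; rewrite ind_ifE; case: ifPn => [_|/E_supp ->]; rewrite ?mul1r ?mulr0.
by apply: L2r_bounded; [exact: E_mf|exact: E_bound].
Qed.

(** Keeping the time profile [rho] under the integral is what later allows exponential weights in
    time. *)
Lemma E_cauchy a b c (rho : R -> R) : (forall s x, a < s < b -> `|f s x| <= gam x * rho s) ->
  (forall s, 0 <= rho s) -> L2r (fun s => ind a b s * rho s) ->
  E f a b c ^+ 2 <= RI (fun x => gam x ^+ 2) * RI (fun s => ind a b s * rho s ^+ 2).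
Proof.
move=> frho rho0 rhoL; have gL := L2r_refl c gam_L2.
have H : `|E f a b c| <= RI (fun s => gam (c - s) * (ind a b s * rho s)).
  apply: RI_norm_le; [exact: E_Li|exact: L2r_Li|].
  move=> s; rewrite normrM ger0_norm ?ind_ge0// mulrCA ind_ifE; case: ifPn => [/frho H|_].
    by rewrite !mul1r.
  by rewrite !mul0r.
rewrite -(real_normK (num_real _)).
apply: (@le_trans _ _ (RI (fun s => gam (c - s) * (ind a b s * rho s)) ^+ 2)).
  by rewrite lerXn2r// nnegrE// (le_trans _ H).
apply: le_trans (RI_cauchy gL rhoL) _; rewrite (RI_refl c (mf_sqr gam_L2.1)).
apply: ler_wpM2l; first by apply: RI_ge0 => x; exact: sqr_ge0.
rewrite le_eqVlt; apply/orP; left; apply/eqP; apply: eq_RI => s.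
by rewrite ind_ifE; case: ifP => _; rewrite ?mul1r// !mul0r expr0n.
Qed.

Lemma E_small a b c : a <= b -> E f a b c ^+ 2 <= RI (fun x => gam x ^+ 2) * (M ^+ 2 * (b - a)).
Proof.
move=> ab; have [M0|M0] := leP 0 M; last first.
  have -> : E f a b c = 0.
    rewrite -(RI0 R); apply: eq_RI => s; have := fS.2 s (c - s) => H.
    have : `|f s (c - s)| <= 0 by apply: le_trans H _; have := gam_ge0 (c - s); nra.
    by rewrite normr_le0 => /eqP ->; rewrite mulr0.
  rewrite expr0n/=; apply: mulr_ge0; first by apply: RI_ge0 => x; exact: sqr_ge0.
  by apply: mulr_ge0; rewrite ?sqr_ge0 ?subr_ge0.
apply: le_trans (@E_cauchy a b c (fun=> M) _ _ _) _ => //.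
- by move=> s x _; rewrite mulrC; exact: fS.2.
- apply: (@L2r_bounded _ a b (fun=> M) M); first exact: mf_cst.
  by move=> x; rewrite ger0_norm.
- rewrite -(RI_ind ab) -(RIZ (M ^+ 2) (Li_ind a b)).
  by rewrite le_eqVlt; apply/orP; left; apply/eqP; congr (_ * _); apply: eq_RI => s; rewrite mulrC.
Qed.

Definition wave (d : R -> R) t c := d c + E f 0 t c.

Lemma wave_L2r d t : L2r d -> L2r (wave d t).
Proof. by move=> dL; apply: L2rD => //; exact: E_L2r. Qed.

(** The increment is a translation of the fixed profile [wave d t0], small by continuity of
    translations, plus the change of the integral between the two times on the same characteristic,
    small uniformly by [E_small]. *)
Lemma wave_continuous d T t0 : L2r d -> 0 <= t0 <= T -> forall eps, 0 < eps ->
  exists2 del : R, 0 < del & forall t, 0 <= t <= T -> `|t - t0| < del ->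
    RI (fun x => ind 0 L x * (wave d t (x + t) - wave d t0 (x + t0)) ^+ 2) < eps.
Proof.
move=> dL /andP[t00 t0T] eps eps0.
pose w := wave d t0; have wL : L2r w by exact: wave_L2r.
have [d1 d10 Hd1] := translation_L2 wL (ltac:(by rewrite divr_gt0) : 0 < eps / 4).
pose G := RI (fun x => gam x ^+ 2).
have G0 : 0 <= G by apply: RI_ge0 => x; exact: sqr_ge0.
have M20 := sqr_ge0 M.
pose K := G * M ^+ 2 * L + 1.
have GML := mulr_ge0 (mulr_ge0 G0 M20) (ltW L0).
have K0 : 0 < K by rewrite ltr_wpDl.
exists (Num.min d1 (eps / (4 * K))).
  by rewrite lt_min d10 divr_gt0// mulr_gt0.
move=> t /andP[t0' tT]; rewrite lt_min => /andP[h1 h2].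
have EE c : (E f 0 t c - E f 0 t0 c) ^+ 2 <= G * (M ^+ 2 * `|t - t0|).
  have [tt|tt] := leP t0 t.
    by rewrite -(E_split c t00 tt) addrC addKr ger0_norm ?subr_ge0// E_small.
  rewrite -(E_split c t0' (ltW tt)) opprD addrA subrr sub0r sqrrN distrC.
  rewrite ger0_norm; first by apply: E_small; exact: ltW.
  by rewrite subr_ge0 ltW.
have L1 : L2r (fun x => w (x + t) - w (x + t0)) by apply: L2rB; exact: L2r_shift.
have bi := LiD (LiZ 2 L1.2) (LiZ (2 * (G * (M ^+ 2 * `|t - t0|))) (Li_ind 0 L)).
have wt : L2r (fun x => wave d t (x + t) - wave d t0 (x + t0)).
  by apply: L2rB; apply: L2r_shift; exact: wave_L2r.
apply: le_lt_trans (RI_le (Li_indM 0 L wt.2) bi _) _.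
  move=> x.
  have -> : wave d t (x + t) - wave d t0 (x + t0) =
     (w (x + t) - w (x + t0)) + (E f 0 t (x + t) - E f 0 t0 (x + t)) by rewrite /w /wave; ring.
  have := EE (x + t); set p := w _ - w _; set q := E f 0 t _ - _; set B := G * _ => qB.
  have B0 : 0 <= B by exact: le_trans (sqr_ge0 _) qB.
  have p0 := sqr_ge0 p; have := sqr_ge0 (p - q); rewrite ind_ifE; case: ifP => _ H.
    by rewrite mul1r mulr1; nra.
  by rewrite mul0r mulr0; nra.
rewrite RID; [|by apply: LiZ; exact: L1.2|by apply: LiZ; exact: Li_ind].
rewrite (RIZ 2 L1.2) RIZ; last exact: Li_ind.
rewrite RI_ind ?ltW// subr0.
have -> : RI (fun x => (w (x + t) - w (x + t0)) ^+ 2) = RI (fun x => (w (x + (t - t0)) - w x) ^+ 2).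
  rewrite -(@RI_shift _ t0 (fun x => (w (x + (t - t0)) - w x) ^+ 2)).
    by apply: eq_RI => x; congr ((w _ - _) ^+ 2); ring.
  by apply: mf_sqr; apply: mfB; [exact: mf_shift wL.1|exact: wL.1].
have := Hd1 _ h1; move: h2; rewrite ltr_pdivlMr ?mulr_gt0// /K => h2 h3.
set tt := `|t - t0| in h2 *.
have tt0 : 0 <= tt by exact: normr_ge0.
have -> : 2 * (G * (M ^+ 2 * tt)) * L = 2 * (tt * (G * M ^+ 2 * L)) by ring.
have : tt * (G * M ^+ 2 * L) <= eps / 4 by lra.
lra.
Qed.

End one_source.

Lemma Li_ind_continuous (p : R -> R) a b : continuous p -> Li (fun t => ind a b t * p t).
Proof.
move=> cp; have [C HC] := @continuous_bounded R p (`|a| + `|b|) cp.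
apply: (Li_le (h := fun t => `|C| * ind a b t)).
- by apply: mfM; [exact: measurable_ind|exact: continuous_mf].
- by apply: LiZ; exact: Li_ind.
move=> x; rewrite !ind_ifE; case: ifPn => [/andP[h1 h2]|_]; last by rewrite mul0r mulr0 normr0.
rewrite mul1r mulr1 (le_trans (HC x _)) ?ler_norm//.
have := ler_norm b; have := ler_norm (- a); rewrite normrN => ? ?.
by rewrite ler_norml; have := normr_ge0 a; have := normr_ge0 b => ? ?; apply/andP; split; lra.
Qed.

(** The primitive of an integrable [e] is only absolutely continuous, so the formula is obtained
    from Fubini on the triangle [a < s < t < b]. *)
Lemma integration_by_parts_ac (e chi chi' : R -> R) (a b V0 : R) : a <= b -> Li e ->
  continuous chi' -> (forall t : R, is_derive t (1 : R) chi (chi' t)) ->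
  let B t := ind a b t * ((V0 + RI (fun s => ind a t s * e s)) * chi' t + e t * chi t) in
  Li B /\ RI B = (V0 + RI (fun s => ind a b s * e s)) * chi b - V0 * chi a.
Proof.
move=> ab ei cchi' dchi B.
have cchi : continuous chi.
  by move=> x; apply: differentiable_continuous; apply/derivable1_diffP; have [] := dchi x.
have Nab x : a < x < b -> `|x| <= `|a| + `|b|.
  move=> /andP[h1 h2]; have := ler_norm b; have := ler_norm (- a); rewrite normrN => ? ?.
  rewrite ler_norml; have := normr_ge0 a; have := normr_ge0 b => ? ?; apply/andP; split; lra.
have [C1 HC1] := @continuous_bounded R chi (`|a| + `|b|) cchi.
have [C2 HC2] := @continuous_bounded R chi' (`|a| + `|b|) cchi'.
have mchi := continuous_mf cchi; have mchi' := continuous_mf cchi'; have me := Li_meas ei.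
have bnd (p : R -> R) C : mf p -> (forall x, `|x| <= `|a| + `|b| -> `|p x| <= C) ->
    forall x, `|ind a b x * p x| <= `|C|.
  move=> mp H x; rewrite ind_ifE; case: ifPn => [/Nab /H|_]; last by rewrite mul0r normr0.
  by rewrite mul1r => /le_trans; apply; exact: ler_norm.
have i1 : Li (fun t => ind a b t * chi' t) by exact: Li_ind_continuous.
have i3 : Li (fun t => ind a b t * chi t * e t).
  by apply: (Li_bounded_mul _ (bnd _ _ mchi HC1)) => //; apply: mfM => //; exact: measurable_ind.
pose F t s := ind a b t * chi' t * (ind a t s * e s).
have mF : mf2 F.
  apply: measurable_funM.
    apply: (measurableT_comp (f := fun t => ind a b t * chi' t)) => //.
    by apply: mfM => //; exact: measurable_ind.
  apply: measurable_funM; last exact: (measurableT_comp me).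
  exact: measurable_ind_comp.
have F2 : Li2 F.
  apply: (@Li2_dom _ F (fun t s => `|C2| * ind a b t * `|e s|) (fun t => `|C2| * RI (fun s => `|e s|) * ind a b t)) => //.
  - move=> t s; rewrite /F normrM; apply: ler_pM => //.
      have := bnd _ _ mchi' HC2 t; rewrite !ind_ifE; case: ifP => _; rewrite ?mulr1// mul0r mulr0 normr0//.
    by rewrite normrM ler_piMl// ger0_norm ?ind_ge0 ?ind_le1.
  - by move=> t; apply: LiZ; exact: Li_norm.
  - by move=> t; rewrite RIZ; [rewrite mulrAC|exact: Li_norm].
  - by apply: LiZ; exact: Li_ind.
have i2 : Li (fun t => RI (F t)) by exact: Li2_Li.
have FE t : RI (F t) = ind a b t * chi' t * RI (fun s => ind a t s * e s).
  by rewrite /F RIZ//; exact: Li_indM.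
have H1 : RI (fun t => RI (F t)) = RI (fun s => ind a b s * e s * (chi b - chi s)).
  rewrite (RI_fubini F2); apply: eq_RI => s.
  have -> : RI (fun t => F t s) = RI (fun t => ind a b s * e s * (ind s b t * chi' t)).
    apply: eq_RI => t; rewrite /F.
    have -> : ind a b t * chi' t * (ind a t s * e s) = (ind a b t * ind a t s) * (chi' t * e s) by ring.
    have -> : ind a b t * ind a t s = ind a b s * ind s b t.
      rewrite !ind_ifE; case: (ltP a t) => at_; case: (ltP t b) => tb; case: (ltP a s) => as_; case: (ltP s t) => st; case: (ltP s b) => sb;
      rewrite /= ?mulr0 ?mul0r ?mulr1//; exfalso; lra.
    by ring.
  rewrite RIZ; last exact: Li_ind_continuous.
  have [sb|sb] := leP s b; first by rewrite (FTC_ind sb cchi' dchi).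
  by rewrite [ind a b s]ind0 ?mul0r// (lt_gtF sb) andbF.
have i4 : Li (fun s => ind a b s * e s) by exact: Li_indM.
have H2 : RI (fun s => ind a b s * e s * (chi b - chi s)) =
    chi b * RI (fun s => ind a b s * e s) - RI (fun t => ind a b t * chi t * e t).
  by rewrite -RIZ// -RIB//; [apply: eq_RI => s; ring|exact: LiZ].
have BE t : V0 * (ind a b t * chi' t) + RI (F t) + ind a b t * chi t * e t = B t.
  by rewrite FE /B; ring.
split; first by apply: eq_Li BE _; apply: LiD => //; apply: LiD => //; exact: LiZ.
rewrite -(eq_RI BE) RID//; last by apply: LiD => //; exact: LiZ.
rewrite RID//; last exact: LiZ.
rewrite RIZ// H1 H2 (FTC_ind ab cchi' dchi); ring.
Qed.

End characteristics.

(** * Continuously differentiable functions of two variables *)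

Section C1_functions.
Variable R : realType.

Lemma mean_value (g g' : R -> R) (x y : R) : (forall t : R, is_derive t (1 : R) g (g' t)) ->
  exists2 z, `|z - x| <= `|y - x| & g y - g x = g' z * (y - x).
Proof.
move=> dg; have cg : continuous g.
  by move=> t; apply: differentiable_continuous; apply/derivable1_diffP; have [] := dg t.
have [xy|yx] := leP x y.
  have [|z] := @MVT_segment R g g' x y xy (fun t _ => dg t); first exact: continuous_subspaceT.
  rewrite in_itv/= => /andP[h1 h2] E; exists z => //.
  by rewrite !ger0_norm ?subr_ge0// lerD2r.
have [|z] := @MVT_segment R g g' y x (ltW yx) (fun t _ => dg t); first exact: continuous_subspaceT.
rewrite in_itv/= => /andP[h1 h2] E; exists z.
  by rewrite !(distrC _ x) !ger0_norm ?subr_ge0 ?(ltW yx)// lerD2l lerN2.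
by rewrite -opprB E -mulrN opprB.
Qed.

Lemma continuous_pair_delta (G : R * R -> R) (p : R * R) : continuous G -> forall eps, 0 < eps ->
  exists2 d : R, 0 < d & forall t x, `|t - p.1| < d -> `|x - p.2| < d -> `|G (t, x) - G p| < eps.
Proof.
move=> cG eps eps0; have /cvgrPdist_lt /(_ _ eps0) /nbhs_ballP[d /= d0 Hd] := cG p.
exists d => // t x td xd; rewrite distrC; apply: Hd; split => /=.
  by rewrite /ball/= distrC.
by rewrite /ball/= distrC.
Qed.

Lemma continuous_line (G : R * R -> R) (a b : R -> R) : continuous G -> continuous a -> continuous b ->
  continuous (fun t => G (a t, b t)).
Proof.
move=> cG ca cb t; apply/cvgrPdist_lt => e e0.
have [d d0 Hd] := continuous_pair_delta (a t, b t) cG e0.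
have /cvgrPdist_lt /(_ _ d0) A := ca t; have /cvgrPdist_lt /(_ _ d0) B := cb t.
by apply: filterS2 A B => s /= h1 h2; rewrite distrC; apply: Hd; rewrite /= distrC.
Qed.

Lemma continuous_idR : continuous (fun t : R => t).
Proof. by move=> t; exact: cvg_id. Qed.

Lemma continuous_cstR (c : R) : continuous (fun _ : R => c).
Proof. by move=> t; exact: cvg_cst. Qed.

Lemma mf2_slab (G : R -> R -> R) (T : R) : 0 <= T -> (forall x, continuous (fun t => G t x)) ->
  (forall t, continuous (G t)) -> mf2 (fun t x => (0 <= t <= T)%R%:R * G t x).
Proof.
move=> T0 c1 c2; apply: (caratheodory T0).
- by move=> s; apply: mfM; [exact: mf_cst|exact: continuous_mf].
- by move=> s x /negbTE ->; rewrite mul0r.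
move=> x s0 s0T eps eps0.
have /cvgrPdist_lt /(_ _ eps0) /nbhs_ballP[d /= d0 Hd] := c1 x s0.
exists d => // s sT sd; rewrite s0T sT !mul1r distrC; apply: Hd.
by rewrite /ball/= distrC.
Qed.

Section one_function.
Variable f : R -> R -> R.
Hypothesis fC : C1_2 f.
Definition ft t x : R := derive1 (fun s => f s x) t.
Definition fx t x : R := derive1 (fun s => f t s) x.

Lemma is_derive_ft (t x : R) : is_derive t (1 : R) (fun s => f s x) (ft t x).
Proof. by apply: DeriveDef; [exact: fC.1|rewrite /ft derive1E]. Qed.

Lemma is_derive_fx (t x : R) : is_derive x (1 : R) (fun s => f t s) (fx t x).
Proof. by apply: DeriveDef; [exact: fC.2.1|rewrite /fx derive1E]. Qed.

Lemma continuous_ft : continuous (fun p : R * R => ft p.1 p.2).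
Proof. exact: fC.2.2.1. Qed.

Lemma continuous_fx : continuous (fun p : R * R => fx p.1 p.2).
Proof. exact: fC.2.2.2. Qed.

Lemma continuous_f1 x : continuous (fun t => f t x).
Proof.
by move=> t; apply: differentiable_continuous; apply/derivable1_diffP; have [] := is_derive_ft t x.
Qed.

Lemma continuous_f2 t : continuous (f t).
Proof.
by move=> x; apply: differentiable_continuous; apply/derivable1_diffP; have [] := is_derive_fx t x.
Qed.

Lemma continuous_refl (c : R) : continuous (fun t : R => c - t).
Proof. by move=> t; apply: cvgB; [exact: cvg_cst|exact: cvg_id]. Qed.

(** The increment splits into one in the first variable, evaluated by the mean value theorem and the
    joint continuity of [ft], and one in the second variable at fixed [t], handled by the chain
    rule. *)
Lemma is_derive_characteristic (c t : R) :
  is_derive t (1 : R) (fun s => f s (c - s)) (ft t (c - t) - fx t (c - t)).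
Proof.
have dB : is_derive t (1 : R) (fun s => f t (c - s)) (- fx t (c - t)).
  have d1 : is_derive t (1 : R) (fun s : R => c - s) (-1).
    have H := is_deriveB (is_derive_cst (c : R) t (1 : R)) (is_derive_id t (1 : R)). by move: H; rewrite sub0r.
  have := @is_derive1_comp R (f t) (fun s => c - s) t _ _ (is_derive_fx t (c - t)) d1.
  by rewrite mulrN1.
have cB : (fun h : R => h^-1 *: (f t (c - (h *: 1 + t)) - f t (c - t))) @ 0^' --> - fx t (c - t).
  by have [dB' e] := dB; rewrite -e; exact: dB'.
have cA : (fun h : R => h^-1 *: (f (h *: 1 + t) (c - (h *: 1 + t)) - f t (c - (h *: 1 + t)))) @ 0^' --> ft t (c - t).
  apply/cvgrPdist_lt => eps eps0.
  have [d d0 Hd] := continuous_pair_delta (t, c - t) continuous_ft eps0.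
  apply: (@filterS _ _ _ (fun h : R => h != 0 /\ `|h| < d)).
    move=> h [h0 hd].
    have [z zt E] := @mean_value (fun s => f s (c - (h *: 1 + t))) (fun s => ft s (c - (h *: 1 + t))) t (h *: 1 + t) (fun s => is_derive_ft s _).
    have hE : h *: (1 : R) = h by rewrite /GRing.scale/= mulr1.
    rewrite E !hE addrK; rewrite hE addrK in zt.
    rewrite (_ : h^-1 *: _ = ft z (c - (h + t))); last first.
      by rewrite /GRing.scale/= mulrCA mulVf// mulr1.
    rewrite distrC.
    apply: Hd => /=; first exact: le_lt_trans zt hd.
    have -> : c - (h + t) - (c - t) = - h by ring.
    by rewrite normrN.
  have Hn : \forall h \near (0 : R), `|h| < d.
    by apply/nbhs_ballP; exists d => //= h; rewrite /ball/= sub0r normrN.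
  by apply: filterS Hn => h hd h0; split.
have cT : (fun h : R => h^-1 *: (((fun s => f s (c - s)) \o shift t) (h *: (1 : R)) - f t (c - t))) @ 0^'
    --> ft t (c - t) - fx t (c - t).
  rewrite (_ : (fun h : R => h^-1 *: (_ - f t (c - t))) = (fun h : R =>
      h^-1 *: (f (h *: 1 + t) (c - (h *: 1 + t)) - f t (c - (h *: 1 + t))) +
      h^-1 *: (f t (c - (h *: 1 + t)) - f t (c - t)))); first exact: cvgD.
  by apply/funext => h /=; rewrite -scalerDr addrA subrK.
apply: DeriveDef; first by apply/cvg_ex; eexists; exact: cT.
exact: cvg_lim cT.
Qed.

Lemma continuous_characteristic c : continuous (fun t => ft t (c - t) - fx t (c - t)).
Proof.
have H1 := continuous_line continuous_ft continuous_idR (@continuous_refl c).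
have H2 := continuous_line continuous_fx continuous_idR (@continuous_refl c).
by move=> t; exact: (cvgB (H1 t) (H2 t)).
Qed.

(** Compactness bounds the continuous partial derivatives; the mean value theorem along [(0, 0)],
    [(0, x)], [(t, x)] then bounds [f]. *)
Lemma C1_bounded (N : R) : 0 <= N -> exists C, forall t x, `|t| <= N -> `|x| <= N ->
  [/\ `|f t x| <= C, `|ft t x| <= C & `|fx t x| <= C].
Proof.
move=> N0.
have cpt : compact (`[-N, N]%classic `*` `[-N, N]%classic : set (R * R)).
  by apply: compact_setX; exact: segment_compact.
have bnd (G : R * R -> R) : continuous G -> exists C, forall t x, `|t| <= N -> `|x| <= N -> `|G (t, x)| <= C.
  move=> cG; have := compact_bounded (continuous_compact (continuous_subspaceT cG) cpt).
  move=> [C [_ HC]]; exists (C + 1) => t x tN xN; apply: (HC (C + 1)); first by rewrite ltrDl.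
  by exists (t, x) => //=; split; rewrite /= in_itv/= -ler_norml.
have [C1 H1] := bnd _ continuous_ft; have [C2 H2] := bnd _ continuous_fx.
have z0 : `|0 : R| <= N by rewrite normr0.
have C10 : 0 <= C1 by exact: le_trans (H1 0 0 z0 z0).
have C20 : 0 <= C2 by exact: le_trans (H2 0 0 z0 z0).
exists (`|f 0 0| + C1 * N + C2 * N + C1 + C2) => t x tN xN.
have CN1 : 0 <= C1 * N by exact: mulr_ge0.
have CN2 : 0 <= C2 * N by exact: mulr_ge0.
have f00 := normr_ge0 (f 0 0).
have := H1 t x tN xN; have := H2 t x tN xN => /= h2 h1; split; [|lra|lra].
have [z zt E1] := mean_value 0 t (fun s => is_derive_ft s x).
have [y yt E2] := mean_value 0 x (fun s => is_derive_fx 0 s).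
rewrite !subr0 in zt E1 yt E2.
have a1 : `|f t x - f 0 x| <= C1 * N.
  by rewrite E1 normrM ler_pM// (H1 z x)// (le_trans zt).
have a2 : `|f 0 x - f 0 0| <= C2 * N.
  by rewrite E2 normrM ler_pM// (H2 0 y)// (le_trans yt).
have -> : f t x = (f t x - f 0 x) + ((f 0 x - f 0 0) + f 0 0) by ring.
apply: le_trans (ler_normD _ _) _; have := ler_normD (f 0 x - f 0 0) (f 0 0); lra.
Qed.

Lemma C1_mf2 T : 0 <= T -> [/\ mf2 (fun t x => (0 <= t <= T)%R%:R * f t x),
  mf2 (fun t x => (0 <= t <= T)%R%:R * ft t x) & mf2 (fun t x => (0 <= t <= T)%R%:R * fx t x)].
Proof.
move=> T0; split; apply: mf2_slab => //.
- exact: continuous_f1.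
- exact: continuous_f2.
- by move=> x; exact: (continuous_line continuous_ft continuous_idR (@continuous_cstR x)).
- by move=> t; exact: (continuous_line continuous_ft (@continuous_cstR t) continuous_idR).
- by move=> x; exact: (continuous_line continuous_fx continuous_idR (@continuous_cstR x)).
- by move=> t; exact: (continuous_line continuous_fx (@continuous_cstR t) continuous_idR).
Qed.

End one_function.
End C1_functions.

(** * Test functions of the characteristic variable *)

Section smooth_step.
Variable R : realType.
Local Notation mu := (@lebesgue_measure R).

(** Meant for the square of the positive part, whose derivative at the junction is read off from a
    quadratic remainder. *)
Lemma is_derive_quadratic (F : R -> R) (z l C : R) :
  (forall h, `|F (h + z) - F z - l * h| <= C * h ^+ 2) -> is_derive z (1 : R) F l.
Proof.
move=> H.
have cT : (fun h : R => h^-1 *: ((F \o shift z) (h *: (1 : R)) - F z)) @ 0^' --> l.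
  apply/cvgrPdist_le => eps eps0.
  have K0 : 0 < `|C| + 1 by rewrite ltr_wpDl.
  have Hn : \forall h \near (0 : R), `|h| < eps / (`|C| + 1).
    apply/nbhs_ballP; exists (eps / (`|C| + 1)) => /=; first by rewrite divr_gt0.
    by move=> h; rewrite /ball/= sub0r normrN.
  apply: filterS Hn => h hd h0 /=.
  rewrite (_ : h *: (1 : R) = h); last by rewrite /GRing.scale/= mulr1.
  rewrite (_ : l - _ = - (h^-1 * (F (h + z) - F z - l * h))); last first.
    by rewrite /GRing.scale/=; field.
  have hp : 0 < `|h| by rewrite normr_gt0.
  rewrite normrN normrM normfV ler_pdivrMl//.
  apply: le_trans (H h) _; rewrite -(real_normK (num_real h)) expr2 mulrA mulrC ler_wpM2l//.
  move: hd; rewrite ltr_pdivlMr// => hd; have := ler_norm C; have := normr_ge0 C; nra.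
apply: DeriveDef; first by apply/cvg_ex; eexists; exact: cT.
exact: cvg_lim cT.
Qed.

Definition zplus (z : R) := Num.max z 0.
(** Vanishes up to [a] and converges boundedly to the indicator of [a < c]; squaring the positive
    part makes the junction continuously differentiable. *)
Definition step (n : nat) (a c : R) := 1 - expR (- (n%:R * zplus (c - a) ^+ 2)).
Definition step' (n : nat) (a c : R) := 2 * n%:R * zplus (c - a) * expR (- (n%:R * zplus (c - a) ^+ 2)).

Lemma is_derive_zplus2 (z : R) : is_derive z (1 : R) (fun y => zplus y ^+ 2) (2 * zplus z).
Proof.
apply: (@is_derive_quadratic _ _ _ 1) => h; rewrite mul1r /zplus ler_norml.
by case: (leP z 0) => z0; case: (leP (h + z) 0) => hz; apply/andP; split; nra.
Qed.

Lemma is_derive_step n a (c : R) : is_derive c (1 : R) (step n a) (step' n a c).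
Proof.
have d0 : is_derive c (1 : R) (fun y : R => y - a) 1.
  have H := is_deriveB (is_derive_id c (1 : R)) (is_derive_cst (a : R) c (1 : R)).
  by move: H; rewrite subr0.
have d1 := @is_derive1_comp R (fun y => zplus y ^+ 2) (fun y => y - a) c _ _ (is_derive_zplus2 (c - a)) d0.
have d2 := is_deriveN (is_deriveZ n%:R d1).
have d3 := is_derive1_comp (is_derive_expR _) d2.
have d4 := is_deriveB (is_derive_cst (1 : R) c (1 : R)) d3.
have E : 0 - expR ((- (n%:R \*: ((fun y : R => zplus y ^+ 2) \o (fun y => y - a)))) c) *
    - (n%:R *: (2 * zplus (c - a) * 1)) = step' n a c.
  by rewrite /step' !fctE /= /GRing.scale/=; ring.
by rewrite -E; exact: d4.
Qed.

Lemma zplus_continuous (a : R) : continuous (fun c => zplus (c - a)).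
Proof.
have cs : continuous (fun c : R => c - a) by move=> c; apply: cvgB; [exact: cvg_id|exact: cvg_cst].
move=> c; have -> : (fun c => zplus (c - a)) = (fun c => (`|c - a| + (c - a)) / 2).
  apply/funext => y; rewrite /zplus; case: (leP (y - a) 0) => h.
    by rewrite ler0_norm// addNr mul0r.
  by rewrite gtr0_norm//; field.
by apply: cvgM; [apply: cvgD; [apply: cvg_norm; exact: cs|exact: cs]|exact: cvg_cst].
Qed.

Lemma step'_continuous n a : continuous (step' n a).
Proof.
move=> c; have cz := @zplus_continuous a c; apply: cvgM.
  by apply: cvgM => //; exact: cvg_cst.
apply: (@continuous_comp _ _ _ (fun c => - (n%:R * zplus (c - a) ^+ 2)) expR); last exact: continuous_expR.
apply: cvgN; apply: cvgM; first exact: cvg_cst.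
by under eq_fun do rewrite expr2; apply: cvgM.
Qed.

Lemma step0 n a c : c <= a -> step n a c = 0.
Proof.
move=> ca; rewrite /step /zplus max_r ?subr_le0// expr0n/= mulr0 oppr0 expR0 subrr.
by [].
Qed.

Lemma step_le1 n a c : `|step n a c| <= 1.
Proof.
rewrite ger0_norm /step ?subr_ge0.
  by rewrite lerBlDr lerDl expR_ge0.
by rewrite -expR0 ler_expR oppr_le0 mulr_ge0// sqr_ge0.
Qed.

Lemma step_cvg a c : step n a c @[n --> \oo] --> ((a < c)%R%:R : R).
Proof.
have [ca|ac] := leP c a.
  by under eq_fun do rewrite step0//; exact: cvg_cst.
have z0 : 0 < zplus (c - a) ^+ 2 by rewrite exprn_gt0// /zplus lt_max subr_gt0 ac.
rewrite /step -[X in _ --> X]subr0; apply: cvgB; first exact: cvg_cst.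
have -> : (fun n : nat => expR (- (n%:R * zplus (c - a) ^+ 2))) = (fun n => expR (- zplus (c - a) ^+ 2) ^+ n).
  by apply/funext => n; rewrite -mulrN expRM_natl.
apply: cvg_expr; rewrite ger0_norm ?expR_ge0//.
by rewrite -[X in _ < X]expR0 ltr_expR oppr_lt0.
Qed.

Lemma ae_shift (P : R -> Prop) (a : R) : {ae mu, forall x, P x} -> {ae mu, forall x, P (x + a)}.
Proof.
move=> [N [mN N0 PN]]; exists (shiftm a @^-1` N); split.
- by have := @measurable_shiftm R a measurableT N mN; rewrite setTI.
- by have := measure_shiftm a mN; rewrite /pushforward => ->.
- by move=> x Px; apply: PN => H; exact: Px.
Qed.

(** Solutions of the free transport equation: used as test functions, they cancel the differential
    part of the weak form. *)
Lemma C1_travelling (psi psi' : R -> R) : continuous psi' -> (forall c : R, is_derive c (1 : R) psi (psi' c)) ->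
  [/\ C1_2 (fun t x => psi (x + t)), forall t x, ft (fun t x => psi (x + t)) t x = psi' (x + t)
    & forall t x, fx (fun t x => psi (x + t)) t x = psi' (x + t)].
Proof.
move=> cp dp.
have d0 (a b : R) : is_derive b (1 : R) (fun y : R => a + y) 1.
  have H := is_deriveD (is_derive_cst (a : R) b (1 : R)) (is_derive_id b (1 : R)).
  by move: H; rewrite add0r.
have d0' (a b : R) : is_derive b (1 : R) (fun y : R => y + a) 1.
  have H := is_deriveD (is_derive_id b (1 : R)) (is_derive_cst (a : R) b (1 : R)).
  by move: H; rewrite addr0.
have d1 (t x : R) : is_derive t (1 : R) (fun s => psi (x + s)) (psi' (x + t)).
  by have := @is_derive1_comp R psi (fun y => x + y) t _ _ (dp (x + t)) (d0 x t); rewrite mulr1.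
have d2 (t x : R) : is_derive x (1 : R) (fun s => psi (s + t)) (psi' (x + t)).
  by have := @is_derive1_comp R psi (fun y => y + t) x _ _ (dp (x + t)) (d0' t x); rewrite mulr1.
have e1 t x : ft (fun t x => psi (x + t)) t x = psi' (x + t) by rewrite /ft derive1E; exact: derive_val.
have e2 t x : fx (fun t x => psi (x + t)) t x = psi' (x + t) by rewrite /fx derive1E; exact: derive_val.
have cpp : continuous (fun p : R * R => psi' (p.2 + p.1)).
  move=> p; apply: (@continuous_comp _ _ _ (fun p : R * R => p.2 + p.1) psi'); last exact: cp.
  by apply: cvgD; [exact: cvg_snd|exact: cvg_fst].
split => //; split; [|split; [|split]].
- by move=> t x; have [] := d1 t x.
- by move=> t x; have [] := d2 t x.
- rewrite (_ : pd1 _ = fun p => psi' (p.2 + p.1))//.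
  by apply/funext => p; exact: e1.
- rewrite (_ : pd2 _ = fun p => psi' (p.2 + p.1))//.
  by apply/funext => p; exact: e2.
Qed.

End smooth_step.

(** * Weak and mild formulations for a given source *)

Section transport.
Variable R : realType.
Local Notation mu := (@lebesgue_measure R).
Variables (L : R) (gam : R -> R).
Hypothesis wgt : weight L gam.
Let L0 : 0 < L. Proof. by case: wgt. Qed.
Let gam_ge0 x : 0 <= gam x. Proof. by case: wgt. Qed.
Let gam_L2 : L2r gam. Proof. by case: wgt. Qed.
Let gam_supp x : ~~ (0 < x < L) -> gam x = 0. Proof. by case: wgt => _ _ _; apply. Qed.

Lemma L2r_ind_continuous (p : R -> R) a b : continuous p -> L2r (fun x => ind a b x * p x).
Proof.
move=> cp; split; first by apply: mfM; [exact: measurable_ind|exact: continuous_mf].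
have cp2 : continuous (fun x => p x ^+ 2).
  by move=> x; under eq_fun do rewrite expr2; exact: (cvgM (cp x) (cp x)).
apply: eq_Li (Li_ind_continuous a b cp2) => x.
by rewrite ind_ifE; case: ifP => _; rewrite ?mul1r// !mul0r expr0n.
Qed.

Lemma mf2_mul (F G : R -> R -> R) : mf2 F -> mf2 G -> mf2 (fun t c => F t c * G t c).
Proof. exact: measurable_funM. Qed.

Lemma mf2_add (F G : R -> R -> R) : mf2 F -> mf2 G -> mf2 (fun t c => F t c + G t c).
Proof. exact: measurable_funD. Qed.

Lemma mf2_sub (F G : R -> R -> R) : mf2 F -> mf2 G -> mf2 (fun t c => F t c - G t c).
Proof. exact: measurable_funB. Qed.

Lemma mf2_shear (F : R -> R -> R) : mf2 F -> mf2 (fun t c => F t (c - t)).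
Proof.
move=> Fm; have m : measurable_fun setT (fun p : R * R => p.2 - p.1) by exact: measurable_funB.
exact: (mf2_comp Fm measurable_fst m).
Qed.

Lemma mf2_fst (p : R -> R) : mf p -> mf2 (fun t c => p t).
Proof. by move=> pm; exact: (measurableT_comp pm measurable_fst). Qed.

Lemma mf2_snd (p : R -> R) : mf p -> mf2 (fun t c => p c).
Proof. by move=> pm; exact: (measurableT_comp pm measurable_snd). Qed.

Section one_wave.
Variables (M : R) (f : R -> R -> R) (d : R -> R).
Hypothesis fS : src gam M f.
Hypothesis dL : L2r d.
Let fsupp := src_supp wgt fS.

Lemma src_L2r t : L2r (f t).
Proof.
apply: (L2r_dom (src_mf fS t) (L2rZ M gam_L2)) => x.
by rewrite (le_trans (fS.2 t x))// ler_norm.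
Qed.

Let wavef := wave f d.
Let wL t : L2r (wavef t). Proof. exact: (wave_L2r wgt fS). Qed.

Section test.
Variables (phi : R -> R -> R) (tau : R).
Hypothesis phiC : C1_2 phi.
Hypothesis tau0 : 0 <= tau.
Hypothesis phi0 : forall t, 0 <= t <= tau -> phi t 0 = 0.

Let P t x := ind 0 L x * (wavef t (x + t) * (- ft phi t x + fx phi t x)).
Let Q t x := f t x * phi t x.
(** The integrand of the weak form in the variables [t] and [c = x + t]. Its rows integrate to the
    weak form and its columns to boundary terms; Fubini equates the two. *)
Let A t c := ind 0 tau t * (P t (c - t) - Q t (c - t)).

Let cD (t : R) : continuous (fun x => - ft phi t x + fx phi t x).
Proof.
have H1 := continuous_line (continuous_ft phiC) (@continuous_cstR R t) (@continuous_idR R).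
have H2 := continuous_line (continuous_fx phiC) (@continuous_cstR R t) (@continuous_idR R).
by move=> x; exact: (cvgD (cvgN (H1 x)) (H2 x)).
Qed.

Let P_Li t : Li (P t).
Proof.
have := L2r_Li (L2r_ind_continuous 0 L (@cD t)) (L2r_shift t (wL t)).
by apply: eq_Li => x; rewrite /P; ring.
Qed.

Let ind_f t x : ind 0 L x * f t x = f t x.
Proof. by rewrite ind_ifE; case: ifPn => [_|/fsupp ->]; rewrite ?mul1r ?mulr0. Qed.

Let Q_Li t : Li (Q t).
Proof.
have := L2r_Li (L2r_ind_continuous 0 L (continuous_f2 phiC (t := t))) (src_L2r t).
by apply: eq_Li => x; rewrite /Q -[in RHS]ind_f; ring.
Qed.

Let A_row t : RI (A t) = ind 0 tau t * (RI (P t) - RI (Q t)).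
Proof.
rewrite -(RIB (P_Li t) (Q_Li t)) -(@RI_shift _ (- t) (fun x => P t x - Q t x)); last first.
  by apply: mfB; exact: Li_meas.
by rewrite -RIZ//; exact: (Li_shift (- t) (LiB (P_Li t) (Q_Li t))).
Qed.

Let AE t c : A t c = ind 0 tau t * (ind 0 L (c - t) * (wavef t c *
    (- ((0 <= t <= tau)%R%:R * ft phi t (c - t)) + (0 <= t <= tau)%R%:R * fx phi t (c - t))) -
    f t (c - t) * ((0 <= t <= tau)%R%:R * phi t (c - t))).
Proof.
rewrite /A /P /Q subrK ind_ifE; case: ifP => [/andP[h1 h2]|_]; last by rewrite !mul0r.
by rewrite (ltW h1) (ltW h2) !mul1r.
Qed.

Let A_mf2 : mf2 A.
Proof.
have [m1 m2 m3] := C1_mf2 phiC tau0.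
have -> : A = fun t c => ind 0 tau t * (ind 0 L (c - t) * (wavef t c *
    ((0 <= t <= tau)%R%:R * fx phi t (c - t) - (0 <= t <= tau)%R%:R * ft phi t (c - t))) -
    f t (c - t) * ((0 <= t <= tau)%R%:R * phi t (c - t))).
  by apply/funext => t; apply/funext => c; rewrite AE [- _ + _]addrC.
apply: mf2_mul; first exact: mf2_fst (measurable_ind 0 tau).
apply: mf2_sub.
  apply: mf2_mul; first exact: mf2_shear (mf2_snd (measurable_ind 0 L)).
  apply: mf2_mul; last by apply: mf2_sub; [exact: (mf2_shear m3)|exact: (mf2_shear m2)].
  by apply: mf2_add; [exact: mf2_snd dL.1|exact: E_mf2 fS 0].
apply: mf2_mul; [exact: (mf2_shear fS.1)|exact: (mf2_shear m1)].
Qed.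

Let A_Li2 : Li2 A.
Proof.
have TL : 0 <= tau + L by rewrite addr_ge0// ltW.
have [C HC] := C1_bounded phiC TL.
have C0 : 0 <= C by have [] := HC 0 0; rewrite ?normr0// => /(le_trans (normr_ge0 _)).
pose K := M * RI gam.
have K0 : 0 <= K by rewrite (le_trans _ (E_bound wgt fS 0 0 0)).
have di : Li (fun c => ind 0 (tau + L) c * (`|d c| + K)).
  have := LiD (Li_norm (L2r_Li (L2r_ind 0 (tau + L)) dL)) (LiZ K (Li_ind 0 (tau + L))).
  apply: eq_Li => c; rewrite mulrDr [K * _]mulrC; congr (_ + _).
  by rewrite normrM ger0_norm ?ind_ge0.
have gi c := Li_shift c (gam_Li wgt).
pose D := RI (fun c => ind 0 (tau + L) c * (`|d c| + K)).
apply: (@Li2_dom _ A (fun t c => ind 0 tau t * (2 * C * (ind 0 (tau + L) c * (`|d c| + K)) + (M * C) * gam (c + - t)))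
  (fun t => (2 * C * D + (M * C) * RI gam) * ind 0 tau t)) => //.
- move=> t c; rewrite /A normrM (ger0_norm (ind_ge0 _ _ _)) ind_ifE.
  case: ifPn => [/andP[t1 t2]|_]; last by rewrite !mul0r.
  rewrite !mul1r (le_trans (ler_normB _ _))//.
  have [ct|ct] := boolP (0 < c - t < L); last first.
    rewrite /P /Q fsupp// !mul0r (ind0 ct) mul0r normr0 addr0.
    rewrite gam_supp// mulr0 addr0; apply: mulr_ge0; first exact: mulr_ge0.
    by rewrite mulr_ge0 ?ind_ge0// addr_ge0.
  have /andP[c1 c2] := ct.
  have [|| b1 b2 b3] := HC t (c - t).
  + by rewrite ger0_norm; [lra|exact: ltW].
  + by rewrite ger0_norm; [lra|exact: ltW].
  rewrite (_ : ind 0 (tau + L) c = 1) ?mul1r; last by rewrite indE//; apply/andP; split; lra.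
  apply: lerD.
    rewrite /P (indE ct) mul1r subrK normrM mulrC; apply: ler_pM => //.
      by rewrite (le_trans (ler_normD _ _))// normrN; lra.
    rewrite /wavef /wave (le_trans (ler_normD _ _))// lerD2l.
    exact: (E_bound wgt fS).
  by rewrite /Q normrM mulrAC; apply: ler_pM => //; exact: fS.2.
- move=> t; apply: LiZ; apply: LiD; apply: LiZ => //.
- move=> t; rewrite RIZ; last by apply: LiD; apply: LiZ.
  rewrite RID; [|exact: LiZ|exact: LiZ].
  rewrite !RIZ// mulrC (RI_shift (- t) (Li_meas (gam_Li wgt))).
  by [].
- by apply: LiZ; exact: Li_ind.
Qed.

(** Contributions of the initial state, of the control and of the final state, according to where
    the characteristic enters and leaves the strip. *)
Let H c := ind 0 L c * (d c * phi 0 c) + ind L (L + tau) c * (d c * phi (c - L) L)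
  - ind tau (tau + L) c * (wavef tau c * phi tau (c - tau)).

(** Integration by parts over the time spent in the strip. The characteristic leaves at [x = 0],
    where [phi] vanishes, or is stopped at time [tau]. The excluded labels are those of the corners
    of the rectangle. *)
Let A_col (c : R) : c != 0 -> c != L -> c != tau -> c != tau + L -> RI (fun t => A t c) = H c.
Proof.
have L0' := L0; have tau0' : (0 : R) <= tau := tau0; move=> cn0 cnL cnt cntL.
have [/andP[c0 cTL]|cout] := boolP (0 < c < tau + L); last first.
  have -> : H c = 0.
    have c' : c <= 0 \/ tau + L <= c.
      by move: cout; rewrite negb_and -!leNgt => /orP[]; [left|right].
    have i1 : ind 0 L c = 0 by apply: ind0; apply/negP => /andP[? ?]; case: c' => ?; lra.
    have i2 : ind L (L + tau) c = 0 by apply: ind0; apply/negP => /andP[? ?]; case: c' => ?; lra.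
    have i3 : ind tau (tau + L) c = 0 by apply: ind0; apply/negP => /andP[? ?]; case: c' => ?; lra.
    by rewrite /H i1 i2 i3 !mul0r addr0 subr0.
  rewrite -(RI0 R); apply: eq_RI => t; rewrite /A ind_ifE; case: ifPn => [/andP[h1 h2]|_]; last by rewrite mul0r.
  have ct : ~~ (0 < c - t < L) by apply: contra cout => /andP[h3 h4]; apply/andP; split; lra.
  by rewrite /P /Q fsupp// (ind0 ct) !mul0r subrr mulr0.
(* Entry and exit times: the characteristic crosses [x = L] at time [c - L] and [x = 0] at time
   [c]. *)
pose t0 := Num.max 0 (c - L); pose t1 := Num.min tau c.
have t00 : 0 <= t0 by rewrite le_max lexx.
have t01 : t0 <= t1.
  by rewrite ge_max !le_min; apply/andP; split; apply/andP; split; lra.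
have E0 : E f 0 t0 c = 0.
  rewrite /t0; case: (leP 0 (c - L)) => h.
    by apply: (E_supp wgt fS); rewrite negb_and -!leNgt; apply/orP; right; lra.
  exact: E_refl.
have Et t : t0 <= t -> E f 0 t c = E f t0 t c.
  by move=> tt; rewrite -(E_split wgt fS c t00 tt) E0 add0r.
pose chi t := phi t (c - t).
have [IBPi IBP] := integration_by_parts_ac (d c) t01 (char_Li wgt fS c)
   (continuous_characteristic phiC (c := c)) (is_derive_characteristic phiC c).
transitivity (- ((d c + E f t0 t1 c) * chi t1 - d c * chi t0)).
  rewrite -IBP -(RIN IBPi).
  apply: eq_RI => t; rewrite /A; have [/andP[h1 h2]|out] := boolP (t0 < t < t1).
    move: h1 h2; rewrite gt_max lt_min => /andP[h1 h2] /andP[h3 h4].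
    rewrite !indE ?h1 ?h3//; last by apply/andP; split; [rewrite gt_max h1|rewrite lt_min h3].
    rewrite !mul1r /P /Q subrK indE; last by apply/andP; split; lra.
    rewrite /wavef /wave Et; last by rewrite ge_max !ltW.
    by rewrite -/(E f t0 t c); ring.
  rewrite (ind0 out) mul0r oppr0 ind_ifE; case: ifPn => [/andP[h1 h2]|_]; last by rewrite mul0r.
  have ct : ~~ (0 < c - t < L).
    apply: contra out => /andP[h3 h4]; rewrite gt_max lt_min h1 h2 /=.
    by apply/andP; split; lra.
  by rewrite /P /Q fsupp// (ind0 ct) !mul0r subrr mulr0.
have -> : (d c + E f t0 t1 c) * chi t1 = ind tau (tau + L) c * (wavef tau c * phi tau (c - tau)).
  move: cnt; rewrite neq_lt => /orP[ct|ct].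
    have -> : t1 = c by rewrite /t1 min_r// ltW.
    rewrite /chi subrr phi0 ?mulr0; last by rewrite !ltW.
    by rewrite ind0 ?mul0r// (lt_gtF ct).
  have t1E : t1 = tau by rewrite /t1 min_l// ltW.
  by rewrite indE ?ct// mul1r t1E /chi /wavef /wave Et// -t1E.
have -> : d c * chi t0 = ind 0 L c * (d c * phi 0 c) + ind L (L + tau) c * (d c * phi (c - L) L).
  move: cnL; rewrite neq_lt => /orP[cl|cl].
    rewrite (indE (a := 0)) ?c0// mul1r ind0 ?(lt_gtF cl)// mul0r addr0.
    by rewrite /chi /t0 max_l ?subr0// subr_le0 ltW.
  rewrite ind0 ?(lt_gtF cl) ?andbF// mul0r add0r indE ?mul1r; last by rewrite cl; lra.
  by rewrite /chi /t0 max_r ?subr_ge0 ?(ltW cl)// opprB addrCA subrr addr0.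
by rewrite /H opprB.
Qed.

Lemma mild_weak :
  RI (fun t => ind 0 tau t * (RI (fun x => ind 0 L x * (wave f d t (x + t) * (- ft phi t x + fx phi t x)))
      - RI (fun x => f t x * phi t x)))
  + RI (fun x => ind 0 L x * (wave f d tau (x + tau) * phi tau x))
  - RI (fun x => ind 0 L x * (d x * phi 0 x)) - RI (fun t => ind 0 tau t * (d (t + L) * phi t L)) = 0.
Proof.
have h1 : Li (fun c => ind 0 L c * (d c * phi 0 c)).
  have := L2r_Li (L2r_ind_continuous 0 L (continuous_f2 phiC (t := 0))) dL.
  by apply: eq_Li => x; ring.
have h2 : Li (fun t => ind 0 tau t * (d (t + L) * phi t L)).
  have := L2r_Li (L2r_ind_continuous 0 tau (continuous_f1 phiC (x := L))) (L2r_shift L dL).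
  by apply: eq_Li => x; ring.
have h3 : Li (fun x => ind 0 L x * (wavef tau (x + tau) * phi tau x)).
  have := L2r_Li (L2r_ind_continuous 0 L (continuous_f2 phiC (t := tau))) (L2r_shift tau (wL tau)).
  by apply: eq_Li => x; ring.
have h2' : Li (fun c => ind L (L + tau) c * (d c * phi (c - L) L)).
  have := Li_shift (- L) h2; apply: eq_Li => c; rewrite subrK; congr (_ * _).
  by rewrite !ind_ifE subr_gt0 ltrBlDl.
have h3' : Li (fun c => ind tau (tau + L) c * (wavef tau c * phi tau (c - tau))).
  have := Li_shift (- tau) h3; apply: eq_Li => c; rewrite subrK; congr (_ * _).
  by rewrite !ind_ifE subr_gt0 ltrBlDl.
have e2 : RI (fun c => ind L (L + tau) c * (d c * phi (c - L) L)) = RI (fun t => ind 0 tau t * (d (t + L) * phi t L)).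
  rewrite -(RI_shift (- L) (Li_meas h2)); apply: eq_RI => c; rewrite subrK; congr (_ * _).
  by rewrite !ind_ifE subr_gt0 ltrBlDl.
have e3 : RI (fun c => ind tau (tau + L) c * (wavef tau c * phi tau (c - tau))) =
    RI (fun x => ind 0 L x * (wavef tau (x + tau) * phi tau x)).
  rewrite -(RI_shift (- tau) (Li_meas h3)); apply: eq_RI => c; rewrite subrK; congr (_ * _).
  by rewrite !ind_ifE subr_gt0 ltrBlDl.
have -> : RI (fun t => ind 0 tau t * (RI (P t) - RI (Q t))) = RI H.
  rewrite -(eq_RI A_row) (RI_fubini A_Li2); apply: RI_ae.
  - have Am : mf2 (fun c t => A t c) by exact: (mf2_comp A_mf2 measurable_snd measurable_fst).
    exact: (mf_RI Am).
  - by apply: Li_meas; apply: LiB => //; exact: LiD.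
  have := aeI (aeI (ae_neq 0) (ae_neq L)) (aeI (ae_neq tau) (ae_neq (tau + L))).
  by apply: aeS => c [[n1 n2] [n3 n4]]; exact: A_col.
rewrite /H RIB//; last exact: LiD.
by rewrite RID// e2 e3 -/wavef; ring.
Qed.

Lemma mild_weak_Li :
  Li (fun t => ind 0 tau t * (RI (fun x => ind 0 L x * (wave f d t (x + t) * (- ft phi t x + fx phi t x)))
      - RI (fun x => f t x * phi t x))).
Proof. exact: eq_Li A_row (Li2_Li A_Li2). Qed.

End test.

(** The condition that [psi] vanishes up to [tau] makes [psi (x + t)] zero on [x = 0]. Letting [psi]
    tend to indicators of half-lines shows that the defect [h] of the mild formula has zero tails
    beyond [tau], and the labels [c > tau] include all those of the characteristics present in the
    strip at time [tau]. *)
Lemma weak_mild (u u0 U : R -> R) (tau : R) : 0 <= tau -> L2r (fun x => ind 0 L x * u x) ->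
  L2r (fun x => ind 0 L x * u0 x) -> L2r (fun t => ind 0 tau t * U t) ->
  (forall psi psi' : R -> R, continuous psi' -> (forall c : R, is_derive c (1 : R) psi (psi' c)) ->
    (forall c, c <= tau -> psi c = 0) ->
    RI (fun t => ind 0 tau t * RI (fun x => f t x * psi (x + t))) =
    RI (fun x => ind 0 L x * (u x * psi (x + tau))) - RI (fun x => ind 0 L x * (u0 x * psi x))
    - RI (fun t => ind 0 tau t * (U t * psi (t + L)))) ->
  {ae mu, forall x, 0 < x < L ->
    u x = ind 0 L (x + tau) * u0 (x + tau) + ind L (L + tau) (x + tau) * U (x + tau - L) + E f 0 tau (x + tau)}.
Proof.
move=> tau0 uL u0L UL W; have L0' := L0.
have toLi a b (w : R -> R) : L2r (fun x => ind a b x * w x) -> Li (fun x => ind a b x * w x).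
  move=> wLi; have := L2r_Li (L2r_ind a b) wLi; apply: eq_Li => x.
  by rewrite ind_ifE; case: ifP => _; rewrite ?mul1r// !mul0r.
have ui := toLi _ _ _ uL; have u0i := toLi _ _ _ u0L; have Ui := toLi _ _ _ UL.
have indS (a b c e : R) : ind a b (e + - c) = ind (c + a) (c + b) e.
  by rewrite !ind_ifE ltrBrDl ltrBlDl.
have ui' : Li (fun c => ind tau (tau + L) c * u (c - tau)).
  by have := Li_shift (- tau) ui; apply: eq_Li => c; rewrite indS addr0.
have Ui' : Li (fun c => ind L (L + tau) c * U (c - L)).
  by have := Li_shift (- L) Ui; apply: eq_Li => c; rewrite indS addr0.
have Ei : Li (E f 0 tau).
  have := L2r_Li (L2r_ind 0 (tau + L)) (E_L2r wgt fS 0 tau); apply: eq_Li => c.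
  by rewrite ind_ifE; case: ifPn => [_|/(E_supp wgt fS) ->]; rewrite ?mul1r ?mulr0.
pose h c := ind tau (tau + L) c * u (c - tau) - (ind 0 L c * u0 c + ind L (L + tau) c * U (c - L)) - E f 0 tau c.
have hi : Li h by apply: LiB => //; apply: LiB => //; exact: LiD.
have key n a : tau <= a -> RI (fun c => step n a c * h c) = 0.
  move=> ta; pose psi := step n a; have cpsi' := @step'_continuous R n a.
  have dpsi := @is_derive_step R n a.
  have psi0 c : c <= tau -> psi c = 0 by move=> ct; apply: step0; exact: le_trans ta.
  have := W psi _ cpsi' dpsi psi0.
  have mpsi : mf psi.
    apply: continuous_mf => c; apply: differentiable_continuous; apply/derivable1_diffP.
    by have [] := dpsi c.
  have psi1 c : `|psi c| <= 1 by exact: step_le1.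
  have B (w : R -> R) : Li w -> Li (fun c => psi c * w c) by exact: Li_bounded_mul.
  have -> : RI (fun x => ind 0 L x * (u x * psi (x + tau))) = RI (fun c => psi c * (ind tau (tau + L) c * u (c - tau))).
    rewrite -(RI_shift tau (Li_meas (B _ ui'))); apply: eq_RI => x.
    have i : ind tau (tau + L) (x + tau) = ind 0 L x by rewrite !ind_ifE ltrDr (addrC tau) ltrD2r.
    by rewrite addrK i; ring.
  have -> : RI (fun t => ind 0 tau t * (U t * psi (t + L))) = RI (fun c => psi c * (ind L (L + tau) c * U (c - L))).
    rewrite -(RI_shift L (Li_meas (B _ Ui'))); apply: eq_RI => x.
    have i : ind L (L + tau) (x + L) = ind 0 tau x by rewrite !ind_ifE ltrDr (addrC L) ltrD2r.
    by rewrite addrK i; ring.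
  have -> : RI (fun x => ind 0 L x * (u0 x * psi x)) = RI (fun c => psi c * (ind 0 L c * u0 c)).
    by apply: eq_RI => c; ring.
  have -> : RI (fun t => ind 0 tau t * RI (fun x => f t x * psi (x + t))) = RI (fun c => psi c * E f 0 tau c).
    pose F t c := ind 0 tau t * (f t (c - t) * psi c).
    have mF : mf2 F.
      apply: mf2_mul; first exact: mf2_fst (measurable_ind 0 tau).
      by apply: mf2_mul; [exact: (mf2_shear fS.1)|exact: mf2_snd].
    have gi := gam_Li wgt.
    have F2 : Li2 F.
      apply: (@Li2_dom _ F (fun t c => ind 0 tau t * (M * gam (c + - t))) (fun t => (M * RI gam) * ind 0 tau t)) => //.
      - move=> t c; rewrite /F normrM ger0_norm ?ind_ge0// ler_wpM2l ?ind_ge0// normrM.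
        by rewrite (le_trans _ (fS.2 t (c - t)))// ler_piMr.
      - by move=> t; apply: LiZ; apply: LiZ; exact: (Li_shift (- t) gi).
      - move=> t; rewrite !RIZ; [|exact: (Li_shift (- t) gi)|by apply: LiZ; exact: (Li_shift (- t) gi)].
        by rewrite (RI_shift (- t) (Li_meas gi)) mulrC.
      - by apply: LiZ; exact: Li_ind.
    have fi t : Li (fun c => f t (c - t) * psi c).
      have := B _ (Li_shift (- t) (Li_le (src_mf fS t) (LiZ M gi) (fS.2 t))).
      by apply: eq_Li => c; rewrite mulrC.
    transitivity (RI (fun t => RI (F t))).
      apply: eq_RI => t; rewrite /F (RIZ _ (fi t)); congr (_ * _).
      rewrite -(RI_shift t (Li_meas (fi t))); apply: eq_RI => x.
      by rewrite addrK.
    rewrite (RI_fubini F2); apply: eq_RI => c; rewrite /E -RIZ; last exact: (E_Li wgt fS).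
    by apply: eq_RI => t; rewrite /F; ring.
  move=> E1; transitivity (RI (fun c => psi c * (ind tau (tau + L) c * u (c - tau)) -
    (psi c * (ind 0 L c * u0 c) + psi c * (ind L (L + tau) c * U (c - L))) - psi c * E f 0 tau c)).
    by apply: eq_RI => c; rewrite /h -/psi; ring.
  rewrite RIB; [|by apply: LiB; [exact: B|apply: LiD; exact: B]|exact: B].
  rewrite RIB; [|exact: B|by apply: LiD; exact: B].
  rewrite RID; [|exact: B|exact: B].
  by move: E1 => ->; ring.
have tail a : tau <= a -> RI (fun x => (a < x)%R%:R * h x) = 0.
  move=> ta; have lim : RI (fun c => step n a c * h c) @[n --> \oo] --> RI (fun x => (a < x)%R%:R * h x).
    apply: (@RI_dominated _ _ _ (fun c => `|h c|)).
    - move=> n; apply: mfM; last exact: Li_meas.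
      apply: continuous_mf => c; apply: differentiable_continuous; apply/derivable1_diffP.
      by have [] := @is_derive_step R n a c.
    - apply: mfM; last exact: Li_meas.
      apply: (eq_measurable_fun (\1_(`]a, +oo[%classic : set R) : R -> R)).
        by move=> x _; rewrite indicE mem_setE in_itv/= andbT.
      exact: measurable_indic.
    - by move=> c; apply: cvgM; [exact: step_cvg|exact: cvg_cst].
    - exact: Li_norm.
    - by move=> n c; rewrite normrM ler_piMl// step_le1.
  apply: (cvg_unique _ lim) => //.
  have -> : (fun n => RI (fun c => step n a c * h c)) = (fun=> 0).
    by apply/funext => n; exact: key.
  exact: cvg_cst.
have := ae_shift tau (ae0_of_tails hi tail).
apply: aeS => x H /andP[x0 xL]; have := H (ltac:(by rewrite ltrDr)).
rewrite /h addrK indE; last by apply/andP; split; lra.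
by rewrite mul1r; lra.
Qed.

End one_wave.
End transport.

(** * Complex-valued square integrable functions *)

Section complex_algebra.
Variable R : realType.
Implicit Types x y z : R[i].
Local Notation Re := complex.Re.
Local Notation Im := complex.Im.

Lemma cplx_eq x y : Re x = Re y -> Im x = Im y -> x = y.
Proof. by case: x => a b; case: y => c d /= -> ->. Qed.
Lemma ReD x y : Re (x + y) = Re x + Re y. Proof. by case: x; case: y. Qed.
Lemma ImD x y : Im (x + y) = Im x + Im y. Proof. by case: x; case: y. Qed.
Lemma ReN x : Re (- x) = - Re x. Proof. by case: x. Qed.
Lemma ImN x : Im (- x) = - Im x. Proof. by case: x. Qed.
Lemma ReB x y : Re (x - y) = Re x - Re y. Proof. by rewrite ReD ReN. Qed.
Lemma ImB x y : Im (x - y) = Im x - Im y. Proof. by rewrite ImD ImN. Qed.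
Lemma ReM x y : Re (x * y) = Re x * Re y - Im x * Im y. Proof. by case: x; case: y. Qed.
Lemma ImM x y : Im (x * y) = Re x * Im y + Im x * Re y. Proof. by case: x; case: y. Qed.
Lemma ReJ x : Re (conjc x) = Re x. Proof. by case: x. Qed.
Lemma ImJ x : Im (conjc x) = - Im x. Proof. by case: x. Qed.
Lemma Re0 : Re (0 : R[i]) = 0. Proof. by []. Qed.
Lemma Im0 : Im (0 : R[i]) = 0. Proof. by []. Qed.

Lemma cnorm2_ge0 x : 0 <= cnorm2 x.
Proof. by rewrite addr_ge0// sqr_ge0. Qed.

Lemma cnorm2M x y : cnorm2 (x * y) = cnorm2 x * cnorm2 y.
Proof. by rewrite /cnorm2 ReM ImM; ring. Qed.

Lemma cnorm2_eq0 x : cnorm2 x = 0 -> x = 0.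
Proof.
move=> /eqP; rewrite paddr_eq0 ?sqr_ge0// !sqrf_eq0 => /andP[/eqP a /eqP b].
exact: cplx_eq.
Qed.

Lemma cnorm2D x y : cnorm2 (x + y) <= 2 * cnorm2 x + 2 * cnorm2 y.
Proof.
rewrite /cnorm2 ReD ImD; have := sqr_ge0 (Re x - Re y); have := sqr_ge0 (Im x - Im y); nra.
Qed.

Lemma cnorm2B x y : cnorm2 (x - y) <= 2 * cnorm2 x + 2 * cnorm2 y.
Proof. by apply: le_trans (cnorm2D _ _) _; rewrite /cnorm2 ReN ImN !sqrrN. Qed.

Lemma Re_sqr_le x : Re x ^+ 2 <= cnorm2 x. Proof. by rewrite lerDl sqr_ge0. Qed.
Lemma Im_sqr_le x : Im x ^+ 2 <= cnorm2 x. Proof. by rewrite lerDr sqr_ge0. Qed.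

End complex_algebra.

Section L2_space.
Variable R : realType.
Local Notation Re := complex.Re.
Local Notation Im := complex.Im.
Local Notation mu := (@lebesgue_measure R).
Local Notation aeq := (@Defs.ae_eq R).

(** Extending the components by zero to the line brings complex states under the real theory. *)
Definition er (L : R) (u : R -> R[i]) x := ind 0 L x * Re (u x).
Definition ei (L : R) (u : R -> R[i]) x := ind 0 L x * Im (u x).

Lemma ind_sqr (a b x : R) : ind a b x ^+ 2 = ind a b x.
Proof. by rewrite ind_ifE; case: ifP; rewrite ?expr1n// expr0n. Qed.

Lemma cL2P (L : R) u : cL2 `]0, L[%classic u <-> L2r (er L u) /\ L2r (ei L u).
Proof.
have e x : ind 0 L x * cnorm2 (u x) = er L u x ^+ 2 + ei L u x ^+ 2.
  by rewrite /er /ei !exprMn ind_sqr /cnorm2; ring.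
split=> [[/measurable_fun_ind mr [/measurable_fun_ind mi /integrable_ind ui]]|[[mr ir] [mi ii]]].
  have {}ui := eq_Li e ui.
  split; split => //; apply: (Li_le _ ui); rewrite /=; try exact: mf_sqr.
    by move=> x; rewrite ger0_norm ?sqr_ge0// lerDl sqr_ge0.
  by move=> x; rewrite ger0_norm ?sqr_ge0// lerDr sqr_ge0.
split; [exact/measurable_fun_ind|split; first exact/measurable_fun_ind].
by apply/integrable_ind; apply: eq_Li (LiD ir ii) => x; rewrite e.
Qed.

Lemma l2nE (L : R) u : cL2 `]0, L[%classic u ->
  l2n L u = RI (fun x => er L u x ^+ 2) + RI (fun x => ei L u x ^+ 2).
Proof.
move=> /cL2P[[_ a] [_ b]]; rewrite /l2n Rintegral_ind -RID//; apply: eq_RI => x.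
by rewrite /er /ei !exprMn ind_sqr /cnorm2; ring.
Qed.

Variable L : R.
Local Notation I := `]0, L[%classic.
Implicit Types u v : R -> R[i].

Lemma l2n_Li u : cL2 I u -> Li (fun x => ind 0 L x * cnorm2 (u x)).
Proof. by move=> [_ [_ /integrable_ind]]. Qed.

Lemma l2n_ge0 u : 0 <= l2n L u.
Proof. by rewrite /l2n; apply: Rintegral_ge0 => x _; exact: cnorm2_ge0. Qed.

Lemma erD u v x : er L (fun x => u x + v x) x = er L u x + er L v x.
Proof. by rewrite /er ReD mulrDr. Qed.
Lemma eiD u v x : ei L (fun x => u x + v x) x = ei L u x + ei L v x.
Proof. by rewrite /ei ImD mulrDr. Qed.
Lemma erB u v x : er L (fun x => u x - v x) x = er L u x - er L v x.
Proof. by rewrite /er ReB mulrBr. Qed.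
Lemma eiB u v x : ei L (fun x => u x - v x) x = ei L u x - ei L v x.
Proof. by rewrite /ei ImB mulrBr. Qed.
Lemma erM k u x : er L (fun x => k * u x) x = Re k * er L u x - Im k * ei L u x.
Proof. by rewrite /er /ei ReM; ring. Qed.
Lemma eiM k u x : ei L (fun x => k * u x) x = Re k * ei L u x + Im k * er L u x.
Proof. by rewrite /er /ei ImM; ring. Qed.

Lemma cL2D u v : cL2 I u -> cL2 I v -> cL2 I (fun x => u x + v x).
Proof.
move=> /cL2P[a b] /cL2P[c d]; apply/cL2P; split.
  by apply: eq_L2r (L2rD a c) => x; rewrite erD.
by apply: eq_L2r (L2rD b d) => x; rewrite eiD.
Qed.

Lemma cL2B u v : cL2 I u -> cL2 I v -> cL2 I (fun x => u x - v x).
Proof.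
move=> /cL2P[a b] /cL2P[c d]; apply/cL2P; split.
  by apply: eq_L2r (L2rB a c) => x; rewrite erB.
by apply: eq_L2r (L2rB b d) => x; rewrite eiB.
Qed.

Lemma cL2M k u : cL2 I u -> cL2 I (fun x => k * u x).
Proof.
move=> /cL2P[a b]; apply/cL2P; split.
  by apply: eq_L2r (L2rB (L2rZ (Re k) a) (L2rZ (Im k) b)) => x; rewrite erM.
by apply: eq_L2r (L2rD (L2rZ (Re k) b) (L2rZ (Im k) a)) => x; rewrite eiM.
Qed.

Lemma cL20 : cL2 I (fun=> 0).
Proof.
have L0r : L2r (fun _ : R => 0).
  by split; [exact: mf_cst|apply: eq_Li (Li0 R) => x; rewrite expr0n].
by apply/cL2P; split; apply: eq_L2r L0r => x; rewrite /er /ei ?Re0 ?Im0 mulr0.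
Qed.

Lemma l2nD u v : cL2 I u -> cL2 I v -> l2n L (fun x => u x + v x) <= 2 * l2n L u + 2 * l2n L v.
Proof.
move=> uL vL; rewrite /l2n !Rintegral_ind -!RIZ; try exact: l2n_Li.
rewrite -RID; try by apply: LiZ; exact: l2n_Li.
apply: RI_le; [by apply: l2n_Li; exact: cL2D|by apply: LiD; apply: LiZ; exact: l2n_Li|].
move=> x; have := cnorm2D (u x) (v x); have := ind_ge0 0 L x; nra.
Qed.

Lemma l2nB u v : cL2 I u -> cL2 I v -> l2n L (fun x => u x - v x) <= 2 * l2n L u + 2 * l2n L v.
Proof.
move=> uL vL; rewrite /l2n !Rintegral_ind -!RIZ; try exact: l2n_Li.
rewrite -RID; try by apply: LiZ; exact: l2n_Li.
apply: RI_le; [by apply: l2n_Li; exact: cL2B|by apply: LiD; apply: LiZ; exact: l2n_Li|].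
move=> x; have := cnorm2B (u x) (v x); have := ind_ge0 0 L x; nra.
Qed.

Lemma l2nM k u : cL2 I u -> l2n L (fun x => k * u x) = cnorm2 k * l2n L u.
Proof.
move=> uL; rewrite /l2n !Rintegral_ind -RIZ; last exact: l2n_Li.
by apply: eq_RI => x; rewrite cnorm2M; ring.
Qed.

Lemma ae_er u v : aeq L u v -> {ae mu, forall x, er L u x = er L v x /\ ei L u x = ei L v x}.
Proof.
apply: aeS => x H; rewrite /er /ei ind_ifE; case: ifPn => [xI|_]; last by rewrite !mul0r.
by rewrite H//= in_itv.
Qed.

Lemma l2n_ae u v : cL2 I u -> cL2 I v -> aeq L u v -> l2n L u = l2n L v.
Proof.
move=> uL vL uv; rewrite !l2nE//; move: uL vL => /cL2P[a b] /cL2P[c d].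
congr (_ + _); apply: RI_ae.
- exact: mf_sqr a.1.
- exact: mf_sqr c.1.
- by apply: aeS (ae_er uv) => x [-> _].
- exact: mf_sqr b.1.
- exact: mf_sqr d.1.
- by apply: aeS (ae_er uv) => x [_ ->].
Qed.

Lemma l2n_eq0 u : cL2 I u -> l2n L u = 0 -> aeq L u (fun=> 0).
Proof.
move=> uL; rewrite l2nE//; move: uL => /cL2P[a b] /eqP.
rewrite paddr_eq0; try by apply: RI_ge0 => x; exact: sqr_ge0.
move=> /andP[/eqP ra /eqP rb]; have := aeI (RI_ae0 a ra) (RI_ae0 b rb).
apply: aeS => x [e1 e2] /=; rewrite in_itv/= => xI; move: e1 e2.
by rewrite /er /ei indE// !mul1r => h1 h2; apply: cplx_eq; rewrite ?h1 ?h2.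
Qed.

Lemma aeq_subr u v : aeq L (fun x => u x - v x) (fun=> 0) <-> aeq L u v.
Proof.
by split; apply: aeS => x H xI; [apply/eqP; rewrite -subr_eq0 H|rewrite H// subrr].
Qed.

Lemma aeq_sym u v : aeq L u v -> aeq L v u.
Proof. by apply: aeS => x H xI; rewrite H. Qed.

Lemma aeq_trans v u w : aeq L u v -> aeq L v w -> aeq L u w.
Proof. by move=> uv vw; apply: aeS (aeI uv vw) => x [a b] xI; rewrite a// b. Qed.

Lemma l2n_bound u (C : R) : 0 <= L -> cL2 I u -> (forall x, 0 < x < L -> cnorm2 (u x) <= C) -> l2n L u <= C * L.
Proof.
move=> L0 uL H; rewrite /l2n Rintegral_ind.
have {2}<- : RI (ind 0 L) = L by rewrite RI_ind// subr0.
rewrite -RIZ; last exact: Li_ind.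
apply: RI_le; [exact: l2n_Li|by apply: LiZ; exact: Li_ind|].
move=> x; rewrite ind_ifE; case: ifPn => [/H|_]; first by rewrite mul1r mulr1.
by rewrite mul0r mulr0.
Qed.

End L2_space.

(** * The integral operator and its adjoint *)

Section kernel.
Variable R : realType.
Local Notation Re := complex.Re.
Local Notation Im := complex.Im.
Local Notation mu := (@lebesgue_measure R).
Local Notation aeq := (@Defs.ae_eq R).
Variables (L : R) (g : R -> R -> R[i]).
Local Notation I := `]0, L[%classic.
Implicit Types u v : R -> R[i].

(** Measurability and support are required on the whole plane and square integrability for each row,
    so that the source is defined and controlled at every [x]. *)
Definition nice_kernel := [/\ mf2 (fun x y => Re (g x y)), mf2 (fun x y => Im (g x y)),
  forall x y, ~~ ((0 < x < L) && (0 < y < L)) -> g x y = 0,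
  forall x, Li (fun y => cnorm2 (g x y)) & Li (fun x => RI (fun y => cnorm2 (g x y)))].

Hypothesis L0 : 0 < L.
Hypothesis gN : nice_kernel.

Definition gam x := Num.sqrt (RI (fun y => cnorm2 (g x y))).

Let gam2 x : gam x ^+ 2 = RI (fun y => cnorm2 (g x y)).
Proof. by rewrite sqr_sqrtr//; apply: RI_ge0 => y; exact: cnorm2_ge0. Qed.

Lemma gam_weight : weight L gam.
Proof.
have [mr mi g0 gi Gi] := gN; split => //.
- by move=> x; exact: sqrtr_ge0.
- split; last by apply: eq_Li Gi => x; rewrite gam2.
  apply: (mf_comp (f := Num.sqrt)); last exact: Li_meas.
  by apply: continuous_mf; exact: sqrt_continuous.
- move=> x xo; rewrite /gam (_ : RI _ = 0) ?sqrtr0// -(RI0 R); apply: eq_RI => y.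
  by rewrite g0 ?(negbTE xo)// /cnorm2 Re0 Im0 expr0n addr0.
Qed.

Let gR x : L2r (fun y => Re (g x y)).
Proof.
have [mr mi g0 gi Gi] := gN.
have m : mf (fun y => Re (g x y)) by apply: (@mf2_comp _ _ _ _ (fun=> x) id mr).
split => //; apply: (Li_le (mf_sqr m) (gi x)) => y.
by rewrite ger0_norm ?sqr_ge0//; exact: Re_sqr_le.
Qed.

Let gI x : L2r (fun y => Im (g x y)).
Proof.
have [mr mi g0 gi Gi] := gN.
have m : mf (fun y => Im (g x y)) by apply: (@mf2_comp _ _ _ _ (fun=> x) id mi).
split => //; apply: (Li_le (mf_sqr m) (gi x)) => y.
by rewrite ger0_norm ?sqr_ge0//; exact: Im_sqr_le.
Qed.

(** Real part of the integral term of the equation, [GI] being its imaginary part; each is a real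
    source in the sense of [src] once estimated. *)
Definition GR u x := RI (fun y => Re (g x y) * er L u y) - RI (fun y => Im (g x y) * ei L u y).
Definition GI u x := RI (fun y => Re (g x y) * ei L u y) + RI (fun y => Im (g x y) * er L u y).

Let GR_norm_le_aux (a b c d A B C D N : R) : a ^+ 2 <= A * C -> b ^+ 2 <= B * D ->
  0 <= A -> 0 <= B -> 0 <= C -> 0 <= D -> A + B = N -> (a + b) ^+ 2 <= N * (2 * (C + D)).
Proof.
by move=> h1 h2 A0 B0 C0 D0 <-; have := sqr_ge0 (a - b); have := mulr_ge0 A0 D0; have := mulr_ge0 B0 C0; nra.
Qed.

Let gam2E x : RI (fun y => Re (g x y) ^+ 2) + RI (fun y => Im (g x y) ^+ 2) = gam x ^+ 2.
Proof. by rewrite gam2 -RID; [|exact: (gR x).2|exact: (gI x).2]. Qed.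

Let abs_le (a b c : R) : 0 <= b -> 0 <= c -> a ^+ 2 <= b ^+ 2 * c -> `|a| <= b * Num.sqrt c.
Proof.
move=> b0 c0 H; have bc : 0 <= b * Num.sqrt c by rewrite mulr_ge0// sqrtr_ge0.
by rewrite -(@ler_pXn2r _ 2)// ?nnegrE// real_normK ?num_real// exprMn sqr_sqrtr.
Qed.

Let sq0 (f : R -> R) : 0 <= RI (fun x => f x ^+ 2).
Proof. by apply: RI_ge0 => x; exact: sqr_ge0. Qed.

Lemma GR_le u x : cL2 I u -> `|GR u x| <= gam x * Num.sqrt (2 * l2n L u).
Proof.
move=> uL; have uL' := uL; move: uL' => /cL2P[a b].
apply: abs_le; [exact: sqrtr_ge0|by rewrite mulr_ge0// l2n_ge0|].
rewrite l2nE//; apply: (@GR_norm_le_aux _ _ 0 0 _ _ _ _ _ _ _ _ _ _ _ (gam2E x)) => //.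
  exact: RI_cauchy.
by rewrite sqrrN; exact: RI_cauchy.
Qed.

Lemma GI_le u x : cL2 I u -> `|GI u x| <= gam x * Num.sqrt (2 * l2n L u).
Proof.
move=> uL; have uL' := uL; move: uL' => /cL2P[a b].
apply: abs_le; [exact: sqrtr_ge0|by rewrite mulr_ge0// l2n_ge0|].
rewrite l2nE// [X in 2 * X]addrC; apply: (@GR_norm_le_aux _ _ 0 0 _ _ _ _ _ _ _ _ _ _ _ (gam2E x)) => //.
  exact: RI_cauchy.
exact: RI_cauchy.
Qed.

Lemma GR_mf u : cL2 I u -> mf (GR u).
Proof.
have [mr mi _ _ _] := gN; move=> /cL2P[a b]; apply: mfB.
  have H : mf2 (fun x y => Re (g x y) * er L u y).
    by apply: measurable_funM => //; exact: (measurableT_comp a.1 measurable_snd).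
  exact: (mf_RI H).
have H : mf2 (fun x y => Im (g x y) * ei L u y).
  by apply: measurable_funM => //; exact: (measurableT_comp b.1 measurable_snd).
exact: (mf_RI H).
Qed.

Lemma GI_mf u : cL2 I u -> mf (GI u).
Proof.
have [mr mi _ _ _] := gN; move=> /cL2P[a b]; apply: mfD.
  have H : mf2 (fun x y => Re (g x y) * ei L u y).
    by apply: measurable_funM => //; exact: (measurableT_comp b.1 measurable_snd).
  exact: (mf_RI H).
have H : mf2 (fun x y => Im (g x y) * er L u y).
  by apply: measurable_funM => //; exact: (measurableT_comp a.1 measurable_snd).
exact: (mf_RI H).
Qed.

(** Equality at every [x], because each row is square integrable. Hence integrals over a single
    characteristic ignore the choice of representatives of the states. *)
Lemma G_ae u v x : cL2 I u -> cL2 I v -> aeq L u v -> GR u x = GR v x /\ GI u x = GI v x.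
Proof.
move=> /cL2P[a b] /cL2P[c d] uv; have e := ae_er uv.
have [p1 q1] := (gR x, gI x).
have h (k p q : R -> R) : mf k -> mf p -> mf q -> {ae mu, forall x, p x = q x} ->
    RI (fun y => k y * p y) = RI (fun y => k y * q y).
  move=> mk mp mq pq; apply: RI_ae; [exact: mfM|exact: mfM|].
  by apply: aeS pq => y ->.
have er_ := aeS (fun x => @proj1 _ _) e; have ei_ := aeS (fun x => @proj2 _ _) e.
split; rewrite /GR /GI.
  by rewrite (h _ _ _ (gR x).1 a.1 c.1 er_) (h _ _ _ (gI x).1 b.1 d.1 ei_).
by rewrite (h _ _ _ (gR x).1 b.1 d.1 ei_) (h _ _ _ (gI x).1 a.1 c.1 er_).
Qed.

Lemma G_lin (a b : R[i]) u v x : cL2 I u -> cL2 I v ->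
  GR (fun x => a * u x + b * v x) x = Re a * GR u x - Im a * GI u x + (Re b * GR v x - Im b * GI v x) /\
  GI (fun x => a * u x + b * v x) x = Re a * GI u x + Im a * GR u x + (Re b * GI v x + Im b * GR v x).
Proof.
move=> /cL2P[ur ui] /cL2P[vr vi].
have h (k p q r s : R -> R) (c1 c2 c3 c4 : R) : L2r k -> L2r p -> L2r q -> L2r r -> L2r s ->
  RI (fun y => k y * (c1 * p y + c2 * q y + (c3 * r y + c4 * s y))) =
   c1 * RI (fun y => k y * p y) + c2 * RI (fun y => k y * q y) + (c3 * RI (fun y => k y * r y) + c4 * RI (fun y => k y * s y)).
  move=> kL pL qL rL sL.
  have [k1 k2 k3 k4] := And4 (L2r_Li kL pL) (L2r_Li kL qL) (L2r_Li kL rL) (L2r_Li kL sL).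
  rewrite -!RIZ// -!RID; try (by apply: LiZ); try (by apply: LiD; apply: LiZ).
  by apply: eq_RI => y; ring.
have e1 y : er L (fun x => a * u x + b * v x) y = Re a * er L u y + - Im a * ei L u y + (Re b * er L v y + - Im b * ei L v y).
  by rewrite erD !erM !mulNr.
have e2 y : ei L (fun x => a * u x + b * v x) y = Im a * er L u y + Re a * ei L u y + (Im b * er L v y + Re b * ei L v y).
  by rewrite eiD !eiM; ring.
rewrite /GR /GI; under [X in RI X - _ = _ /\ _]eq_fun do rewrite e1.
split.
- rewrite (eq_RI (f := fun y => Im (g x y) * _) (h := fun y => Im (g x y) * (Im a * er L u y + Re a * ei L u y + (Im b * er L v y + Re b * ei L v y)))); last by move=> y; rewrite e2.
  by rewrite (h _ _ _ _ _ _ _ _ _ (gR x) ur ui vr vi) (h _ _ _ _ _ _ _ _ _ (gI x) ur ui vr vi); ring.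
- rewrite (eq_RI (f := fun y => Re (g x y) * _) (h := fun y => Re (g x y) * (Im a * er L u y + Re a * ei L u y + (Im b * er L v y + Re b * ei L v y)))); last by move=> y; rewrite e2.
  rewrite (eq_RI (f := fun y => Im (g x y) * _) (h := fun y => Im (g x y) * (Re a * er L u y + - Im a * ei L u y + (Re b * er L v y + - Im b * ei L v y)))); last by move=> y; rewrite e1.
  by rewrite (h _ _ _ _ _ _ _ _ _ (gR x) ur ui vr vi) (h _ _ _ _ _ _ _ _ _ (gI x) ur ui vr vi); ring.
Qed.

Lemma G_sub u v x : cL2 I u -> cL2 I v ->
  GR (fun x => u x - v x) x = GR u x - GR v x /\ GI (fun x => u x - v x) x = GI u x - GI v x.
Proof.
move=> uL vL; have [e1 e2] := @G_lin 1 (-1) u v x uL vL.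
have E : (fun x => u x - v x) = (fun x => 1 * u x + -1 * v x) by apply/funext => y; rewrite mul1r mulN1r.
by rewrite E e1 e2 /= ; split; ring.
Qed.

Lemma G_supp u x : ~~ (0 < x < L) -> GR u x = 0 /\ GI u x = 0.
Proof.
have [_ _ g0 _ _] := gN; move=> xo.
have h (p k : R -> R) : (forall y, k y = 0) -> RI (fun y => k y * p y) = 0.
  by move=> k0; rewrite -(RI0 R); apply: eq_RI => y; rewrite k0 mul0r.
have gy y : g x y = 0 by rewrite g0// (negbTE xo).
by rewrite /GR /GI !h ?subr0 ?addr0// => y; rewrite gy.
Qed.

Section adjoint.
(** [k] stands for the real or imaginary part of [g], and [p] for a component of a test function at
    a fixed time. *)
Variables (k : R -> R -> R) (p : R -> R).
Hypothesis k_m : mf2 k.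
Hypothesis k_L2 : forall y, L2r (k y).
Hypothesis k_gam : forall y, RI (fun x => k y x ^+ 2) <= gam y ^+ 2.
Hypothesis k_supp : forall y x, ~~ (0 < x < L) -> k y x = 0.
Hypothesis p_c : continuous p.

Let F (a : R -> R) y x := ind 0 L y * p y * (k y x * a x).

Let F_Li2 a : L2r a -> Li2 (F a).
Proof.
move=> aL; have [C HC] := @continuous_bounded R p L p_c.
have [_ _ gamL gam0] := gam_weight.
have pC y : `|ind 0 L y * p y| <= `|C| * ind 0 L y.
  rewrite ind_ifE; case: ifPn => [/andP[h1 h2]|_]; last by rewrite mul0r mulr0 normr0.
  rewrite mul1r mulr1 (le_trans (HC y _)) ?ler_norm// ger0_norm; exact: ltW.
have mF : mf2 (F a).
  apply: measurable_funM.
    apply: (measurableT_comp (f := fun y => ind 0 L y * p y)) => //.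
    by apply: mfM; [exact: measurable_ind|exact: continuous_mf].
  by apply: measurable_funM => //; exact: (measurableT_comp aL.1 measurable_snd).
have kn y : L2r (fun x => `|k y x|) by apply: (L2r_dom _ (k_L2 y)) => [|x]; rewrite ?normr_id//; exact: mf_norm (k_L2 y).1.
have an : L2r (fun x => `|a x|) by apply: (L2r_dom _ aL) => [|x]; rewrite ?normr_id//; exact: mf_norm aL.1.
apply: (@Li2_dom _ (F a) (fun y x => `|C| * (`|k y x| * `|a x|)) (fun y => `|C| * Num.sqrt (RI (fun x => a x ^+ 2)) * gam y)) => //.
- move=> y x; rewrite /F normrM normrM [in X in _ * X]normrM; apply: ler_wpM2r; first exact: mulr_ge0.
  by rewrite -normrM (le_trans (pC y))// ler_piMr// ind_le1.
- by move=> y; apply: LiZ; exact: L2r_Li.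
- move=> y; rewrite RIZ; last exact: L2r_Li.
  rewrite -mulrA ler_wpM2l// mulrC.
  apply: (le_trans (ler_norm _)); apply: abs_le; [exact: sqrtr_ge0|exact: sq0|].
  apply: le_trans (RI_cauchy (kn y) an) _.
  under eq_fun do rewrite real_normK ?num_real//.
  under [X in _ * RI X <= _]eq_fun do rewrite real_normK ?num_real//.
  by apply: ler_wpM2r; [exact: sq0|exact: k_gam].
- by apply: LiZ; exact: gam_Li gam_weight.
Qed.

(** The hypotheses control every row, but Fubini gives columns only almost everywhere; the
    identities involving the adjoint are therefore almost everywhere ones. *)
Lemma adjoint_col_Li : {ae mu, forall x, Li (fun y => ind 0 L y * (k y x * p y))}.
Proof.
have := ae_integrable1 (Li2_swap (F_Li2 (L2r_ind 0 L))).
apply: aeS => x H; have [xI|xo] := boolP (0 < x < L).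
  by apply: eq_Li H => y /=; rewrite /F (indE xI); ring.
by apply: eq_Li (Li0 R) => y; rewrite k_supp// mul0r mulr0.
Qed.

Lemma adjoint_E a : L2r a -> [/\ Li (fun x => a x * RI (fun y => ind 0 L y * (k y x * p y))),
  Li (fun y => ind 0 L y * p y * RI (fun x => k y x * a x)) &
  RI (fun x => a x * RI (fun y => ind 0 L y * (k y x * p y))) =
  RI (fun y => ind 0 L y * p y * RI (fun x => k y x * a x))].
Proof.
move=> aL; have F2 := F_Li2 aL.
have e1 y : RI (F a y) = ind 0 L y * p y * RI (fun x => k y x * a x).
  by rewrite /F RIZ//; exact: L2r_Li.
have mq : mf (fun x => RI (fun y => ind 0 L y * (k y x * p y))).
  have H : mf2 (fun x y => ind 0 L y * (k y x * p y)).
    apply: measurable_funM; first exact: (measurableT_comp (measurable_ind 0 L) measurable_snd).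
    apply: measurable_funM; first exact: (mf2_comp k_m measurable_snd measurable_fst).
    exact: (measurableT_comp (continuous_mf p_c) measurable_snd).
  exact: (mf_RI H).
have i2 := Li2_Li (Li2_swap F2).
have ae2 : {ae mu, forall x, RI (fun y => F a y x) = a x * RI (fun y => ind 0 L y * (k y x * p y))}.
  apply: aeS adjoint_col_Li => x H; rewrite -RIZ//; apply: eq_RI => y.
  by rewrite /F; ring.
have m2 : mf (fun x => a x * RI (fun y => ind 0 L y * (k y x * p y))) by apply: mfM => //; exact: aL.1.
split.
- apply/integrableP; split; first exact/measurable_EFinP.
  have /integrableP[_] := i2; apply: le_lt_trans; rewrite le_eqVlt; apply/orP; left; apply/eqP.
  apply: ae_eq_integral => //.
  + by apply: measurableT_comp => //; apply/measurable_EFinP; exact: m2.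
  + by apply: measurableT_comp => //; apply/measurable_EFinP; exact: (Li_meas i2).
  + by apply: aeS ae2 => x /= -> _.
- by apply: eq_Li e1 (Li2_Li F2).
- rewrite -(eq_RI e1) (RI_fubini F2); apply/esym; apply: RI_ae => //.
  exact: Li_meas.
Qed.

End adjoint.

(** Moves the adjoint operator from the test function to the state: the inner integral of the weak
    form becomes a transport term and a source built from [GR] and [GI]. *)
Lemma adjointE u (a ph : R -> R[i]) : cL2 I u ->
  continuous (fun x => Re (a x)) -> continuous (fun x => Im (a x)) ->
  continuous (fun x => Re (ph x)) -> continuous (fun x => Im (ph x)) ->
  cint I (fun x => u x * conjc (a x - cint I (fun y => conjc (g y x) * ph y))) =
  Complex
   (RI (fun x => ind 0 L x * (Re (u x) * Re (a x))) - RI (fun y => GR u y * Re (ph y)) +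
    (RI (fun x => ind 0 L x * (Im (u x) * Im (a x))) - RI (fun y => GI u y * Im (ph y))))
   (RI (fun x => ind 0 L x * (Im (u x) * Re (a x))) - RI (fun y => GI u y * Re (ph y)) -
    (RI (fun x => ind 0 L x * (Re (u x) * Im (a x))) - RI (fun y => GR u y * Im (ph y)))).
Proof.
move=> /cL2P[ur ui] ca cb cp cq.
have [mr mi g0 _ _] := gN.
have gRg y : RI (fun x => Re (g y x) ^+ 2) <= gam y ^+ 2 by rewrite -gam2E lerDl.
have gIg y : RI (fun x => Im (g y x) ^+ 2) <= gam y ^+ 2 by rewrite -gam2E lerDr.
have gRs y x : ~~ (0 < x < L) -> Re (g y x) = 0 by move=> xo; rewrite g0// (negbTE xo) andbF.
have gIs y x : ~~ (0 < x < L) -> Im (g y x) = 0 by move=> xo; rewrite g0// (negbTE xo) andbF.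
pose Q (k : R -> R -> R) (p : R -> R) x := RI (fun y => ind 0 L y * (k y x * p y)).
pose kR y x := Re (g y x); pose kI y x := Im (g y x).
pose pR y := Re (ph y); pose pI y := Im (ph y).
have [c1 c2] := (adjoint_col_Li mr gR gRg gRs cp, adjoint_col_Li mr gR gRg gRs cq).
have [c3 c4] := (adjoint_col_Li mi gI gIg gIs cp, adjoint_col_Li mi gI gIg gIs cq).
have qE : {ae mu, forall x, Re (cint I (fun y => conjc (g y x) * ph y)) = Q kR pR x + Q kI pI x /\
    Im (cint I (fun y => conjc (g y x) * ph y)) = Q kR pI x - Q kI pR x}.
  apply: aeS (aeI (aeI c1 c2) (aeI c3 c4)) => x [[l1 l2] [l3 l4]]; split.
    rewrite /= Rintegral_ind -RID//; apply: eq_RI => y.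
    by rewrite ReM ReJ ImJ /kR /kI /pR /pI; ring.
  rewrite /= Rintegral_ind -RIB//; apply: eq_RI => y.
  by rewrite ImM ReJ ImJ /kR /kI /pR /pI; ring.
have mQ (k : R -> R -> R) (p : R -> R) : mf2 k -> continuous p -> mf (Q k p).
  move=> km pc; have H : mf2 (fun x y => ind 0 L y * (k y x * p y)).
    apply: measurable_funM; first exact: (measurableT_comp (measurable_ind 0 L) measurable_snd).
    apply: measurable_funM; first exact: (mf2_comp km measurable_snd measurable_fst).
    exact: (measurableT_comp (continuous_mf pc) measurable_snd).
  exact: (mf_RI H).
have X (w b : R -> R) : L2r (fun x => ind 0 L x * w x) -> continuous b -> Li (fun x => ind 0 L x * (w x * b x)).
  move=> wL bc; have [C HC] := @continuous_bounded R b L bc.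
  apply: (Li_le (h := fun x => `|C| * `|ind 0 L x * (ind 0 L x * w x)|)).
  - have -> : (fun x => ind 0 L x * (w x * b x)) = (fun x => (ind 0 L x * w x) * b x).
      by apply/funext => x; ring.
    by apply: mfM; [exact: wL.1|exact: continuous_mf].
  - by apply: LiZ; apply: Li_norm; exact: L2r_Li (L2r_ind 0 L) wL.
  - move=> x; rewrite ind_ifE; case: ifPn => [/andP[h1 h2]|_]; last by rewrite !mul0r normr0 mulr0.
    rewrite !mul1r normrM mulrC ler_wpM2r// (le_trans (HC x _)) ?ler_norm// ger0_norm; exact: ltW.
have [a1 b1 e1] := adjoint_E mr gR gRg gRs cp ur.
have [a2 b2 e2] := adjoint_E mi gI gIg gIs cq ur.
have [a3 b3 e3] := adjoint_E mr gR gRg gRs cq ui.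
have [a4 b4 e4] := adjoint_E mi gI gIg gIs cp ui.
have [a5 b5 e5] := adjoint_E mr gR gRg gRs cp ui.
have [a6 b6 e6] := adjoint_E mi gI gIg gIs cq ui.
have [a7 b7 e7] := adjoint_E mr gR gRg gRs cq ur.
have [a8 b8 e8] := adjoint_E mi gI gIg gIs cp ur.
have sR y : GR u y = ind 0 L y * GR u y.
  by rewrite ind_ifE; case: ifPn => [_|/(G_supp u)[-> _]]; rewrite ?mul1r ?mulr0.
have sI y : GI u y = ind 0 L y * GI u y.
  by rewrite ind_ifE; case: ifPn => [_|/(G_supp u)[_ ->]]; rewrite ?mul1r ?mulr0.
have f1 : RI (fun y => GR u y * Re (ph y)) = RI (fun x => er L u x * Q kR pR x) - RI (fun x => ei L u x * Q kI pR x).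
  by rewrite e1 e4 -(RIB b1 b4); apply: eq_RI => y; rewrite sR /GR; ring.
have f2 : RI (fun y => GI u y * Im (ph y)) = RI (fun x => ei L u x * Q kR pI x) + RI (fun x => er L u x * Q kI pI x).
  by rewrite e3 e2 -(RID b3 b2); apply: eq_RI => y; rewrite sI /GI; ring.
have f3 : RI (fun y => GI u y * Re (ph y)) = RI (fun x => ei L u x * Q kR pR x) + RI (fun x => er L u x * Q kI pR x).
  by rewrite e5 e8 -(RID b5 b8); apply: eq_RI => y; rewrite sI /GI; ring.
have f4 : RI (fun y => GR u y * Im (ph y)) = RI (fun x => er L u x * Q kR pI x) - RI (fun x => ei L u x * Q kI pI x).
  by rewrite e7 e6 -(RIB b7 b6); apply: eq_RI => y; rewrite sR /GR; ring.
have [x1 x2] := (X _ _ ur ca, X _ _ ui cb); have [x3 x4] := (X _ _ ui ca, X _ _ ur cb).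
have comb (p q r s t v : R -> R) : Li p -> Li q -> Li r -> Li s -> Li t -> Li v ->
    RI (fun x => p x + q x - (r x + s x) - (t x - v x)) = RI p + RI q - (RI r + RI s) - (RI t - RI v).
  move=> pi qi ri si ti vi; rewrite (RIB (LiB (LiD pi qi) (LiD ri si)) (LiB ti vi)).
  by rewrite (RIB (LiD pi qi) (LiD ri si)) (RID pi qi) (RID ri si) (RIB ti vi).
have comb' (p q r s t v : R -> R) : Li p -> Li q -> Li r -> Li s -> Li t -> Li v ->
    RI (fun x => p x - q x - (r x + s x) + (t x - v x)) = RI p - RI q - (RI r + RI s) + (RI t - RI v).
  move=> pi qi ri si ti vi; rewrite (RID (LiB (LiB pi qi) (LiD ri si)) (LiB ti vi)).
  by rewrite (RIB (LiB pi qi) (LiD ri si)) (RIB pi qi) (RID ri si) (RIB ti vi).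
have mc (w : R -> R[i]) : mf (fun x => Re (cint I (fun y => conjc (g y x) * ph y))) /\
    mf (fun x => Im (cint I (fun y => conjc (g y x) * ph y))).
  have m1 : mf2 (fun x y => ind 0 L y * Re (conjc (g y x) * ph y)).
    have -> : (fun x y => ind 0 L y * Re (conjc (g y x) * ph y)) =
        (fun x y => ind 0 L y * (Re (g y x) * Re (ph y) + Im (g y x) * Im (ph y))).
      by apply/funext => x; apply/funext => y; rewrite ReM ReJ ImJ; ring.
    apply: measurable_funM; first exact: (measurableT_comp (measurable_ind 0 L) measurable_snd).
    apply: measurable_funD; apply: measurable_funM.
    + exact: (mf2_comp mr measurable_snd measurable_fst).
    + exact: (measurableT_comp (continuous_mf cp) measurable_snd).
    + exact: (mf2_comp mi measurable_snd measurable_fst).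
    + exact: (measurableT_comp (continuous_mf cq) measurable_snd).
  have m2 : mf2 (fun x y => ind 0 L y * Im (conjc (g y x) * ph y)).
    have -> : (fun x y => ind 0 L y * Im (conjc (g y x) * ph y)) =
        (fun x y => ind 0 L y * (Re (g y x) * Im (ph y) - Im (g y x) * Re (ph y))).
      by apply/funext => x; apply/funext => y; rewrite ImM ReJ ImJ; ring.
    apply: measurable_funM; first exact: (measurableT_comp (measurable_ind 0 L) measurable_snd).
    apply: measurable_funB; apply: measurable_funM.
    + exact: (mf2_comp mr measurable_snd measurable_fst).
    + exact: (measurableT_comp (continuous_mf cq) measurable_snd).
    + exact: (mf2_comp mi measurable_snd measurable_fst).
    + exact: (measurableT_comp (continuous_mf cp) measurable_snd).
  split; [apply: eq_mf (mf_RI m1)|apply: eq_mf (mf_RI m2)] => x; by rewrite /= Rintegral_ind.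
have [mcR mcI] := mc u.
have [maR maI] := (continuous_mf ca, continuous_mf cb).
apply: cplx_eq.
- rewrite [LHS]/= Rintegral_ind [RHS]/= f1 f2.
  transitivity (RI (fun x => ind 0 L x * (Re (u x) * Re (a x)) + ind 0 L x * (Im (u x) * Im (a x))
     - (er L u x * Q kR pR x + er L u x * Q kI pI x) - (ei L u x * Q kR pI x - ei L u x * Q kI pR x))).
    apply: RI_ae.
    + apply: (eq_mf (f := fun x => er L u x * (Re (a x) - Re (cint I (fun y => conjc (g y x) * ph y))) +
         ei L u x * (Im (a x) - Im (cint I (fun y => conjc (g y x) * ph y))))).
        by move=> x; rewrite /er /ei ReM ReJ ImJ ReB ImB; ring.
      by apply: mfD; apply: mfM; [exact: ur.1|exact: mfB|exact: ui.1|exact: mfB].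
    + exact: (Li_meas (LiB (LiB (LiD x1 x2) (LiD a1 a2)) (LiB a3 a4))).
    + by apply: aeS qE => x [q1 q2]; rewrite ReM ReJ ImJ ReB ImB q1 q2 /er /ei; ring.
  apply: (etrans (comb _ _ _ _ _ _ x1 x2 a1 a2 a3 a4)).
  suff rg (p q r s t v : R) : p + q - (r + s) - (t - v) = p - (r - v) + (q - (t + s)) by exact: rg.
  by ring.
- rewrite [LHS]/= Rintegral_ind [RHS]/= f3 f4.
  transitivity (RI (fun x => ind 0 L x * (Im (u x) * Re (a x)) - ind 0 L x * (Re (u x) * Im (a x))
     - (ei L u x * Q kR pR x + er L u x * Q kI pR x) + (er L u x * Q kR pI x - ei L u x * Q kI pI x))).
    apply: RI_ae.
    + apply: (eq_mf (f := fun x => ei L u x * (Re (a x) - Re (cint I (fun y => conjc (g y x) * ph y))) -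
         er L u x * (Im (a x) - Im (cint I (fun y => conjc (g y x) * ph y))))).
        by move=> x; rewrite /er /ei ImM ReJ ImJ ReB ImB; ring.
      by apply: mfB; apply: mfM; [exact: ui.1|exact: mfB|exact: ur.1|exact: mfB].
    + exact: (Li_meas (LiD (LiB (LiB x3 x4) (LiD a5 a8)) (LiB a7 a6))).
    + by apply: aeS qE => x [q1 q2]; rewrite ImM ReJ ImJ ReB ImB q1 q2 /er /ei; ring.
  apply: (etrans (comb' _ _ _ _ _ _ x3 x4 a5 a8 a7 a6)).
  suff rg (p q r s t v : R) : p - q - (r + s) + (t - v) = p - (r + s) - (q - (t - v)) by exact: rg.
  by ring.
Qed.

End kernel.

(** Negation exchanges the two parts of [f], compatibly with the value of [fine] at infinity; signs
    can thus be moved before any integrability in time has been established. *)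
Lemma RI_oppr (R : realType) (f : R -> R) : RI (fun x => - f x) = - RI f.
Proof.
rewrite /RI /Rintegral [in LHS]integralE [in RHS]integralE.
set p := integral _ _ _; set n := integral _ _ _; set p' := integral _ _ _; set n' := integral _ _ _.
have -> : p = n' by apply: eq_integral => x _; rewrite funeposE funenegE.
have -> : n = p' by apply: eq_integral => x _; rewrite funeposE funenegE/= opprK.
have : (0 <= p')%E by apply: integral_ge0 => x _; exact: funepos_ge0.
have : (0 <= n')%E by apply: integral_ge0 => x _; exact: funeneg_ge0.
by case: p' => [r| |]; case: n' => [q| |] //= _ _; rewrite ?oppr0// opprB.
Qed.

Lemma add_balance (R : realType) (a1 a2 b1 b2 c1 c2 e1 e2 : R) :
  a1 + b1 - c1 - e1 = 0 -> a2 + b2 - c2 - e2 = 0 ->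
  (a1 + a2) + (b1 + b2) - (c1 + c2) - (e1 + e2) = 0.
Proof. by lra. Qed.

Lemma sub_balance (R : realType) (a1 a2 b1 b2 c1 c2 e1 e2 : R) :
  a1 + b1 - c1 - e1 = 0 -> a2 + b2 - c2 - e2 = 0 ->
  (a1 - a2) + (b1 - b2) - (c1 - c2) - (e1 - e2) = 0.
Proof. by lra. Qed.

Lemma balance_components (R : realType) (a1 a2 b1 b2 c1 c2 e1 e2 : R) :
  Complex (- a1) (- a2) + Complex b1 b2 - Complex c1 c2 - Complex e1 e2 = 0 ->
  a1 = b1 - c1 - e1 /\ a2 = b2 - c2 - e2.
Proof. by move=> [h1 h2]; split; lra. Qed.

(** * Weak and mild solutions *)

Section weak_and_mild.
Variable R : realType.
Local Notation Re := complex.Re.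
Local Notation Im := complex.Im.
Local Notation mu := (@lebesgue_measure R).
Local Notation aeq := (@Defs.ae_eq R).
Variables (L : R) (g : R -> R -> R[i]).
Local Notation I := `]0, L[%classic.
Hypothesis L0 : 0 < L.
Hypothesis gN : nice_kernel L g.
Local Notation gam := (gam g).
Let wgt : weight L gam. Proof. exact: gam_weight. Qed.

(** Compactness of [[0, T]] through a supremum: the local bound there pushes the bounded interval
    past its own supremum unless [T] has been reached. *)
Lemma C0L2_bounded (T : R) u : 0 <= T -> C0L2 L T u ->
  exists B, forall t, 0 <= t <= T -> l2n L (u t) <= B.
Proof.
move=> T0 [uL uc].
have inT t : 0 <= t <= T -> `[0, T]%classic t by rewrite /= in_itv.
have loc t0 : 0 <= t0 <= T -> exists d B : R, 0 < d /\ forall s, 0 <= s <= T -> `|s - t0| < d -> l2n L (u s) <= B.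
  move=> t0T; have [d d0 Hd] := uc _ (inT _ t0T) 1 ltr01.
  exists d, (2 * 1 + 2 * l2n L (u t0)); split => // s sT sd.
  have := l2nD (cL2B (uL _ (inT _ sT)) (uL _ (inT _ t0T))) (uL _ (inT _ t0T)).
  under eq_fun do rewrite subrK.
  by have := Hd _ (inT _ sT) sd; lra.
pose A := [set t | 0 <= t <= T /\ exists B, forall s, 0 <= s <= t -> l2n L (u s) <= B].
have A0 : A 0.
  split; first by rewrite lexx.
  by exists (l2n L (u 0)) => s s0; rewrite (_ : s = 0)//; apply/eqP; rewrite eq_le andbC.
have supA : has_sup A by split; [exists 0|exists T => t [/andP[]]].
pose sg := sup A.
have sg0 : 0 <= sg by exact: sup_ub_strict A0 || exact: (ub_le_sup supA.2 A0).
have sgT : sg <= T by apply: sup_le_ub; [exists 0|move=> t [/andP[]]].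
have [d [B [d0 HB]]] := loc sg (ltac:(by rewrite sg0 sgT)).
have [t [/andP[t0 tT] [B' HB']] tsg] := sup_adherent d0 supA.
pose t' := Num.min (sg + d / 2) T.
have At' : forall s, 0 <= s <= t' -> l2n L (u s) <= Num.max B B'.
  move=> s /andP[s0]; rewrite le_min => /andP[s1 s2]; rewrite le_max.
  have [st|st] := leP s t; first by rewrite HB' ?orbT ?s0.
  by rewrite HB ?s0//= ltr_norml; apply/andP; split; rewrite -/sg in tsg; lra.
have : A t'.
  split; last by exists (Num.max B B').
  by rewrite ge_min lexx orbT andbT le_min T0 addr_ge0// divr_ge0// ltW.
move=> /(ub_le_sup supA.2); rewrite -/sg ge_min => /orP[h|h]; first lra.
exists (Num.max B B') => s /andP[s0 sT]; apply: At'; rewrite s0 le_min sT andbT /=.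
lra.
Qed.

(** The time window extends the source to all [s] and provides the support condition of
    [caratheodory]. *)
Definition fR (T : R) (u : R -> R -> R[i]) s x := (0 <= s <= T)%R%:R * GR L g (u s) x.
Definition fI (T : R) (u : R -> R -> R[i]) s x := (0 <= s <= T)%R%:R * GI L g (u s) x.

(** [GR_le] and [GI_le] turn the norm of a difference of states into a bound at each [x], so
    continuity in time of the states becomes continuity in [s] of the source at fixed [x]. *)
Lemma src_C0L2 (T : R) u : 0 <= T -> C0L2 L T u ->
  exists M, src gam M (fR T u) /\ src gam M (fI T u).
Proof.
move=> T0 uC; have [B HB] := C0L2_bounded T0 uC; have [uL uc] := uC.
have inT t : 0 <= t <= T -> `[0, T]%classic t by rewrite /= in_itv.
have [_ gam0 _ _] := wgt.
have bound s x (H : R -> R) : (0 <= s <= T -> `|H x| <= gam x * Num.sqrt (2 * l2n L (u s))) ->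
    `|(0 <= s <= T)%R%:R * H x| <= Num.sqrt (2 * B) * gam x.
  case: (boolP (0 <= s <= T)) => [sT /(_ isT) h|_ _]; last by rewrite mul0r normr0 mulr_ge0// sqrtr_ge0.
  rewrite mul1r (le_trans h)// mulrC ler_wpM2r// ler_wsqrtr// ler_wpM2l//.
  exact: HB.
have ctn (x s0 : R) : 0 <= s0 <= T -> forall eps, 0 < eps -> exists2 d : R, 0 < d &
    forall s, 0 <= s <= T -> `|s - s0| < d -> gam x * Num.sqrt (2 * l2n L (fun x => u s x - u s0 x)) < eps.
  move=> s0T eps eps0.
  have gp : 0 < gam x + 1 by rewrite ltr_wpDl.
  have e0 : 0 < (eps / (gam x + 1)) ^+ 2 / 2 by rewrite divr_gt0// exprn_gt0// divr_gt0.
  have [d d0 Hd] := uc _ (inT _ s0T) _ e0; exists d => // s sT sd.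
  have := Hd _ (inT _ sT) sd; set l := l2n _ _ => Hl.
  have h : Num.sqrt (2 * l) < eps / (gam x + 1).
    rewrite -[X in _ < X]ger0_norm; last by rewrite divr_ge0// ltW.
    rewrite -sqrtr_sqr ltr_sqrt; last by rewrite exprn_gt0// divr_gt0.
    by lra.
  apply: (@le_lt_trans _ _ ((gam x + 1) * Num.sqrt (2 * l))).
    by rewrite ler_wpM2r ?sqrtr_ge0// lerDl.
  by rewrite mulrC -ltr_pdivlMr.
exists (Num.sqrt (2 * B)); split; split.
- apply: (caratheodory T0).
  + move=> s; case: (boolP (0 <= s <= T)) => sT; last first.
      by apply: (eq_mf (f := fun=> 0)) (mf_cst 0) => x; rewrite /fR (negbTE sT) mul0r.
    by apply: mfM; [exact: mf_cst|apply: GR_mf => //; exact: uL (inT _ sT)].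
  + by move=> s x /negbTE sT; rewrite /fR sT mul0r.
  + move=> x s0 s0T eps eps0; have [d d0 Hd] := ctn x s0 s0T eps eps0; exists d => // s sT sd.
    have [us us0] := (uL _ (inT _ sT), uL _ (inT _ s0T)).
    rewrite /fR sT s0T !mul1r -(G_sub gN x us us0).1; apply: le_lt_trans (Hd _ sT sd).
    by apply: GR_le => //; exact: cL2B.
- by move=> s x; apply: bound => sT; apply: GR_le => //; exact: uL (inT _ sT).
- apply: (caratheodory T0).
  + move=> s; case: (boolP (0 <= s <= T)) => sT; last first.
      by apply: (eq_mf (f := fun=> 0)) (mf_cst 0) => x; rewrite /fI (negbTE sT) mul0r.
    by apply: mfM; [exact: mf_cst|apply: GI_mf => //; exact: uL (inT _ sT)].
  + by move=> s x /negbTE sT; rewrite /fI sT mul0r.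
  + move=> x s0 s0T eps eps0; have [d d0 Hd] := ctn x s0 s0T eps eps0; exists d => // s sT sd.
    have [us us0] := (uL _ (inT _ sT), uL _ (inT _ s0T)).
    rewrite /fI sT s0T !mul1r -(G_sub gN x us us0).2; apply: le_lt_trans (Hd _ sT sd).
    by apply: GI_le => //; exact: cL2B.
- by move=> s x; apply: bound => sT; apply: GI_le => //; exact: uL (inT _ sT).
Qed.

Definition cwave (T : R) (d : R -> R[i]) (u : R -> R -> R[i]) t c : R[i] :=
  Complex (wave (fR T u) (fun c => Re (d c)) t c) (wave (fI T u) (fun c => Im (d c)) t c).

Definition mild (T : R) (d : R -> R[i]) (u : R -> R -> R[i]) :=
  [/\ C0L2 L T u, L2r (fun c => Re (d c)), L2r (fun c => Im (d c)) &
   forall t, 0 <= t <= T -> aeq L (u t) (fun x => cwave T d u t (x + t))].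

Lemma cintRe (a b : R) (f : R -> R[i]) : Re (cint `]a, b[%classic f) = RI (fun x => ind a b x * Re (f x)).
Proof. exact: Rintegral_ind. Qed.

Lemma cintIm (a b : R) (f : R -> R[i]) : Im (cint `]a, b[%classic f) = RI (fun x => ind a b x * Im (f x)).
Proof. exact: Rintegral_ind. Qed.

Lemma cint_conj (al be : R) (w p : R -> R[i]) (a b : R -> R) :
  mf (fun x => ind al be x * Re (w x)) -> mf (fun x => ind al be x * Im (w x)) ->
  {ae mu, forall x, al < x < be -> Re (w x) = a x /\ Im (w x) = b x} -> L2r a -> L2r b ->
  continuous (fun x => Re (p x)) -> continuous (fun x => Im (p x)) ->
  cint `]al, be[%classic (fun x => w x * conjc (p x)) =
  Complex (RI (fun x => ind al be x * (a x * Re (p x))) + RI (fun x => ind al be x * (b x * Im (p x))))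
    (RI (fun x => ind al be x * (b x * Re (p x))) - RI (fun x => ind al be x * (a x * Im (p x)))).
Proof.
move=> mr mi wab aL bL cr ci.
have X (q c : R -> R) : L2r q -> continuous c -> Li (fun x => ind al be x * (q x * c x)).
  move=> qL cc; have := L2r_Li (L2r_ind_continuous al be cc) qL.
  by apply: eq_Li => x; ring.
have [x1 x2] := (X _ _ aL cr, X _ _ bL ci); have [x3 x4] := (X _ _ bL cr, X _ _ aL ci).
have [mcr mci] := (continuous_mf cr, continuous_mf ci).
rewrite /cint !Rintegral_ind; congr (Complex _ _).
- rewrite -(RID x1 x2); apply: RI_ae; last 1 first.
  + apply: aeS wab => x H; rewrite ReM ReJ ImJ ind_ifE; case: ifPn => [/H[-> ->]|_]; last by rewrite !mul0r addr0.
    by ring.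
  + apply: (eq_mf (f := fun x => (ind al be x * Re (w x)) * Re (p x) + (ind al be x * Im (w x)) * Im (p x))).
      by move=> x; rewrite ReM ReJ ImJ; ring.
    by apply: mfD; exact: mfM.
  + exact: Li_meas (LiD x1 x2).
- rewrite -(RIB x3 x4); apply: RI_ae; last 1 first.
  + apply: aeS wab => x H; rewrite ImM ReJ ImJ ind_ifE; case: ifPn => [/H[-> ->]|_]; last by rewrite !mul0r subrr.
    by ring.
  + apply: (eq_mf (f := fun x => (ind al be x * Im (w x)) * Re (p x) - (ind al be x * Re (w x)) * Im (p x))).
      by move=> x; rewrite ImM ReJ ImJ; ring.
    by apply: mfB; exact: mfM.
  + exact: Li_meas (LiB x3 x4).
Qed.

Let TB f d phi tau := RI (fun t => ind 0 tau t *
   (RI (fun x => ind 0 L x * (wave f d t (x + t) * (- ft phi t x + fx phi t x))) - RI (fun x => f t x * phi t x))).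

(** The complex identity splits into four real ones, pairing a component of the wave with a
    component of the test function. *)
Lemma mild_to_weak (T : R) d u u0 (U : R -> R[i]) : 0 <= T -> mild T d u -> cL2 I u0 ->
  mf (fun t => ind 0 T t * Re (U t)) -> mf (fun t => ind 0 T t * Im (U t)) ->
  aeq L d u0 -> {ae mu, forall t, 0 < t < T -> d (t + L) = U t} -> weak_sol L g T u0 U u.
Proof.
move=> T0 [uC dR dI um] u0L mUR mUI du0 dU; split=> // tau; rewrite /= in_itv/= => /andP[tau0 tauT] phi [phC phD] phi0.
have [M [sR sI]] := src_C0L2 T0 uC; have [uL _] := uC.
have inT t : 0 <= t <= T -> `[0, T]%classic t by rewrite /= in_itv.
pose pR t x := Re (phi t x); pose pI t x := Im (phi t x).
have pR0 t : 0 <= t <= tau -> pR t 0 = 0 by move=> h; rewrite /pR phi0//= in_itv.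
have pI0 t : 0 <= t <= tau -> pI t 0 = 0 by move=> h; rewrite /pI phi0//= in_itv.
pose dr c := Re (d c); pose di c := Im (d c).
have mw f dd ph := fun (fS : src gam M f) (dL : L2r dd) (pC : C1_2 ph) (p0 : forall t, 0 <= t <= tau -> ph t 0 = 0) =>
  mild_weak wgt fS dL pC tau0 p0.
have W1 := mw _ dr pR sR dR phC pR0; have W2 := mw _ di pI sI dI phD pI0.
have W3 := mw _ di pR sI dI phC pR0; have W4 := mw _ dr pI sR dR phD pI0.
have i1 := mild_weak_Li wgt sR dR phC tau0; have i2 := mild_weak_Li wgt sI dI phD tau0.
have i3 := mild_weak_Li wgt sI dI phC tau0; have i4 := mild_weak_Li wgt sR dR phD tau0.
have wr t := L2r_shift t (wave_L2r wgt sR t dR); have wi t := L2r_shift t (wave_L2r wgt sI t dI).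
have cx (ph : R -> R -> R) t : C1_2 ph -> continuous (ph t) by move=> pC; exact: continuous_f2 pC t.
have erm t : 0 <= t <= T -> mf (fun x => ind 0 L x * Re (u t x)) /\ mf (fun x => ind 0 L x * Im (u t x)).
  by move=> tT; have /cL2P[[a _] [b _]] := uL _ (inT _ tT).
rewrite (_ : cint `]0, tau[%classic _ = Complex (TB (fR T u) dr pR tau + TB (fI T u) di pI tau)
    (TB (fI T u) di pR tau - TB (fR T u) dr pI tau)); last first.
  have inner t : 0 < t < tau -> cint I (fun x => u t x * conjc (- dt phi t x + dx phi t x
      - cint I (fun y => conjc (g y x) * phi t y))) =
    Complex ((RI (fun x => ind 0 L x * (wave (fR T u) dr t (x + t) * (- ft pR t x + fx pR t x))) - RI (fun x => fR T u t x * pR t x)) +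
      (RI (fun x => ind 0 L x * (wave (fI T u) di t (x + t) * (- ft pI t x + fx pI t x))) - RI (fun x => fI T u t x * pI t x)))
     ((RI (fun x => ind 0 L x * (wave (fI T u) di t (x + t) * (- ft pR t x + fx pR t x))) - RI (fun x => fI T u t x * pR t x)) -
      (RI (fun x => ind 0 L x * (wave (fR T u) dr t (x + t) * (- ft pI t x + fx pI t x))) - RI (fun x => fR T u t x * pI t x))).
    move=> /andP[t0 tt]; have tT : 0 <= t <= T by rewrite (ltW t0) (le_trans (ltW tt)).
    have cD (ph : R -> R -> R) : C1_2 ph -> continuous (fun x => - ft ph t x + fx ph t x).
      move=> pC; have H1 := continuous_line (continuous_ft pC) (@continuous_cstR R t) (@continuous_idR R).
      have H2 := continuous_line (continuous_fx pC) (@continuous_cstR R t) (@continuous_idR R).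
      by move=> x; exact: (cvgD (cvgN (H1 x)) (H2 x)).
    rewrite (adjointE L0 gN (uL _ (inT _ tT)) (a := fun x => - dt phi t x + dx phi t x) (cD _ phC) (cD _ phD) (cx _ t phC) (cx _ t phD)).
    have [m1 m2] := erm t tT; have uae := um t tT.
    have E (q p : R -> R) (f : R -> R -> R) (dd : R -> R) : mf (fun x => ind 0 L x * q x) -> mf (wave f dd t) -> continuous p ->
        {ae mu, forall x, 0 < x < L -> q x = wave f dd t (x + t)} ->
        RI (fun x => ind 0 L x * (q x * p x)) = RI (fun x => ind 0 L x * (wave f dd t (x + t) * p x)).
      move=> qm wm pc qw; have pm := continuous_mf pc; apply: RI_ae.
      - apply: (eq_mf (f := fun x => (ind 0 L x * q x) * p x)); first by move=> x; ring.
        exact: mfM.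
      - by apply: mfM; [exact: measurable_ind|apply: mfM => //; exact: (mf_shift t wm)].
      - by apply: aeS qw => x H; rewrite ind_ifE; case: ifPn => [/H ->//|_]; rewrite !mul0r.
    have ur : {ae mu, forall x, 0 < x < L -> Re (u t x) = wave (fR T u) dr t (x + t)}.
      by apply: aeS uae => x H xI; rewrite H//= in_itv.
    have ui : {ae mu, forall x, 0 < x < L -> Im (u t x) = wave (fI T u) di t (x + t)}.
      by apply: aeS uae => x H xI; rewrite H//= in_itv.
    have fRE y : GR L g (u t) y = fR T u t y by rewrite /fR tT mul1r.
    have fIE y : GI L g (u t) y = fI T u t y by rewrite /fI tT mul1r.
    have wmr := (wave_L2r wgt sR t dR).1; have wmi := (wave_L2r wgt sI t dI).1.
    rewrite (E _ _ _ _ m1 wmr (cD _ phC) ur) (E _ _ _ _ m2 wmi (cD _ phD) ui).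
    rewrite (E _ _ _ _ m2 wmi (cD _ phC) ui) (E _ _ _ _ m1 wmr (cD _ phD) ur).
    by congr (Complex (_ - _ + (_ - _)) (_ - _ - (_ - _))); apply: eq_RI => y; rewrite ?fRE ?fIE.
  apply: cplx_eq; rewrite ?cintRe ?cintIm.
    apply: (etrans _ (RID i1 i2)); apply: eq_RI => t; rewrite !ind_ifE.
    by case: ifPn => [/inner ->|_]; rewrite ?mul1r// !mul0r addr0.
  apply: (etrans _ (RIB i3 i4)); apply: eq_RI => t; rewrite !ind_ifE.
  by case: ifPn => [/inner ->|_]; rewrite ?mul1r// !mul0r subrr.
have tauI : 0 <= tau <= T by rewrite tau0.
have [m1 m2] := erm tau tauI.
rewrite (cint_conj m1 m2 (a := fun x => wave (fR T u) dr tau (x + tau)) (b := fun x => wave (fI T u) di tau (x + tau))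
   _ (wr tau) (wi tau) (cx _ tau phC) (cx _ tau phD)); last first.
  by apply: aeS (um tau tauI) => x H xI; rewrite H//= in_itv.
have /cL2P[[n1 _] [n2 _]] := u0L.
rewrite (cint_conj n1 n2 (a := dr) (b := di) _ dR dI (cx _ 0 phC) (cx _ 0 phD)); last first.
  by apply: aeS du0 => x H xI; rewrite /dr /di H//= in_itv.
have k1 : mf (fun t => ind 0 tau t * Re (U t)).
  apply: (eq_mf (f := fun t => ind 0 tau t * (ind 0 T t * Re (U t)))); last by apply: mfM => //; exact: measurable_ind.
  move=> t; rewrite (ind_ifE 0 tau); case: ifPn => [/andP[h1 h2]|_]; last by rewrite !mul0r.
  by rewrite !mul1r indE ?mul1r// h1 (lt_le_trans h2).
have k2 : mf (fun t => ind 0 tau t * Im (U t)).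
  apply: (eq_mf (f := fun t => ind 0 tau t * (ind 0 T t * Im (U t)))); last by apply: mfM => //; exact: measurable_ind.
  move=> t; rewrite (ind_ifE 0 tau); case: ifPn => [/andP[h1 h2]|_]; last by rewrite !mul0r.
  by rewrite !mul1r indE ?mul1r// h1 (lt_le_trans h2).
rewrite (cint_conj k1 k2 (a := fun t => dr (t + L)) (b := fun t => di (t + L)) _ (L2r_shift L dR) (L2r_shift L dI)
  (p := fun t => phi t L) (continuous_f1 phC (x := L)) (continuous_f1 phD (x := L))); last first.
  by apply: aeS dU => t H /andP[h1 h2]; rewrite /dr /di H// h1 (lt_le_trans h2).
apply: cplx_eq; first exact: (add_balance W1 W2).
exact: (sub_balance W3 W4).
Qed.

Definition dat (T : R) (u0 U : R -> R[i]) (c : R) : R[i] :=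
  Complex (ind 0 L c * Re (u0 c) + ind L (L + T) c * Re (U (c - L)))
          (ind 0 L c * Im (u0 c) + ind L (L + T) c * Im (U (c - L))).

Lemma dat_L2r (T : R) (u0 U : R -> R) : L2r (fun x => ind 0 L x * u0 x) -> L2r (fun t => ind 0 T t * U t) ->
  L2r (fun c => ind 0 L c * u0 c + ind L (L + T) c * U (c - L)).
Proof.
move=> a b; apply: L2rD => //; apply: eq_L2r (L2r_shift (- L) b) => c /=.
by congr (_ * _); rewrite !ind_ifE subr_gt0 ltrBlDl.
Qed.

(** Against real test functions of [x + t] the weak identity decouples into the two real identities
    that [weak_mild] asks for. *)
Lemma weak_to_mild (T : R) u0 U u : 0 <= T -> weak_sol L g T u0 U u -> cL2 I u0 ->
  cL2 `]0, T[%classic U -> mild T (dat T u0 U) u.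
Proof.
move=> T0 [uC W] /cL2P[r0 i0] /cL2P[rU iU].
have [M [sR sI]] := src_C0L2 T0 uC; have [uL _] := uC.
have inT t : 0 <= t <= T -> `[0, T]%classic t by rewrite /= in_itv.
split => //; [exact: dat_L2r r0 rU|exact: dat_L2r i0 iU|] => tau tauI.
have /andP[tau0 tauT] := tauI.
have /cL2P[rt it] := uL _ (inT _ tauI).
have cut (V : R -> R) : L2r (fun t => ind 0 T t * V t) -> L2r (fun t => ind 0 tau t * V t).
  move=> VL; apply: eq_L2r (L2r_indM 0 tau VL) => t.
  rewrite (ind_ifE 0 tau); case: ifPn => [/andP[h1 h2]|_]; last by rewrite !mul0r.
  by rewrite !mul1r indE ?mul1r// h1 (lt_le_trans h2).
have key (psi psi' : R -> R) : continuous psi' -> (forall c : R, is_derive c (1 : R) psi (psi' c)) ->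
    (forall c, c <= tau -> psi c = 0) ->
    RI (fun t => ind 0 tau t * RI (fun x => fR T u t x * psi (x + t))) =
      RI (fun x => ind 0 L x * (Re (u tau x) * psi (x + tau))) - RI (fun x => ind 0 L x * (Re (u0 x) * psi x))
      - RI (fun t => ind 0 tau t * (Re (U t) * psi (t + L))) /\
    RI (fun t => ind 0 tau t * RI (fun x => fI T u t x * psi (x + t))) =
      RI (fun x => ind 0 L x * (Im (u tau x) * psi (x + tau))) - RI (fun x => ind 0 L x * (Im (u0 x) * psi x))
      - RI (fun t => ind 0 tau t * (Im (U t) * psi (t + L))).
  move=> cp dp p0; have [pC e1 e2] := C1_travelling cp dp.
  have [zC z1 z2] := @C1_travelling R (fun=> 0) (fun=> 0) (@continuous_cstR R 0) (fun c => is_derive_cst _ _ _).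
  pose phi t x : R[i] := Complex (psi (x + t)) 0.
  have ph0 t : `[0, tau]%classic t -> phi t 0 = 0.
    by rewrite /= in_itv/= => /andP[_ tt]; rewrite /phi add0r p0.
  have E := W tau (inT _ tauI) phi (conj pC zC) ph0.
  have inner t : 0 < t < tau -> cint I (fun x => u t x * conjc (- dt phi t x + dx phi t x
      - cint I (fun y => conjc (g y x) * phi t y))) =
      Complex (- RI (fun x => fR T u t x * psi (x + t))) (- RI (fun x => fI T u t x * psi (x + t))).
    move=> /andP[t0 tt]; have tT : 0 <= t <= T by rewrite (ltW t0) (le_trans (ltW tt)).
    have aE (x : R) : - dt phi t x + dx phi t x = 0.
      apply: cplx_eq; rewrite ?ReD ?ImD ?ReN ?ImN.
        have -> : Re (dt phi t x) = psi' (x + t) by exact: (e1 t x).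
        have -> : Re (dx phi t x) = psi' (x + t) by exact: (e2 t x).
        by rewrite addNr.
      have -> : Im (dt phi t x) = 0 by exact: (z1 t x).
      have -> : Im (dx phi t x) = 0 by exact: (z2 t x).
      by rewrite oppr0 addr0.
    have -> : (fun x => u t x * conjc (- dt phi t x + dx phi t x - cint I (fun y => conjc (g y x) * phi t y))) =
        (fun x => u t x * conjc (0 - cint I (fun y => conjc (g y x) * phi t y))).
      by apply/funext => x; rewrite aE.
    rewrite (adjointE L0 gN (uL _ (inT _ tT)) (a := fun=> 0) (ph := phi t) (@continuous_cstR R 0) (@continuous_cstR R 0)
      (continuous_f2 pC (t := t)) (@continuous_cstR R 0)).
    have z (q h : R -> R) : RI (fun x => q x * (h x * 0)) = 0.
      by apply: (etrans _ (RI0 R)); apply: eq_RI => x; rewrite !mulr0.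
    have z' (q : R -> R) : RI (fun x => q x * 0) = 0.
      by apply: (etrans _ (RI0 R)); apply: eq_RI => x; rewrite mulr0.
    have o1 : RI (fun x => ind 0 L x * (Re (u t x) * Re (0 : R[i]))) = 0 by exact: z.
    have o2 : RI (fun x => ind 0 L x * (Im (u t x) * Im (0 : R[i]))) = 0 by exact: z.
    have o3 : RI (fun x => ind 0 L x * (Im (u t x) * Re (0 : R[i]))) = 0 by exact: z.
    have o4 : RI (fun x => ind 0 L x * (Re (u t x) * Im (0 : R[i]))) = 0 by exact: z.
    have o5 : RI (fun y => GI L g (u t) y * Im (phi t y)) = 0 by exact: z'.
    have o6 : RI (fun y => GR L g (u t) y * Im (phi t y)) = 0 by exact: z'.
    have nf (p q r s a b c d : R) : p = 0 -> q = 0 -> r = 0 -> s = 0 -> b = 0 -> d = 0 ->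
        Complex (p - a + (q - b)) (r - c - (s - d)) = Complex (- a) (- c).
      by move=> -> -> -> -> -> ->; rewrite !subr0 !sub0r addr0.
    apply: (etrans (nf _ _ _ _ _ _ _ _ o1 o2 o3 o4 o5 o6)).
    congr (Complex (- _) (- _)); apply: eq_RI => x.
      by rewrite /fR tT mul1r.
    by rewrite /fI tT mul1r.
  have AE : cint `]0, tau[%classic (fun t => cint I (fun x => u t x * conjc (- dt phi t x + dx phi t x
      - cint I (fun y => conjc (g y x) * phi t y)))) =
    Complex (- RI (fun t => ind 0 tau t * RI (fun x => fR T u t x * psi (x + t))))
      (- RI (fun t => ind 0 tau t * RI (fun x => fI T u t x * psi (x + t)))).
    apply: cplx_eq; rewrite ?cintRe ?cintIm.
      apply: (etrans _ (RI_oppr _)); apply: eq_RI => t; rewrite !ind_ifE.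
      by case: ifPn => [/inner ->|_]; rewrite ?mul1r// !mul0r oppr0.
    apply: (etrans _ (RI_oppr _)); apply: eq_RI => t; rewrite !ind_ifE.
    by case: ifPn => [/inner ->|_]; rewrite ?mul1r// !mul0r oppr0.
  have BE (al be : R) (w : R -> R[i]) (p : R -> R) : cint `]al, be[%classic (fun x => w x * conjc (Complex (p x) 0)) =
      Complex (RI (fun x => ind al be x * (Re (w x) * p x))) (RI (fun x => ind al be x * (Im (w x) * p x))).
    apply: cplx_eq; rewrite ?cintRe ?cintIm; apply: eq_RI => x.
      by rewrite ReM ReJ ImJ /= oppr0 mulr0 subr0.
    by rewrite ImM ReJ ImJ /= oppr0 mulr0 add0r.
  move: E; rewrite AE !BE => E.
  have e3 : (fun x => ind 0 L x * (Re (u0 x) * psi (x + 0))) = (fun x => ind 0 L x * (Re (u0 x) * psi x)).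
    by apply/funext => x; rewrite addr0.
  have e4 : (fun x => ind 0 L x * (Im (u0 x) * psi (x + 0))) = (fun x => ind 0 L x * (Im (u0 x) * psi x)).
    by apply/funext => x; rewrite addr0.
  have e5 : (fun t => ind 0 tau t * (Re (U t) * psi (L + t))) = (fun t => ind 0 tau t * (Re (U t) * psi (t + L))).
    by apply/funext => x; rewrite addrC.
  have e6 : (fun t => ind 0 tau t * (Im (U t) * psi (L + t))) = (fun t => ind 0 tau t * (Im (U t) * psi (t + L))).
    by apply/funext => x; rewrite addrC.
  rewrite e3 e4 e5 e6 in E; exact: (balance_components E).
have wR := weak_mild wgt sR tau0 rt r0 (cut _ rU) (fun psi psi' a b c => (key psi psi' a b c).1).
have wI := weak_mild wgt sI tau0 it i0 (cut _ iU) (fun psi psi' a b c => (key psi psi' a b c).2).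
apply: aeS (aeI wR wI) => x [hR hI] /=; rewrite in_itv/= => xI.
(* A characteristic inside the strip at time [tau] carries only controls applied before [tau]. *)
have iE : ind L (L + T) (x + tau) = ind L (L + tau) (x + tau).
  move: xI => /andP[x0 xL]; rewrite !ind_ifE.
  have -> : x + tau < L + T by lra.
  by have -> : x + tau < L + tau by lra.
apply: cplx_eq; first by rewrite (hR xI) /cwave /= /wave iE.
by rewrite (hI xI) /cwave /= /wave iE.
Qed.

End weak_and_mild.

(** * An iterative substitute for Gronwall's lemma, and uniform limits *)

Lemma bootstrap_le (R : realType) (T A M0 : R) (y e : R -> R) : 0 <= T -> 0 <= A ->
  (forall t : R, 0 <= t <= T -> 1 <= e t) -> (forall t : R, 0 <= t <= T -> y t <= M0) ->
  (forall M : R, 0 <= M -> (forall t : R, 0 <= t <= T -> y t <= M * e t) ->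
    forall t : R, 0 <= t <= T -> y t <= (A + M / 2) * e t) ->
  forall t : R, 0 <= t <= T -> y t <= 2 * A * e t.
Proof.
move=> T0 A0 e1 yM step.
(* The map sending [M] to [A + M / 2] has the fixed point [2 * A], and the excess over it halves at
   each step. *)
have H n : forall t : R, 0 <= t <= T -> y t <= (2 * A + `|M0| / 2 ^+ n) * e t.
  elim: n => [t tT|n IH t tT].
    have m0 := normr_ge0 M0; have mm := ler_norm M0; have := e1 t tT; have := yM t tT.
    rewrite expr0 divr1; nra.
  have m0 : 0 <= `|M0| / 2 ^+ n by rewrite divr_ge0// exprn_ge0.
  apply: le_trans (step _ _ IH t tT) _; first by rewrite addr_ge0// mulr_ge0.
  rewrite exprS invfM (_ : `|M0| * (2^-1 * (2 ^+ n)^-1) = `|M0| / 2 ^+ n / 2); last by ring.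
  by move: (`|M0| / 2 ^+ n) => m; rewrite le_eqVlt; apply/orP; left; apply/eqP; field.
move=> t tT; have et := e1 t tT; apply/ler_addgt0Pr => eps eps0.
have [N HN] := archi_gt (`|M0| * e t / eps).
apply: le_trans (H N t tT) _; rewrite mulrDl lerD2l.
have p0 : 0 < 2 ^+ N :> R by rewrite exprn_gt0.
rewrite mulrAC ler_pdivrMr//; move: HN; rewrite ltr_pdivrMr// => /ltW/le_trans; apply.
rewrite mulrC ler_wpM2l ?(ltW eps0)//.
have -> : 2 ^+ N = (2 ^ N)%:R :> R by rewrite natrX.
by rewrite ler_nat ltnW// ltn_expl.
Qed.

(** The limit is taken as the lower limit, the supremum of eventual lower bounds. [X] is arbitrary,
    to cover functions of one and of two variables. *)
Lemma uniform_limit (R : realType) (X : Type) (w : nat -> X -> R) :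
  (forall eps : R, 0 < eps -> exists N, forall m n p, (N <= m)%N -> (N <= n)%N -> `|w m p - w n p| <= eps) ->
  exists l : X -> R, forall eps : R, 0 < eps -> exists N, forall n p, (N <= n)%N -> `|w n p - l p| <= eps.
Proof.
move=> C; pose A p := [set r | exists N, forall n, (N <= n)%N -> r <= w n p].
exists (fun p => sup (A p)) => eps eps0; have [N HN] := C _ eps0; exists N => n p Nn.
have An : A p (w n p - eps).
  exists N => m Nm; have := HN n m p Nn Nm; rewrite ler_norml => /andP[_]; lra.
have ubA : ubound (A p) (w n p + eps).
  move=> r [K HK]; apply: (le_trans (HK _ (leq_maxr N K))).
  have := HN (maxn N K) n p (leq_maxl _ _) Nn; rewrite ler_norml => /andP[_]; lra.
have h1 : w n p - eps <= sup (A p) by apply: ub_le_sup => //; exists (w n p + eps).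
have h2 : sup (A p) <= w n p + eps by apply: ge_sup => //; exists (w n p - eps).
by rewrite ler_norml; apply/andP; split; lra.
Qed.

Lemma mf_uniform_limit (R : realType) (w : nat -> R -> R) (l : R -> R) : (forall n, mf (w n)) ->
  (forall eps : R, 0 < eps -> exists N, forall n p, (N <= n)%N -> `|w n p - l p| <= eps) -> mf l.
Proof.
move=> wm wl; apply: (measurable_fun_cvg (h := w)) => // x _.
apply/cvgrPdist_le => eps eps0; have [N HN] := wl _ eps0.
by exists N => // n /= Nn; rewrite distrC; exact: HN.
Qed.

(** * Algebra of integrals along characteristics *)

Section source_integral.
Variable R : realType.
Implicit Types (f : R -> R -> R) (a b c : R).

Lemma eq_E f h a b c : (forall s : R, a < s < b -> f s (c - s) = h s (c - s)) -> E f a b c = E h a b c.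
Proof.
move=> H; rewrite /E; apply: eq_RI => s; rewrite ind_ifE; case: ifPn => [/H ->|_] //.
by rewrite !mul0r.
Qed.

Lemma E_shift f (t a b c : R) : mf (fun s => ind (a + t) (b + t) s * f s (c + t - s)) ->
  E f (a + t) (b + t) (c + t) = E (fun s => f (s + t)) a b c.
Proof.
move=> m; rewrite /E -(RI_shift t m); apply: eq_RI => s.
by rewrite !ind_ifE !ltrD2r; congr (_ * f _ _); ring.
Qed.

Lemma E_lin f1 f2 f3 f4 (c1 c2 c3 c4 a b c : R) :
  Li (fun s => ind a b s * f1 s (c - s)) -> Li (fun s => ind a b s * f2 s (c - s)) ->
  Li (fun s => ind a b s * f3 s (c - s)) -> Li (fun s => ind a b s * f4 s (c - s)) ->
  E (fun s x => (c1 * f1 s x + c2 * f2 s x) + (c3 * f3 s x + c4 * f4 s x)) a b c =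
  (c1 * E f1 a b c + c2 * E f2 a b c) + (c3 * E f3 a b c + c4 * E f4 a b c).
Proof.
move=> pL qL rL sL.
transitivity (RI (fun s => (c1 * (ind a b s * f1 s (c - s)) + c2 * (ind a b s * f2 s (c - s))) +
   (c3 * (ind a b s * f3 s (c - s)) + c4 * (ind a b s * f4 s (c - s))))).
  by rewrite /E; apply: eq_RI => s; ring.
rewrite (RID (LiD (LiZ c1 pL) (LiZ c2 qL)) (LiD (LiZ c3 rL) (LiZ c4 sL))).
rewrite (RID (LiZ c1 pL) (LiZ c2 qL)) (RID (LiZ c3 rL) (LiZ c4 sL)).
by rewrite (RIZ c1 pL) (RIZ c2 qL) (RIZ c3 rL) (RIZ c4 sL).
Qed.

End source_integral.

Opaque RI E GR GI.

(** * The backward Cauchy problem *)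

Section evolution.
Variable R : realType.
Local Notation Re := complex.Re.
Local Notation Im := complex.Im.
Local Notation aeq := (@Defs.ae_eq R).
Variables (L : R) (g : R -> R -> R[i]).
Local Notation I := `]0, L[%classic.
Hypothesis L0 : 0 < L.
Hypothesis gN : nice_kernel L g.
Local Notation gam := (gam g).
Local Notation mild := (mild L g).
Local Notation cwave := (cwave L g).
Let wgt : weight L gam. Proof. exact: gam_weight. Qed.

Lemma C0L2_cL2 (T : R) u (t : R) : C0L2 L T u -> 0 <= t <= T -> cL2 I (u t).
Proof. by move=> [uL _] tT; apply: uL; rewrite /= in_itv. Qed.

Lemma C0L2P (T : R) u : (forall t : R, 0 <= t <= T -> cL2 I (u t)) ->
  (forall t0 : R, 0 <= t0 <= T -> forall e : R, 0 < e -> exists2 d : R, 0 < d &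
    forall t : R, 0 <= t <= T -> `|t - t0| < d -> l2n L (fun x => u t x - u t0 x) < e) -> C0L2 L T u.
Proof.
move=> uL uc; split=> t; rewrite /= in_itv/= => tT; first exact: uL.
move=> e e0; have [d d0 H] := uc t tT e e0; exists d => // s; rewrite in_itv/= => sT; exact: H.
Qed.

Lemma C0L2_continuous (T : R) u (t0 e : R) : C0L2 L T u -> 0 <= t0 <= T -> 0 < e ->
  exists2 d : R, 0 < d &
    forall t : R, 0 <= t <= T -> `|t - t0| < d -> l2n L (fun x => u t x - u t0 x) < e.
Proof.
move=> [_ uc] tT e0; have [|d d0 H] := uc t0 _ e e0; first by rewrite /= in_itv.
by exists d => // t tT'; apply: H; rewrite /= in_itv.
Qed.

Lemma C0L2_ae (T : R) u v : C0L2 L T u -> (forall t : R, 0 <= t <= T -> cL2 I (v t) /\ aeq L (u t) (v t)) ->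
  C0L2 L T v.
Proof.
move=> uC uv; apply: C0L2P => [t /uv[]//|t0 t0T e e0].
have [d d0 H] := C0L2_continuous uC t0T e0; exists d => // t tT td.
have [v1 a1] := uv t tT; have [v2 a2] := uv t0 t0T.
have [u1 u2] := (C0L2_cL2 uC tT, C0L2_cL2 uC t0T).
rewrite -(l2n_ae (cL2B u1 u2) (cL2B v1 v2)); first exact: H.
by apply: aeS (aeI a1 a2) => x [b1 b2] xI; rewrite b1// b2.
Qed.

Lemma C0L2_lin (T : R) (al be : R[i]) u v : C0L2 L T u -> C0L2 L T v ->
  C0L2 L T (fun t x => al * u t x + be * v t x).
Proof.
move=> uC vC; apply: C0L2P => [t tT|t0 t0T e e0].
  by apply: cL2D; apply: cL2M; exact: C0L2_cL2 tT.
pose k := cnorm2 al + cnorm2 be + 1.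
have [a0 b0] := (cnorm2_ge0 al, cnorm2_ge0 be).
have k0 : 0 < k by rewrite /k; lra.
have e'0 : 0 < e / (4 * k) by rewrite divr_gt0// mulr_gt0.
have [d1 d10 H1] := C0L2_continuous uC t0T e'0; have [d2 d20 H2] := C0L2_continuous vC t0T e'0.
exists (Num.min d1 d2); first by rewrite lt_min d10.
move=> t tT; rewrite lt_min => /andP[t1 t2].
have [u1 u2] := (C0L2_cL2 uC tT, C0L2_cL2 uC t0T).
have [v1 v2] := (C0L2_cL2 vC tT, C0L2_cL2 vC t0T).
have := l2nD (cL2M al (cL2B u1 u2)) (cL2M be (cL2B v1 v2)).
rewrite !l2nM; [|exact: cL2B|exact: cL2B].
rewrite (_ : (fun x => al * (u t x - u t0 x) + be * (v t x - v t0 x)) =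
   (fun x => al * u t x + be * v t x - (al * u t0 x + be * v t0 x))); last by apply/funext => x; ring.
move=> /le_lt_trans; apply.
have := H1 t tT t1; have := H2 t tT t2; have := l2n_ge0 L (fun x => u t x - u t0 x).
have := l2n_ge0 L (fun x => v t x - v t0 x).
move: (l2n L _) (l2n L _) => q p q0 p0; rewrite !ltr_pdivlMr ?mulr_gt0//.
by rewrite /k; nra.
Qed.

Definition cE (T : R) (u : R -> R -> R[i]) (a b c : R) : R[i] :=
  Complex (E (fR L g T u) a b c) (E (fI L g T u) a b c).

Lemma Re_cE (T : R) u (a b c : R) : Re (cE T u a b c) = E (fR L g T u) a b c.
Proof. by []. Qed.

Lemma Im_cE (T : R) u (a b c : R) : Im (cE T u a b c) = E (fI L g T u) a b c.
Proof. by []. Qed.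

Opaque cE.

Lemma cwaveE (T : R) d u (t c : R) : cwave T d u t c = d c + cE T u 0 t c.
Proof. by apply: cplx_eq; rewrite ?ReD ?ImD ?Re_cE ?Im_cE. Qed.

(** A factor 2 comes from [GR_le] and [GI_le], another from adding the two components. *)
Definition C0 : R := 4 * RI (fun x => gam x ^+ 2).

Lemma C0_ge0 : 0 <= C0.
Proof. by rewrite mulr_ge0//; apply: RI_ge0 => x; exact: sqr_ge0. Qed.

(** The quantitative smoothing estimate: norms of the states bound the integral at each label [c].
    The profile [e] is left free, for exponential weights or a constant. *)
Lemma cE_le (T : R) u (a b c : R) (e : R -> R) (M : R) : 0 <= T -> C0L2 L T u -> 0 <= a -> b <= T ->
  continuous e -> (forall s, 0 <= e s) -> 0 <= M ->
  (forall s : R, a < s < b -> l2n L (u s) <= M * e s) ->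
  cnorm2 (cE T u a b c) <= C0 * (M * RI (fun s => ind a b s * e s)).
Proof.
move=> T0 uC a0 bT ce e0 M0 H; have [N [sR sI]] := src_C0L2 L0 gN T0 uC.
have [_ gam0 _ _] := wgt.
pose rho (s : R) := Num.sqrt (2 * M * e s).
have rho0 s : 0 <= rho s by exact: sqrtr_ge0.
have rho2 s : rho s ^+ 2 = 2 * M * e s by rewrite sqr_sqrtr// mulr_ge0// mulr_ge0.
have cr : continuous rho.
  move=> s; apply: (@continuous_comp _ _ _ (fun s => 2 * M * e s) Num.sqrt); last exact: sqrt_continuous.
  by apply: cvgM; [exact: cvg_cst|exact: ce].
have rL := L2r_ind_continuous a b cr.
have fb (s x : R) : a < s < b -> [/\ (0 <= s <= T) = true, cL2 I (u s) & gam x * Num.sqrt (2 * l2n L (u s)) <= gam x * rho s].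
  move=> sab; have /andP[h1 h2] := sab.
  have sT : 0 <= s <= T by rewrite (le_trans a0 (ltW h1)) (le_trans (ltW h2) bT).
  split=> //; first exact: C0L2_cL2 sT.
  by apply: ler_wpM2l => //; apply: ler_wsqrtr; rewrite -mulrA ler_wpM2l// H.
have h1 : E (fR L g T u) a b c ^+ 2 <= RI (fun x => gam x ^+ 2) * RI (fun s => ind a b s * rho s ^+ 2).
  apply: (E_cauchy wgt sR) => // s x /(fb s x)[sT us le]; rewrite /fR sT mul1r.
  exact: le_trans (GR_le gN x us) le.
have h2 : E (fI L g T u) a b c ^+ 2 <= RI (fun x => gam x ^+ 2) * RI (fun s => ind a b s * rho s ^+ 2).
  apply: (E_cauchy wgt sI) => // s x /(fb s x)[sT us le]; rewrite /fI sT mul1r.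
  exact: le_trans (GI_le gN x us) le.
have E2 : RI (fun s => ind a b s * rho s ^+ 2) = 2 * (M * RI (fun s => ind a b s * e s)).
  rewrite mulrA -(RIZ (2 * M) (Li_ind_continuous a b ce)); apply: eq_RI => s.
  by rewrite rho2; ring.
rewrite E2 in h1 h2; rewrite /cnorm2 /C0 Re_cE Im_cE; lra.
Qed.

(** It also changes the horizon, which enters only through the time window. *)
Lemma cE_congr (T T' : R) u v (a b c : R) :
  (forall s : R, a < s < b -> [/\ 0 <= s <= T, 0 <= s <= T', cL2 I (u s), cL2 I (v s) & aeq L (u s) (v s)]) ->
  cE T u a b c = cE T' v a b c.
Proof.
move=> H; apply: cplx_eq; [apply: (etrans (Re_cE _ _ _ _ _)); apply: (etrans _ (esym (Re_cE _ _ _ _ _)))|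
  apply: (etrans (Im_cE _ _ _ _ _)); apply: (etrans _ (esym (Im_cE _ _ _ _ _)))]; apply: eq_E => s /H[sT sT' us vs uv].
  by rewrite /fR sT sT' !mul1r (G_ae gN (c - s) us vs uv).1.
by rewrite /fI sT sT' !mul1r (G_ae gN (c - s) us vs uv).2.
Qed.

(** The equation is autonomous: a translation in time is a translation of the labels. *)
Lemma cE_shift (T T' : R) u (t a b c : R) : C0L2 L T' u -> 0 <= T' -> 0 <= a -> b <= T -> 0 <= a + t -> b + t <= T' ->
  cE T (fun s => u (s + t)) a b c = cE T' u (a + t) (b + t) (c + t).
Proof.
move=> uC T0 a0 bT at0 btT; have [N [sR sI]] := src_C0L2 L0 gN T0 uC.
have ab (s : R) : a < s < b -> (0 <= s <= T) = true /\ (0 <= s + t <= T') = true.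
  by move=> /andP[h1 h2]; split; apply/andP; split; lra.
apply: cplx_eq; [apply: (etrans (Re_cE _ _ _ _ _)); apply: (etrans _ (esym (Re_cE _ _ _ _ _)))|
  apply: (etrans (Im_cE _ _ _ _ _)); apply: (etrans _ (esym (Im_cE _ _ _ _ _)))].
  apply: (etrans _ (esym (E_shift (Li_meas (E_Li wgt sR _ _ _))))).
  by apply: eq_E => s /ab[e1 e2]; rewrite /fR e1 e2.
apply: (etrans _ (esym (E_shift (Li_meas (E_Li wgt sI _ _ _))))).
by apply: eq_E => s /ab[e1 e2]; rewrite /fI e1 e2.
Qed.

Lemma cE_split (T : R) u (a b c x : R) : 0 <= T -> C0L2 L T u -> a <= b -> b <= c ->
  cE T u a b x + cE T u b c x = cE T u a c x.
Proof.
move=> T0 uC ab bc; have [N [sR sI]] := src_C0L2 L0 gN T0 uC.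
by apply: cplx_eq; rewrite ?ReD ?ImD ?Re_cE ?Im_cE; [exact: (E_split wgt sR)|exact: (E_split wgt sI)].
Qed.

Lemma cE_supp (T : R) u (a b c : R) : 0 <= T -> C0L2 L T u -> ~~ (a < c < b + L) -> cE T u a b c = 0.
Proof.
move=> T0 uC ab; have [N [sR sI]] := src_C0L2 L0 gN T0 uC.
by apply: cplx_eq; rewrite ?Re_cE ?Im_cE ?(E_supp wgt sR ab) ?(E_supp wgt sI ab).
Qed.

Lemma cE_L2r (T : R) u (a b : R) : 0 <= T -> C0L2 L T u ->
  L2r (fun c => Re (cE T u a b c)) /\ L2r (fun c => Im (cE T u a b c)).
Proof.
move=> T0 uC; have [N [sR sI]] := src_C0L2 L0 gN T0 uC.
split; [apply: eq_L2r (E_L2r wgt sR a b) => c|apply: eq_L2r (E_L2r wgt sI a b) => c].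
  by rewrite Re_cE.
by rewrite Im_cE.
Qed.

Lemma cE_null (T : R) u (a b c : R) : 0 <= T -> C0L2 L T u -> 0 <= a -> b <= T ->
  (forall s : R, a < s < b -> aeq L (u s) (fun=> 0)) -> cE T u a b c = 0.
Proof.
move=> T0 uC a0 bT H; apply: cnorm2_eq0; apply/le_anti; rewrite cnorm2_ge0 andbT.
rewrite -(mulr0 C0) -[X in _ <= _ * X](mul0r (RI (fun s => ind a b s * 1))).
apply: cE_le => //; first exact: continuous_cstR.
move=> s sab; rewrite mul0r; have /andP[h1 h2] := sab.
have sT : 0 <= s <= T by apply/andP; split; lra.
rewrite (l2n_ae (C0L2_cL2 uC sT) (cL20 L) (H s sab)) /l2n Rintegral_ind.
rewrite (_ : RI _ = 0)//; apply: (etrans _ (RI0 R)); apply: eq_RI => x.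
by rewrite /cnorm2 Re0 Im0 expr0n/= addr0 mulr0.
Qed.

Lemma cE_lin (T : R) (al be : R[i]) u v (a b c : R) : 0 <= T -> C0L2 L T u -> C0L2 L T v ->
  cE T (fun t x => al * u t x + be * v t x) a b c = al * cE T u a b c + be * cE T v a b c.
Proof.
move=> T0 uC vC; have [M [ur ui]] := src_C0L2 L0 gN T0 uC; have [N [vr vi]] := src_C0L2 L0 gN T0 vC.
have [e1 e2] := (E_Li wgt ur a b c, E_Li wgt ui a b c).
have [e3 e4] := (E_Li wgt vr a b c, E_Li wgt vi a b c).
have RE (p q : R[i]) : Re (al * p + be * q) = (Re al * Re p + - Im al * Im p) + (Re be * Re q + - Im be * Im q).
  by rewrite ReD !ReM !mulNr.
have IE (p q : R[i]) : Im (al * p + be * q) = (Re al * Im p + Im al * Re p) + (Re be * Im q + Im be * Re q).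
  by rewrite ImD !ImM.
apply: cplx_eq.
- apply: (etrans (Re_cE _ _ _ _ _)); apply: (etrans _ (esym (RE _ _))); apply: (etrans _ (E_lin _ _ _ _ e1 e2 e3 e4)); apply: eq_E => s _.
  rewrite /fR /fI; case: (boolP (0 <= s <= T)) => sT; last by rewrite !mul0r !mulr0 !addr0.
  by rewrite (G_lin gN al be (c - s) (C0L2_cL2 uC sT) (C0L2_cL2 vC sT)).1; ring.
- apply: (etrans (Im_cE _ _ _ _ _)); apply: (etrans _ (esym (IE _ _))); apply: (etrans _ (E_lin _ _ _ _ e2 e1 e4 e3)); apply: eq_E => s _.
  rewrite /fR /fI; case: (boolP (0 <= s <= T)) => sT; last by rewrite !mul0r !mulr0 !addr0.
  by rewrite (G_lin gN al be (c - s) (C0L2_cL2 uC sT) (C0L2_cL2 vC sT)).2; ring.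
Qed.

Definition cL2r (d : R -> R[i]) := L2r (fun c => Re (d c)) /\ L2r (fun c => Im (d c)).

Lemma cL2r_lin (al be : R[i]) d1 d2 : cL2r d1 -> cL2r d2 -> cL2r (fun c => al * d1 c + be * d2 c).
Proof.
move=> [r1 i1] [r2 i2]; split.
  apply: eq_L2r (L2rD (L2rB (L2rZ (Re al) r1) (L2rZ (Im al) i1)) (L2rB (L2rZ (Re be) r2) (L2rZ (Im be) i2))) => c.
  by rewrite ReD (ReM al) (ReM be).
apply: eq_L2r (L2rD (L2rD (L2rZ (Re al) i1) (L2rZ (Im al) r1)) (L2rD (L2rZ (Re be) i2) (L2rZ (Im be) r2))) => c.
by rewrite ImD (ImM al) (ImM be).
Qed.

Lemma cL2r_shift (t : R) d : cL2r d -> cL2r (fun c => d (c + t)).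
Proof. by move=> [r i]; split; [exact: L2r_shift r|exact: L2r_shift i]. Qed.

Lemma cL2r_cL2 (T : R) d : cL2r d -> cL2 `]0, T[%classic d.
Proof. by move=> [r i]; apply/cL2P; split; exact: L2r_indM. Qed.

Lemma mild_lin (T : R) (al be : R[i]) d1 d2 u v : 0 <= T -> mild T d1 u -> mild T d2 v ->
  mild T (fun c => al * d1 c + be * d2 c) (fun t x => al * u t x + be * v t x).
Proof.
move=> T0 [uC r1 i1 um] [vC r2 i2 vm].
have [dr di] := @cL2r_lin al be d1 d2 (conj r1 i1) (conj r2 i2).
split; [exact: C0L2_lin|exact: dr|exact: di|].
move=> t tT; apply: aeS (aeI (um t tT) (vm t tT)) => x [h1 h2] xI.
rewrite (h1 xI) (h2 xI) !cwaveE (cE_lin _ _ _ _ _ T0 uC vC).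
by move: (cE _ _ _ _ _) (cE _ _ _ _ _) => p q; ring.
Qed.

Lemma wave_C0L2 (T : R) d u : 0 <= T -> C0L2 L T u -> cL2r d ->
  C0L2 L T (fun t x => d (x + t) + cE T u 0 t (x + t)).
Proof.
move=> T0 uC dL; have [dr di] := dL; have [N [sR sI]] := src_C0L2 L0 gN T0 uC.
have wL (t : R) : 0 <= t <= T -> cL2 I (fun x => d (x + t) + cE T u 0 t (x + t)).
  move=> tT; apply: cL2D; apply: cL2r_cL2; first exact: cL2r_shift.
  by apply: (@cL2r_shift t (fun c => cE T u 0 t c)); exact: cE_L2r.
apply: C0L2P => // t0 t0T e e0; have e20 : 0 < e / 2 by rewrite divr_gt0.
have [d1 d10 H1] := wave_continuous wgt sR dr t0T e20; have [d2 d20 H2] := wave_continuous wgt sI di t0T e20.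
exists (Num.min d1 d2); first by rewrite lt_min d10.
move=> t tT; rewrite lt_min => /andP[t1 t2].
rewrite l2nE; last by apply: cL2B; exact: wL.
rewrite (_ : RI _ = RI (fun x : R => ind 0 L x * (wave (fR L g T u) (fun c => Re (d c)) t (x + t) - wave (fR L g T u) (fun c => Re (d c)) t0 (x + t0)) ^+ 2)); last first.
  apply: eq_RI => x; rewrite /er exprMn ind_sqr; congr (_ * _ ^+ 2).
  by apply: (etrans (ReB _ _)); congr (_ - _); apply: (etrans (ReD _ _)); congr (_ + _); exact: Re_cE.
rewrite [X in _ + X < _](_ : RI _ = RI (fun x : R => ind 0 L x * (wave (fI L g T u) (fun c => Im (d c)) t (x + t) - wave (fI L g T u) (fun c => Im (d c)) t0 (x + t0)) ^+ 2)); last first.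
  apply: eq_RI => x; rewrite /ei exprMn ind_sqr; congr (_ * _ ^+ 2).
  by apply: (etrans (ImB _ _)); congr (_ - _); apply: (etrans (ImD _ _)); congr (_ + _); exact: Im_cE.
by have := H1 t tT t1; have := H2 t tT t2; move: (RI _) (RI _) => p q; lra.
Qed.

(** Formally [b c] is the last value taken on the characteristic [c]: the final state for labels in
    [(L, 2L)], the value at [x = 0] at time [c] for labels in [(0, L)]. *)
Definition back b u := C0L2 L L u /\
  forall t : R, 0 <= t <= L -> aeq L (u t) (fun x => b (x + t) - cE L u t L (x + t)).

Lemma back_mild b u : cL2r b -> back b u -> mild L (fun c => b c - cE L u 0 L c) u.
Proof.
move=> [br bi] [uC ub]; have [er ei] := cE_L2r 0 L (ltW L0) uC; split=> //.
- by apply: eq_L2r (L2rB br er) => c; rewrite ReB.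
- by apply: eq_L2r (L2rB bi ei) => c; rewrite ImB.
move=> t tL; have /andP[t0 t1] := tL; apply: aeS (ub t tL) => x h xI; rewrite h// cwaveE.
by rewrite -(cE_split (x + t) (ltW L0) uC t0 t1); ring.
Qed.

Lemma back_lin (al be : R[i]) b1 b2 u v : back b1 u -> back b2 v ->
  back (fun c => al * b1 c + be * b2 c) (fun t x => al * u t x + be * v t x).
Proof.
move=> [uC ub] [vC vb]; split; first exact: C0L2_lin.
move=> t tL; apply: aeS (aeI (ub t tL) (vb t tL)) => x [h1 h2] xI.
rewrite (h1 xI) (h2 xI) (cE_lin _ _ _ _ _ (ltW L0) uC vC).
by move: (cE _ _ _ _ _) (cE _ _ _ _ _) => p q; ring.
Qed.

Definition nb (b : R -> R[i]) := RI (fun c => Re (b c) ^+ 2) + RI (fun c => Im (b c) ^+ 2).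

Lemma nb_ge0 b : 0 <= nb b.
Proof. by rewrite addr_ge0//; apply: RI_ge0 => x; exact: sqr_ge0. Qed.

Lemma l2n_shift_le b (t : R) : cL2r b -> l2n L (fun x => b (x + t)) <= nb b.
Proof.
move=> bL; have [r i] := cL2r_shift t bL; rewrite l2nE; last by apply: cL2r_cL2.
rewrite /nb -(RI_shift t (mf_sqr bL.1.1)) -(RI_shift t (mf_sqr bL.2.1)).
apply: lerD; apply: RI_le.
- exact: (L2r_indM 0 L r).2.
- exact: r.2.
- by move=> x; rewrite /er exprMn ind_sqr ler_piMl ?sqr_ge0// ind_le1.
- exact: (L2r_indM 0 L i).2.
- exact: i.2.
- by move=> x; rewrite /ei exprMn ind_sqr ler_piMl ?sqr_ge0// ind_le1.
Qed.

(* With this rate the integral term is a contraction for the norm weighted by [expR (kap * _)]. *)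
Definition kap : R := 8 * L * C0 + 1.

Lemma kap_gt0 : 0 < kap.
Proof. by have := mulr_ge0 (ltW L0) C0_ge0; rewrite /kap; lra. Qed.

Lemma continuous_expZ (k : R) : continuous (fun s : R => expR (k * s)).
Proof. by move=> x; apply: continuous_comp; [exact: mulrl_continuous|exact: continuous_expR]. Qed.

Lemma continuous_expB (k b : R) : continuous (fun s : R => expR (k * (b - s))).
Proof.
move=> x; apply: (@continuous_comp _ _ _ (fun s : R => b - s) (fun s => expR (k * s))); last exact: continuous_expZ.
by apply: cvgB; [exact: cvg_cst|exact: cvg_id].
Qed.

Let ew (t : R) := expR (kap * (L - t)).

(** The second inequality is the contraction, and amounts to [8 * L * C0 <= kap]. *)
Lemma cE_back_le u (M t c : R) : C0L2 L L u -> 0 <= M -> 0 <= t <= L ->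
  (forall s : R, 0 <= s <= L -> l2n L (u s) <= M * ew s) ->
  cnorm2 (cE L u t L c) <= C0 / kap * M * ew t /\ 4 * L * (C0 / kap * M * ew t) <= M / 2 * ew t.
Proof.
move=> uC M0 /andP[t0 tL] H; have k0 := kap_gt0; have c0 := C0_ge0.
have e0 : 0 <= ew t by exact: expR_ge0.
split.
  apply: le_trans (cE_le (e := ew) c (ltW L0) uC t0 (lexx L) (@continuous_expB _ _) _ M0 _) _.
  - by move=> s; exact: expR_ge0.
  - by move=> s /andP[h1 h2]; apply: H; rewrite (le_trans t0 (ltW h1)) ltW.
  have := RI_expR_refl k0 tL; rewrite -/(ew t).
  move=> /(ler_wpM2l M0)/(ler_wpM2l c0)/le_trans; apply.
  by rewrite le_eqVlt; apply/orP; left; apply/eqP; rewrite /ew; ring.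
have -> : 4 * L * (C0 / kap * M * ew t) = (8 * L * C0) / kap * (M / 2 * ew t) by field; rewrite gt_eqF.
apply: ler_piMl; first by rewrite mulr_ge0// divr_ge0.
by rewrite ler_pdivrMr// mul1r /kap lerDl.
Qed.

Lemma back_bound : exists2 A, 0 <= A & forall b u, cL2r b -> back b u ->
  forall t : R, 0 <= t <= L -> l2n L (u t) <= A * nb b.
Proof.
have k0 := kap_gt0; have c0 := C0_ge0.
(* [bootstrap_le] with [A = 2 * nb b] gives [4 * nb b] times the weight, which is largest at time
   zero. *)
exists (4 * expR (kap * L)); first by rewrite mulr_ge0// expR_ge0.
move=> b u bL [uC ub] t tL; have [M0 HM0] := C0L2_bounded (ltW L0) uC.
have nb0 := nb_ge0 b.
have e1 (s : R) : 0 <= s <= L -> 1 <= ew s.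
  by move=> /andP[_ sL]; rewrite -expR0 ler_expR mulr_ge0 ?subr_ge0// ltW.
apply: (@le_trans _ _ (2 * (2 * nb b) * ew t)); last first.
  rewrite mulrA (_ : 2 * 2 = 4 :> R); last by ring.
  rewrite mulrAC ler_wpM2r// ler_wpM2l// ler_expR ler_wpM2l ?(ltW k0)//.
  by move: tL => /andP[t0 _]; rewrite lerBlDr lerDl.
apply: (bootstrap_le (ltW L0) (mulr_ge0 _ nb0) e1 HM0) => // M M_0 H s sL.
have us := C0L2_cL2 uC sL; have [h1 h2] := cE_back_le 0 uC M_0 sL H.
have [er ei] := cE_L2r s L (ltW L0) uC.
have bs := cL2r_cL2 L (cL2r_shift s bL).
have es : cL2 I (fun x => cE L u s L (x + s)) by apply: cL2r_cL2; exact: (@cL2r_shift s (cE L u s L)).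
rewrite (l2n_ae us (cL2B bs es) (ub s sL)).
apply: le_trans (l2nB bs es) _.
have l1 := l2n_shift_le s bL.
have l2 := l2n_bound (ltW L0) es (fun x _ => (cE_back_le (x + s) uC M_0 sL H).1).
rewrite [leRHS]mulrDl; apply: lerD.
  have w1 := e1 s sL; have l1' := ler_wpM2l (ltW (ltr0n R 2)) l1.
  apply: le_trans l1' _; rewrite ler_peMr// mulr_ge0//.
have p0 := l2n_ge0 L (fun x => cE L u s L (x + s)).
by move: (l2n L _) (C0 / kap * M * ew s) l2 h2 p0 => p q; lra.
Qed.

Lemma nb0 : nb (fun=> 0) = 0.
Proof.
have z : RI (fun=> (0 : R) ^+ 2) = 0 by apply: (etrans _ (RI0 R)); apply: eq_RI => x; rewrite expr0n.
by rewrite /nb /= z addr0.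
Qed.

Lemma back_unique b u v : back b u -> back b v -> forall t : R, 0 <= t <= L -> aeq L (u t) (v t).
Proof.
move=> ub vb t tL; have [A _ HA] := back_bound.
have := back_lin 1 (-1) ub vb.
rewrite (_ : (fun c => _ + _) = (fun=> 0)); last by apply/funext => c; ring.
move=> wb; have zL : cL2r (fun=> 0).
  by split; apply: eq_L2r (L2rZ 0 (L2r_ind 0 L)) => x; rewrite mul0r.
have := HA _ _ zL wb t tL; rewrite nb0 mulr0 => l0.
apply/aeq_subr.
have := l2n_eq0 (C0L2_cL2 wb.1 tL) (ltac:(by apply/le_anti; rewrite l0 l2n_ge0)).
by apply: aeS => x h xI; rewrite -(h xI); ring.
Qed.
End evolution.

Opaque cE.

(** * Existence of backward solutions *)

Lemma geometric_limit (R : realType) (X : Type) (w : nat -> X -> R) (Q : R) : 0 <= Q ->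
  (forall n p, `|w n.+1 p - w n p| <= Q / 2 ^+ n) ->
  exists l : X -> R, forall eps : R, 0 < eps -> exists N, forall n p, (N <= n)%N -> `|w n p - l p| <= eps.
Proof.
move=> Q0 H; apply: uniform_limit => eps eps0.
have tail m k p : `|w (m + k)%N p - w m p| <= 2 * Q / 2 ^+ m - 2 * Q / 2 ^+ (m + k).
  elim: k => [|k IH]; first by rewrite addn0 !subrr normr0.
  rewrite addnS (_ : w _ p - w m p = (w (m + k).+1 p - w (m + k)%N p) + (w (m + k)%N p - w m p)); last by ring.
  apply: le_trans (ler_normD _ _) _; apply: le_trans (lerD (H _ _) IH) _.
  rewrite exprS invfM; set z := (2 ^+ (m + k))^-1.
  by rewrite le_eqVlt; apply/orP; left; apply/eqP; field.
have tail' N m p : (N <= m)%N -> `|w m p - w N p| <= 2 * Q / 2 ^+ N.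
  move=> Nm; rewrite -(subnKC Nm); apply: le_trans (tail _ _ _) _.
  by rewrite gerBl divr_ge0// mulr_ge0.
have [N HN] := archi_gt (4 * Q / eps); exists N => m n p Nm Nn.
rewrite (_ : w m p - w n p = (w m p - w N p) - (w n p - w N p)); last by ring.
apply: le_trans (ler_normB _ _) _; apply: le_trans (lerD (tail' _ _ _ Nm) (tail' _ _ _ Nn)) _.
have p0 : 0 < 2 ^+ N :> R by rewrite exprn_gt0.
rewrite -mulrDl ler_pdivrMr//; move: HN; rewrite ltr_pdivrMr// => /ltW HN.
have NN : N%:R <= 2 ^+ N :> R.
  have -> : 2 ^+ N = (2 ^ N)%:R :> R by rewrite natrX.
  by rewrite ler_nat ltnW// ltn_expl.
have := ler_wpM2r (ltW eps0) NN; move: (2 ^+ N) (N%:R) HN => a b; lra.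
Qed.

Lemma small_le0 (R : realType) (a K : R) : 0 <= K -> (forall eps : R, 0 < eps -> a <= eps * K) -> a <= 0.
Proof.
move=> K0 H; rewrite leNgt; apply/negP => a0.
have K1 : 0 < K + 1 by rewrite ltr_wpDl.
have := H (a / (2 * (K + 1))) (ltac:(by rewrite divr_gt0// mulr_gt0)).
rewrite mulrAC ler_pdivlMr ?mulr_gt0//; nra.
Qed.

Section cauchy_problem.
Variable R : realType.
Local Notation Re := complex.Re.
Local Notation Im := complex.Im.

Lemma Re_le (z : R[i]) (e : R) : 0 <= e -> cnorm2 z <= e ^+ 2 -> `|Re z| <= e.
Proof.
move=> e0 h; rewrite -(@ler_pXn2r _ 2)// ?nnegrE// real_normK ?num_real//.
exact: le_trans (Re_sqr_le z) h.
Qed.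

Lemma Im_le (z : R[i]) (e : R) : 0 <= e -> cnorm2 z <= e ^+ 2 -> `|Im z| <= e.
Proof.
move=> e0 h; rewrite -(@ler_pXn2r _ 2)// ?nnegrE// real_normK ?num_real//.
exact: le_trans (Im_sqr_le z) h.
Qed.

Lemma cnorm2_le (z : R[i]) (e : R) : `|Re z| <= e -> `|Im z| <= e -> cnorm2 z <= 2 * e ^+ 2.
Proof.
move=> h1 h2; have e0 := le_trans (normr_ge0 _) h1.
rewrite /cnorm2 -(real_normK (num_real (Re z))) -(real_normK (num_real (Im z))).
have := ler_pM (normr_ge0 _) (normr_ge0 _) h1 h1; have := ler_pM (normr_ge0 _) (normr_ge0 _) h2 h2.
rewrite -!expr2; lra.
Qed.

Lemma cnorm2N (z : R[i]) : cnorm2 (- z) = cnorm2 z.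
Proof. by rewrite /cnorm2 ReN ImN !sqrrN. Qed.

Variables (L : R) (g : R -> R -> R[i]).
Local Notation I := `]0, L[%classic.
Hypothesis L0 : 0 < L.

Lemma l2n0 : l2n L (fun=> 0) = 0.
Proof.
rewrite /l2n Rintegral_ind; apply: (etrans _ (RI0 R)); apply: eq_RI => x.
by rewrite /cnorm2 Re0 Im0 expr0n/= addr0 mulr0.
Qed.

Lemma C0L2_0 (T : R) : C0L2 L T (fun _ _ => 0).
Proof.
apply: C0L2P => [t _|t0 _ e e0]; first exact: cL20.
exists 1 => // t _ _; rewrite (_ : (fun x => _) = (fun=> 0)) ?l2n0//.
by apply/funext => x; rewrite subrr.
Qed.

Lemma cL2_bounded (u : R -> R[i]) (C : R) : mf (er L u) -> mf (ei L u) ->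
  (forall x : R, 0 < x < L -> cnorm2 (u x) <= C ^+ 2) -> cL2 I u.
Proof.
move=> mr mi H; apply/cL2P.
have D (h : R -> R) : mf (fun x => ind 0 L x * h x) -> (forall x, 0 < x < L -> `|h x| <= `|C|) ->
    L2r (fun x => ind 0 L x * h x).
  move=> mh hC; apply: (eq_L2r (f := fun x => ind 0 L x * (ind 0 L x * h x))).
    by move=> x; rewrite mulrA -expr2 ind_sqr.
  apply: (L2r_bounded 0 L mh (C := `|C|)) => x; rewrite ind_ifE; case: ifPn => [/hC|_].
    by rewrite mul1r.
  by rewrite mul0r normr0.
have C2 : C ^+ 2 = `|C| ^+ 2 by rewrite real_normK ?num_real.
split; apply: D => // x /H; rewrite C2; [exact: Re_le|exact: Im_le].
Qed.

(** On a bounded interval uniform closeness implies closeness in norm, and pointwise limits stay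
    measurable; this takes the place of completeness of the state space. *)
Lemma C0L2_limit (T : R) (v : nat -> R -> R -> R[i]) u : (forall n, C0L2 L T (v n)) ->
  (forall eps : R, 0 < eps -> exists N, forall n (t x : R), (N <= n)%N -> 0 <= t <= T -> cnorm2 (v n t x - u t x) <= eps) ->
  C0L2 L T u.
Proof.
move=> vC vu.
have um (t : R) : 0 <= t <= T -> mf (er L (u t)) /\ mf (ei L (u t)).
  move=> tT; have vL n := C0L2_cL2 (vC n) tT.
  have U (eps : R) : 0 < eps -> exists N, forall n x, (N <= n)%N ->
      `|er L (v n t) x - er L (u t) x| <= eps /\ `|ei L (v n t) x - ei L (u t) x| <= eps.
    move=> eps0; have [N HN] := vu _ (exprn_gt0 2 eps0); exists N => n x Nn.
    rewrite -erB -eiB /er /ei !normrM (ger0_norm (ind_ge0 0 L x)).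
    have h1 := Re_le (ltW eps0) (HN n t x Nn tT); have h2 := Im_le (ltW eps0) (HN n t x Nn tT).
    by split; [apply: le_trans h1|apply: le_trans h2]; rewrite ler_piMl// ind_le1.
  split; [apply: (mf_uniform_limit (w := fun n => er L (v n t)))|apply: (mf_uniform_limit (w := fun n => ei L (v n t)))].
  - by move=> n; have /cL2P[[]] := vL n.
  - by move=> eps /U[N HN]; exists N => n p Nn; exact: (HN n p Nn).1.
  - by move=> n; have /cL2P[_ []] := vL n.
  - by move=> eps /U[N HN]; exists N => n p Nn; exact: (HN n p Nn).2.
have dL n (t C : R) : 0 <= t <= T -> (forall x : R, cnorm2 (v n t x - u t x) <= C ^+ 2) -> cL2 I (fun x => v n t x - u t x).
  move=> tT H; have [m1 m2] := um t tT; have /cL2P[v1 v2] := C0L2_cL2 (vC n) tT.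
  apply: (@cL2_bounded _ C) => //.
    by apply: eq_mf (mfB v1.1 m1) => x; rewrite erB.
  by apply: eq_mf (mfB v2.1 m2) => x; rewrite eiB.
have uL (t : R) : 0 <= t <= T -> cL2 I (u t).
  move=> tT; have [N HN] := vu (1 ^+ 2) (exprn_gt0 2 ltr01).
  have := cL2B (C0L2_cL2 (vC N) tT) (dL N t 1 tT (fun x => HN N t x (leqnn N) tT)).
  by rewrite (_ : (fun x => _) = u t)//; apply/funext => x; rewrite opprB addrC subrK.
apply: C0L2P => // t0 t0T e e0.
pose eps := e / (16 * (L + 1)); have L1 : 0 < L + 1 by rewrite ltr_wpDl// ltW.
have eps0 : 0 < eps by rewrite divr_gt0// mulr_gt0.
have [N HN] := vu _ eps0; have e80 : 0 < e / 16 by rewrite divr_gt0.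
have [d d0 Hd] := C0L2_continuous (vC N) t0T e80; exists d => // t tT td.
have vt := C0L2_cL2 (vC N) tT; have vt0 := C0L2_cL2 (vC N) t0T.
have H (s : R) : 0 <= s <= T -> cL2 I (fun x => v N s x - u s x) /\ l2n L (fun x => v N s x - u s x) <= e / 16.
  move=> sT; have cl := cL2B (C0L2_cL2 (vC N) sT) (uL s sT); split=> //.
  apply: le_trans (l2n_bound (ltW L0) cl (fun x _ => HN N s x (leqnn N) sT)) _.
  rewrite /eps invfM mulrA -mulrA ler_piMr//; first exact: ltW.
  by rewrite mulrC ler_pdivrMr// mul1r lerDl.
have [c1 l1] := H t tT; have [c2 l2] := H t0 t0T; have c3 := cL2B vt vt0.
have l3 := Hd t tT td.
have A := l2nB (cL2D c3 c2) c1; have B := l2nD c3 c2.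
rewrite (_ : (fun x => u t x - u t0 x) = (fun x => v N t x - v N t0 x + (v N t0 x - u t0 x) - (v N t x - u t x))); last first.
  by apply/funext => x; ring.
apply: le_lt_trans A _.
by move: (l2n L _) (l2n L _) (l2n L _) (l2n L _) B l1 l2 l3 => p q r s; lra.
Qed.

Hypothesis gN : nice_kernel L g.
Local Notation cE := (cE L g).
Local Notation back := (back L g).
Local Notation kap := (kap L g).
Local Notation C0 := (C0 g).

Section picard.
Variable b : R -> R[i].
Hypothesis bL : cL2r b.

Let step (u : R -> R -> R[i]) (t x : R) : R[i] := b (x + t) - cE L u t L (x + t).
Let ew (t : R) := expR (kap * (L - t)).

Let step_C0L2 u : C0L2 L L u -> C0L2 L L (step u).
Proof.
move=> uC; have e0 := cE_L2r L0 gN 0 L (ltW L0) uC.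
have dL := cL2r_lin 1 (-1) bL e0.
apply: (C0L2_ae (wave_C0L2 L0 gN (ltW L0) uC dL)) => t tL; split.
  apply: cL2B; apply: cL2r_cL2; first exact: cL2r_shift.
  by apply: (@cL2r_shift R t (cE L u t L)); exact: (cE_L2r L0 gN t L (ltW L0) uC).
have /andP[t0 t1] := tL.
apply: aeW => x _; rewrite /step -(cE_split L0 gN (x + t) (ltW L0) uC t0 t1).
by move: (cE _ _ _ _ _) (cE _ _ _ _ _) => p q; ring.
Qed.

Let step_le u v (M : R) : C0L2 L L u -> C0L2 L L v -> 0 <= M ->
  (forall s : R, 0 <= s <= L -> l2n L (fun x => u s x - v s x) <= M * ew s) ->
  (forall t x : R, 0 <= t <= L -> cnorm2 (step u t x - step v t x) <= C0 / kap * M * ew t) /\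
  (forall t : R, 0 <= t <= L -> l2n L (fun x => step u t x - step v t x) <= M / 4 * ew t).
Proof.
move=> uC vC M0 H; have wC := C0L2_lin 1 (-1) uC vC.
have wE (s : R) : (fun x => 1 * u s x + -1 * v s x) = (fun x => u s x - v s x).
  by apply/funext => x; ring.
have H' (s : R) : 0 <= s <= L -> l2n L (fun x => 1 * u s x + -1 * v s x) <= M * ew s by move=> sL; rewrite wE H.
have P (t c : R) (tL : 0 <= t <= L) := cE_back_le L0 gN c wC M0 tL H'.
have pt (t x : R) : 0 <= t <= L -> cnorm2 (step u t x - step v t x) <= C0 / kap * M * ew t.
  move=> tL; have [h _] := P t (x + t) tL.
  rewrite (cE_lin L0 gN _ _ _ _ _ (ltW L0) uC vC) in h; apply: le_trans h.
  rewrite le_eqVlt; apply/orP; left; apply/eqP; rewrite -cnorm2N; congr cnorm2; rewrite /step.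
  by move: (cE _ _ _ _ _) (cE _ _ _ _ _) => p q; ring.
split=> // t tL; have [_ h] := P t 0 tL.
have sL := cL2B (C0L2_cL2 (step_C0L2 uC) tL) (C0L2_cL2 (step_C0L2 vC) tL).
apply: le_trans (l2n_bound (ltW L0) sL (fun x _ => pt t x tL)) _.
have e0 : 0 <= ew t by exact: expR_ge0.
by move: h; rewrite -/(ew t); have := mulr_ge0 M0 e0; move: (C0 / kap * M * ew t) => q; lra.
Qed.

(** The iterates converge geometrically in weighted norm, and smoothing by one more [step] makes the
    convergence uniform in [t] and [x]. The limit then satisfies the equation at every point. *)
Lemma back_exists : exists u, back b u.
Proof.
have k0 : 0 < kap by exact: kap_gt0.
have c0 : 0 <= C0 by exact: C0_ge0.
have e1 (s : R) : 0 <= s <= L -> 1 <= ew s.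
  by move=> /andP[_ sL]; rewrite -expR0 ler_expR mulr_ge0 ?subr_ge0// ltW.
have e2 (s : R) : 0 <= s <= L -> ew s <= ew 0.
  by move=> /andP[s0 _]; rewrite ler_expR ler_wpM2l ?(ltW k0)// subr0 lerBlDr lerDl.
have [un [un0 unS]] : exists un : nat -> R -> R -> R[i], un 0%N = (fun _ _ => 0) /\ forall n, un n.+1 = step (un n).
  by exists (fun n => iter n step (fun _ _ => 0)).
have unC n : C0L2 L L (un n) by elim: n => [|n IH]; [rewrite un0; exact: C0L2_0|rewrite unS; exact: step_C0L2].
have [B HB] := C0L2_bounded (ltW L0) (C0L2_lin 1 (-1) (unC 1%N) (unC 0%N)).
have M0 n : 0 <= `|B| / 4 ^+ n by rewrite divr_ge0// exprn_ge0.
have dn n : forall t : R, 0 <= t <= L -> l2n L (fun x => un n.+1 t x - un n t x) <= `|B| / 4 ^+ n * ew t.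
  elim: n => [t tL|n IH t tL].
    rewrite expr0 divr1 (_ : (fun x => _) = (fun x => 1 * un 1%N t x + -1 * un 0%N t x)); last by apply/funext => x; ring.
    apply: le_trans (HB t tL) _; apply: le_trans (ler_norm _) _.
    by rewrite ler_peMr// e1.
  have [_ H] := step_le (unC n.+1) (unC n) (M0 n) IH; rewrite -!unS in H; apply: le_trans (H t tL) _.
  by rewrite exprS invfM le_eqVlt; apply/orP; left; apply/eqP; ring.
pose Q := C0 / kap * `|B| * ew 0.
have ck0 : 0 <= C0 / kap by exact: divr_ge0 c0 (ltW k0).
have Q0 : 0 <= Q by exact: mulr_ge0 (mulr_ge0 ck0 (normr_ge0 B)) (expR_ge0 _).
(* A square root is avoided through [Q <= (Q + 1) ^+ 2]. *)
have pn n (t x : R) : 0 <= t <= L -> cnorm2 (un n.+2 t x - un n.+1 t x) <= ((Q + 1) / 2 ^+ n) ^+ 2.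
  move=> tL; have [H _] := step_le (unC n.+1) (unC n) (M0 n) (dn n); rewrite -!unS in H; apply: le_trans (H t x tL) _.
  apply: (@le_trans _ _ (Q / 4 ^+ n)).
    have -> : Q / 4 ^+ n = C0 / kap * (`|B| / 4 ^+ n) * ew 0 by rewrite /Q; ring.
    by apply: ler_wpM2l; [exact: mulr_ge0 ck0 (M0 n)|exact: e2].
  rewrite exprMn exprVn -exprM mulnC exprM (_ : 2 ^+ 2 = 4 :> R); last by rewrite -natrX.
  by rewrite ler_wpM2r ?invr_ge0 ?exprn_ge0//; nra.
have q0 n : 0 <= (Q + 1) / 2 ^+ n by rewrite divr_ge0 ?exprn_ge0// addr_ge0.
(* The sequence starts at index 1: the very first increment contains [b], which may be unbounded,
   while the later ones are uniformly small. *)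
pose wr n (p : R * R) : R := (0 <= p.1 <= L)%R%:R * Re (un n.+1 p.1 p.2).
pose wi n (p : R * R) : R := (0 <= p.1 <= L)%R%:R * Im (un n.+1 p.1 p.2).
have Q1 : 0 <= Q + 1 by rewrite addr_ge0.
have [lr Hr] : exists l : R * R -> R, forall eps : R, 0 < eps -> exists N, forall n p, (N <= n)%N -> `|wr n p - l p| <= eps.
  apply: (geometric_limit (Q := Q + 1)) => // n [t x]; rewrite /wr /=; case: (boolP (0 <= t <= L)) => tL.
    by rewrite !mul1r -(ReB (un n.+2 t x)); exact: Re_le (q0 n) (pn n t x tL).
  by rewrite !mul0r subrr normr0.
have [li Hi] : exists l : R * R -> R, forall eps : R, 0 < eps -> exists N, forall n p, (N <= n)%N -> `|wi n p - l p| <= eps.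
  apply: (geometric_limit (Q := Q + 1)) => // n [t x]; rewrite /wi /=; case: (boolP (0 <= t <= L)) => tL.
    by rewrite !mul1r -(ImB (un n.+2 t x)); exact: Im_le (q0 n) (pn n t x tL).
  by rewrite !mul0r subrr normr0.
pose u (t x : R) : R[i] := Complex (lr (t, x)) (li (t, x)).
have near (eps : R) : 0 < eps -> exists N, forall n (t x : R), (N <= n)%N -> 0 <= t <= L -> cnorm2 (un n.+1 t x - u t x) <= eps.
  move=> eps0; pose e := Num.min 1 (eps / 2).
  have e0 : 0 < e by rewrite lt_min ltr01 divr_gt0.
  have [N1 H1] := Hr e e0; have [N2 H2] := Hi e e0; exists (maxn N1 N2) => n t x; rewrite geq_max => /andP[n1 n2] tL.
  apply: (@le_trans _ _ (2 * e ^+ 2)).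
    apply: cnorm2_le; rewrite ?ReB ?ImB.
      by have := H1 n (t, x) n1; rewrite /wr [(t, x).1]/= tL mul1r.
    by have := H2 n (t, x) n2; rewrite /wi [(t, x).1]/= tL mul1r.
  have h1 : e <= 1 by rewrite ge_min lexx.
  have h2 : e <= eps / 2 by rewrite ge_min lexx orbT.
  by nra.
have uC : C0L2 L L u by exact: (C0L2_limit (v := fun n => un n.+1)) (fun n => unC n.+1) near.
exists u; split=> // t tL; apply: aeW => x _.
apply/eqP; rewrite -subr_eq0; apply/eqP; apply: cnorm2_eq0; apply/le_anti; rewrite cnorm2_ge0 andbT.
apply: (@small_le0 _ _ (2 + 2 * (C0 / kap * L * ew t))).
  exact: addr_ge0 (ltW (ltr0n R 2)) (mulr_ge0 (ltW (ltr0n R 2)) (mulr_ge0 (mulr_ge0 ck0 (ltW L0)) (expR_ge0 _))).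
move=> eps eps0; have [N HN] := near eps eps0.
have eL : 0 <= eps * L by rewrite mulr_ge0 ?ltW.
have lN (s : R) : 0 <= s <= L -> l2n L (fun x => un N.+1 s x - u s x) <= eps * L * ew s.
  move=> sL; have cl := cL2B (C0L2_cL2 (unC N.+1) sL) (C0L2_cL2 uC sL).
  apply: le_trans (l2n_bound (ltW L0) cl (fun x _ => HN N s x (leqnn N) sL)) _.
  by rewrite ler_peMr// e1.
have [h1 _] := step_le (unC N.+1) uC eL lN; have {}h1 := h1 t x tL.
have h2 := HN N.+1 t x (leqnSn N) tL.
have := cnorm2D (u t x - un N.+2 t x) (step (un N.+1) t x - step u t x).
rewrite -cnorm2N opprB in h2.
rewrite (_ : u t x - un N.+2 t x + _ = u t x - step u t x); last first.
  by rewrite unS; move: (u t x) (step (un N.+1) t x) (step u t x) => p q r; ring.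
move=> /le_trans; apply.
rewrite [leRHS]mulrDr; move: (cnorm2 _) (cnorm2 _) h1 h2 => p q h1 h2.
have -> : eps * (2 * (C0 / kap * L * ew t)) = 2 * (C0 / kap * (eps * L) * ew t) by ring.
by move: (C0 / kap * _ * _) h1 => r; lra.
Qed.

End picard.
End cauchy_problem.

(** * Closed-loop trajectories *)

Section control.
Variable R : realType.
Local Notation aeq := (@Defs.ae_eq R).
Variables (L : R) (g : R -> R -> R[i]).
Local Notation I := `]0, L[%classic.
Hypothesis L0 : 0 < L.
Hypothesis gN : nice_kernel L g.
Local Notation mild := (mild L g).
Local Notation cE := (cE L g).

(** As a datum for [back] it is zero on [(L, 2L)], so the backward solution is null at time [L]. *)
Definition ext (u : R -> R[i]) (c : R) : R[i] := Complex (er L u c) (ei L u c).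

Lemma extE u (x : R) : 0 < x < L -> ext u x = u x.
Proof. by move=> xI; apply: cplx_eq; rewrite /= /er /ei indE// mul1r. Qed.

Lemma ext0 u (x : R) : ~~ (0 < x < L) -> ext u x = 0.
Proof. by move=> xI; apply: cplx_eq; rewrite /= /er /ei ind0// mul0r. Qed.

Lemma ext_cL2r u : cL2 I u -> cL2r (ext u).
Proof. by move=> /cL2P. Qed.

Lemma ext_lin (al be : R[i]) u v : ext (fun x => al * u x + be * v x) = (fun c => al * ext u c + be * ext v c).
Proof.
apply/funext => c; case: (boolP (0 < c < L)) => cI; first by rewrite !extE.
by rewrite !ext0// !mulr0 addr0.
Qed.

Lemma nb_ext u : cL2 I u -> nb (ext u) = l2n L u.
Proof. by move=> uL; rewrite l2nE. Qed.

Lemma datE (T : R) u0 U (x : R) : 0 < x < L -> dat L T u0 U x = u0 x.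
Proof.
move=> xI; have xo : ~~ (L < x < L + T) by case/andP: xI => _ xL; rewrite (lt_gtF xL).
by apply: cplx_eq; rewrite /= (indE xI) (ind0 xo) mul1r mul0r addr0.
Qed.

Lemma datU (T : R) u0 U (c : R) : L < c < L + T -> dat L T u0 U c = U (c - L).
Proof.
move=> cI; have xo : ~~ (0 < c < L) by case/andP: cI => xL _; rewrite (lt_gtF xL) andbF.
by apply: cplx_eq; rewrite /= (indE cI) (ind0 xo) mul1r mul0r add0r.
Qed.

Lemma datL (T : R) u0 U : dat L T u0 U L = 0.
Proof. by apply: cplx_eq; rewrite /= !ind0 ?ltxx ?andbF// !mul0r addr0. Qed.

Lemma cE_refl (T : R) u (a c : R) : 0 <= T -> C0L2 L T u -> 0 <= a <= T -> cE T u a a c = 0.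
Proof.
move=> T0 uC /andP[a0 aT]; apply: cE_null => // s /andP[h1 h2].
by have := lt_trans h1 h2; rewrite ltxx.
Qed.

Section functional.
Variable Gam : (R -> R[i]) -> R[i].
Hypothesis GamB : bounded_linear_functional L Gam.

Lemma functional_lin (al be : R[i]) f h : cL2 I f -> cL2 I h ->
  Gam (fun x => al * f x + be * h x) = al * Gam f + be * Gam h.
Proof.
have [GD [GM _]] := GamB => fL hL.
by rewrite (GD (fun x => al * f x) (fun x => be * h x) (cL2M al fL) (cL2M be hL)) !GM.
Qed.

Lemma functional_bound : exists2 m : R, 0 < m & forall f, cL2 I f -> cnorm2 (Gam f) <= m * l2n L f.
Proof.
have [_ [_ [M HM]]] := GamB; exists (`|M| + 1); first by rewrite ltr_wpDl.
move=> f fL; apply: le_trans (HM f fL) _; apply: ler_wpM2r; first exact: l2n_ge0.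
by rewrite (le_trans (ler_norm M))// lerDl.
Qed.

(** The feedback signal is continuous and bounded on [[0, T]]; its measurability is read from
    [caratheodory] with a dummy space variable. *)
Lemma functional_cL2 (T : R) u : 0 <= T -> C0L2 L T u -> cL2 `]0, T[%classic (fun t => Gam (u t)).
Proof.
move=> T0 uC; have [m m0 Hm] := functional_bound.
have ct (t0 : R) : 0 <= t0 <= T -> forall eps : R, 0 < eps -> exists2 d : R, 0 < d &
    forall t : R, 0 <= t <= T -> `|t - t0| < d -> cnorm2 (Gam (u t) - Gam (u t0)) <= (eps / 2) ^+ 2.
  move=> t0T eps eps0; have e0 : 0 < (eps / 2) ^+ 2 / m by rewrite divr_gt0// exprn_gt0// divr_gt0.
  have [d d0 Hd] := C0L2_continuous uC t0T e0; exists d => // t tT td.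
  have [u1 u2] := (C0L2_cL2 uC tT, C0L2_cL2 uC t0T).
  have -> : Gam (u t) - Gam (u t0) = Gam (fun x => u t x - u t0 x).
    rewrite (_ : (fun x => _) = (fun x => 1 * u t x + -1 * u t0 x)); last by apply/funext => x; ring.
    by rewrite functional_lin//; ring.
  apply: le_trans (Hm _ (cL2B u1 u2)) _.
  by have := Hd t tT td; rewrite ltr_pdivlMr// mulrC => /ltW.
have half (eps : R) : 0 < eps -> eps / 2 < eps by lra.
pose h (p : R[i] -> R) (s x : R) : R := (0 <= s <= T)%R%:R * p (Gam (u s)).
have mh (p : R[i] -> R) : (forall (z w : R[i]) (e : R), 0 <= e -> cnorm2 (z - w) <= e ^+ 2 -> `|p z - p w| <= e) ->
    mf (fun s => ind 0 T s * p (Gam (u s))).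
  move=> pp; have m2 : mf2 (h p).
    apply: (caratheodory T0) => [s|s x /negbTE sT|x s0 s0T eps eps0].
    - exact: mf_cst.
    - by rewrite /h sT mul0r.
    have [d d0 Hd] := ct s0 s0T eps eps0; exists d => // s sT sd.
    rewrite /h sT s0T !mul1r; apply: le_lt_trans (half _ eps0).
    by apply: pp; [rewrite divr_ge0// ltW|exact: Hd].
  have m1 : mf (fun s => h p s 0).
    by apply: (@mf2_comp _ _ _ _ id (fun=> 0) m2).
  apply: (eq_mf (f := fun s => ind 0 T s * h p s 0)); last by apply: mfM => //; exact: measurable_ind.
  move=> s; rewrite ind_ifE; case: ifPn => [/andP[s0 sT]|_]; last by rewrite !mul0r.
  by rewrite !mul1r /h (ltW s0) (ltW sT) mul1r.
have [B HB] := C0L2_bounded T0 uC.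
apply: (@cL2_bounded R T _ (m * `|B| + 1)).
- by apply: mh => z w e e0; rewrite -ReB; exact: Re_le.
- by apply: mh => z w e e0; rewrite -ImB; exact: Im_le.
move=> t /andP[t0 tT]; have tI : 0 <= t <= T by rewrite !ltW.
apply: le_trans (Hm _ (C0L2_cL2 uC tI)) _.
have := HB t tI; have := ler_norm B; have := mulr_ge0 (ltW m0) (normr_ge0 B).
by move: (l2n L _) => q; nra.
Qed.

Lemma closed_loop_mild (T : R) u0 u : 0 <= T -> cL2 I u0 -> closed_loop_sol L g Gam u0 u ->
  mild T (dat L T u0 (fun t => Gam (u t))) u.
Proof.
move=> T0 u0L uc; have W := uc T T0.
exact: (weak_to_mild L0 gN T0 W u0L (functional_cL2 T0 W.1)).
Qed.

(** The difference [w] starts from zero and is driven by [Gam (w s)]. With an exponential weight the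
    control and integral terms are both contractive, and [bootstrap_le] with [A = 0] leaves
    nothing. *)
Lemma closed_loop_unique u0 u v : cL2 I u0 -> closed_loop_sol L g Gam u0 u -> closed_loop_sol L g Gam u0 v ->
  forall t : R, 0 <= t -> aeq L (u t) (v t).
Proof.
move=> u0L uc vc T T0; have [m m0 Hm] := functional_bound.
have um := closed_loop_mild T0 u0L uc; have vm := closed_loop_mild T0 u0L vc.
have [uC _ _ _] := um; have [vC _ _ _] := vm.
have := mild_lin L0 gN 1 (-1) T0 um vm.
set D := (fun c => _); set w := (fun t x => _) => -[wC Dr Di wm].
pose c0 := C0 g; have c00 : 0 <= c0 by exact: C0_ge0.
(* Chosen so that [2 * m + 2 * (L * c0)], the joint constant of the control and integral terms, is
   at most [k / 2]. *)
pose k : R := 4 * m + 4 * (L * c0) + 1.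
have Lc0 : 0 <= L * c0 by exact: mulr_ge0 (ltW L0) c00.
have k0 : 0 < k by rewrite /k; lra.
pose e (t : R) := expR (k * t).
have e0 (t : R) : 0 <= e t by exact: expR_ge0.
have ce : continuous e by exact: continuous_expZ.
have [M0 HM0] := C0L2_bounded T0 wC.
have D0 (c : R) : 0 < c -> c <= L -> D c = 0.
  move=> c1; rewrite le_eqVlt => /orP[/eqP ->|c2]; first by rewrite /D !datL !mulr0 addr0.
  by rewrite /D !datE ?c1// mul1r mulN1r subrr.
have DU (s : R) : 0 < s < T -> D (s + L) = Gam (w s).
  move=> /andP[s0 sT]; have sI : 0 <= s <= T by rewrite !ltW.
  have sL : L < s + L < L + T by rewrite ltrDr s0 addrC ltrD2l.
  rewrite /D !datU// addrK /w functional_lin//; exact: C0L2_cL2 sI.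
have H : forall t : R, 0 <= t <= T -> l2n L (w t) <= 2 * 0 * e t.
  apply: (bootstrap_le T0 (lexx 0) _ HM0).
    by move=> t /andP[t0 _]; rewrite -expR0 ler_expR mulr_ge0// ltW.
  move=> M M_0 HM t tT; have /andP[t0 t1] := tT; rewrite add0r.
  have Db := cL2r_cL2 L (cL2r_shift t (conj Dr Di)).
  have es : cL2 I (fun x => cE T w 0 t (x + t)).
    by apply: cL2r_cL2; apply: (@cL2r_shift R t (cE T w 0 t)); exact: (cE_L2r L0 gN 0 t T0 wC).
  have wE : aeq L (w t) (fun x => D (x + t) + cE T w 0 t (x + t)).
    by apply: aeS (wm t tT) => x h xI; rewrite (h xI) cwaveE.
  have Ei : RI (fun s => ind 0 t s * e s) <= e t / k by exact: RI_expR.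
  have Mk : 0 <= M * RI (fun s => ind 0 t s * e s).
    by apply: mulr_ge0 => //; apply: RI_ge0 => s; rewrite mulr_ge0// ind_ge0.
  have l2 : l2n L (fun x => cE T w 0 t (x + t)) <= c0 * (M * RI (fun s => ind 0 t s * e s)) * L.
    apply: (l2n_bound (ltW L0) es) => x _; apply: (cE_le L0 gN _ T0 wC (lexx 0) t1 ce e0 M_0).
    by move=> s /andP[s0 s1]; apply: HM; rewrite ltW// ltW// (lt_le_trans s1).
  have l1 : l2n L (fun x => D (x + t)) <= m * (M * RI (fun s => ind 0 t s * e s)).
    have me := Li_ind_continuous 0 t ce.
    have ms := LiZ (m * M) (Li_shift (t - L) me).
    rewrite mulrA -(RI_shift (t - L) (Li_meas me)) -(RIZ (m * M) (Li_shift (t - L) me)).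
    rewrite /l2n Rintegral_ind; apply: RI_le ms _; first exact: (l2n_Li Db).
    move=> x; rewrite [in X in X <= _]ind_ifE; case: ifPn => [/andP[x0 xL]|_]; last first.
      by rewrite mul0r mulr_ge0// ?mulr_ge0 ?ind_ge0// ltW.
    rewrite mul1r; case: (leP (x + t) L) => xt.
      by rewrite D0// ?ltr_wpDr// (_ : cnorm2 0 = 0) ?mulr_ge0 ?ind_ge0// ?ltW// /cnorm2 /= expr0n addr0.
    have s0 : 0 < x + (t - L) < t by apply/andP; split; lra.
    have sT : 0 < x + (t - L) < T by apply/andP; split; lra.
    have sI : 0 <= x + (t - L) <= T by apply/andP; split; lra.
    rewrite (_ : x + t = x + (t - L) + L); last by ring.
    rewrite (DU _ sT) (indE s0) mul1r -mulrA.
    by apply: le_trans (Hm _ (C0L2_cL2 wC sI)) _; rewrite ler_wpM2l ?(ltW m0)// HM.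
  rewrite (l2n_ae (C0L2_cL2 wC tT) (cL2D Db es) wE).
  apply: le_trans (l2nD Db es) _.
  have fin : (2 * m + 2 * (L * c0)) * (M * (e t / k)) <= M / 2 * e t.
    have -> : (2 * m + 2 * (L * c0)) * (M * (e t / k)) = (4 * m + 4 * (L * c0)) / k * (M / 2 * e t).
      by field; rewrite gt_eqF.
    apply: ler_piMl; first by rewrite mulr_ge0// divr_ge0.
    by rewrite ler_pdivrMr// mul1r /k lerDl.
  have ml := ler_wpM2l M_0 Ei.
  have p0 : 0 <= 2 * m + 2 * (L * c0) by lra.
  apply: le_trans fin; apply: le_trans (ler_wpM2l p0 ml).
  by move: (l2n L _) (l2n L _) (M * RI _) l1 l2 => a b q; rewrite mulrDl; lra.
apply/aeq_subr; have TT : 0 <= T <= T by rewrite T0 lexx.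
have := H T TT; rewrite mulr0 mul0r => l0.
have := l2n_eq0 (C0L2_cL2 wC TT) (ltac:(by apply/le_anti; rewrite l0 l2n_ge0)).
by apply: aeS => x h xI; rewrite -(h xI) /w; ring.
Qed.

End functional.

Lemma stabilizable_controllable : stabilizable_in_finite_time L g L -> exactly_controllable L g L.
Proof.
move=> [Gam [GB HG]] u0 u1 u0L u1L.
have LL : 0 <= L <= L by rewrite lexx ltW.
have L00 : 0 <= (0 : R) <= L by rewrite lexx ltW.
(* The target on [(L, 2L)], where the final state is read; on [(0, L)] the datum is free and set to
   zero. *)
pose b c := ext u1 (c - L).
have bL : cL2r b by apply: (@cL2r_shift R (- L) (ext u1)); exact: ext_cL2r.
have [v vb] := back_exists L0 gN bL; have vm := back_mild L0 gN bL vb; have [vC vE] := vb.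
have v0L := C0L2_cL2 vC L00.
have wL := cL2B u0L v0L.
have [[w wc] [_ wz]] := HG _ wL.
have wm := closed_loop_mild GB (ltW L0) wL wc.
have := mild_lin L0 gN 1 1 (ltW L0) vm wm.
set d := (fun c => _); set u := (fun t x => _) => um.
have [uC dr di _] := um.
have UL : cL2 I (fun t => d (t + L)) by apply: cL2r_cL2; apply: (@cL2r_shift R L d).
(* The control is read from the datum of the sum on the labels entering through [x = L]. *)
exists (fun t => d (t + L)); split => //; exists u; split.
  have /cL2P[[m1 _] [m2 _]] := UL.
  apply: (mild_to_weak L0 gN (ltW L0) um u0L m1 m2); last by apply: aeW.
  have [_ _ _ v0] := vm; apply: aeS (v0 0 L00) => x h xI; rewrite /d.
  have xI' : 0 < x < L by move: xI; rewrite /= in_itv.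
  rewrite datE//; move: (h xI); rewrite cwaveE (cE_refl _ (ltW L0) vC L00) !addr0 => ->.
  by rewrite !mul1r addrC subrK.
apply: aeS (aeI (vE L LL) (wz w wc L (lexx L))) => x [h1 h2] xI.
have xI' : 0 < x < L by move: xI; rewrite /= in_itv.
rewrite /u (h1 xI) (h2 xI) (cE_refl _ (ltW L0) vC LL) /b addrK extE//.
by rewrite mulr0 addr0 subr0 mul1r.
Qed.
End control.

(** * Bessel's inequality for bounded functionals *)

Section bessel.
Variables (R : realType) (V : lmodType R) (S : V -> Prop) (ip : V -> V -> R).
Hypothesis SD : forall x y, S x -> S y -> S (x + y).
Hypothesis SZ : forall a x, S x -> S (a *: x).
Hypothesis S0 : S 0.
Hypothesis ipC : forall x y, ip x y = ip y x.
Hypothesis ipDl : forall x y z, S x -> S y -> S z -> ip (x + y) z = ip x z + ip y z.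
Hypothesis ipZl : forall a x z, S x -> S z -> ip (a *: x) z = a * ip x z.

(** For [v] with coefficients [phi (e i)], both [phi v] and [ip v v] equal the sum [s], so
    [s ^+ 2 <= C * s]. No vector representing [phi] is involved. *)
Lemma bessel_functional (phi : V -> R) (C : R) n e : 0 <= C ->
  (forall x y, S x -> S y -> phi (x + y) = phi x + phi y) ->
  (forall a x, S x -> phi (a *: x) = a * phi x) ->
  (forall x, S x -> phi x ^+ 2 <= C * ip x x) ->
  orthonormal S ip e n -> \sum_(i < n) phi (e i) ^+ 2 <= C.
Proof.
move=> C0 phiD phiZ phiB [eS eo].
have phi0 : phi 0 = 0 by rewrite -(scale0r 0) phiZ// mul0r.
have phi_sum m (c : nat -> R) : (m <= n)%N -> phi (\sum_(i < m) c i *: e i) = \sum_(i < m) c i * phi (e i).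
  elim: m => [|m IH] mn; first by rewrite !big_ord0.
  rewrite !big_ord_recr /= phiD ?phiZ ?IH ?(ltnW mn)//; try exact: eS.
    by apply: (sumS SD SZ c) => // i im; apply: eS; exact: ltn_trans im mn.
  by apply: SZ; exact: eS.
pose v := \sum_(i < n) phi (e i) *: e i.
have vS : S v by exact: (sumS SD SZ (fun i => phi (e i)) eS).
have vv : ip v v = \sum_(i < n) phi (e i) ^+ 2.
  rewrite {1}/v (ip_suml SD SZ ipDl ipZl (fun i => phi (e i)) eS S0 vS); apply: eq_bigr => i _.
  rewrite ipC {1}/v (ip_suml SD SZ ipDl ipZl (fun i => phi (e i)) eS S0 (eS _ (ltn_ord i))) expr2; congr (_ * _).
  rewrite (bigD1 i)//= eo// eqxx mulr1 big1 ?addr0// => j ji.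
  by rewrite eo// (_ : (j == i :> nat) = false) ?mulr0//; apply: negbTE.
have := phiB v vS; rewrite vv {1}/v (phi_sum n (fun i => phi (e i)) (leqnn n)).
rewrite (_ : \sum_(i < n) _ * _ = \sum_(i < n) phi (e i) ^+ 2); last by apply: eq_bigr => i _; rewrite expr2.
have s0 : 0 <= \sum_(i < n) phi (e i) ^+ 2 by apply: sumr_ge0 => i _; exact: sqr_ge0.
by move: (\sum_(i < n) _) s0 => s s0 H; rewrite leNgt; apply/negP => Cs; nra.
Qed.

End bessel.

(** * The feedback *)

Section feedback.
Variable R : realType.
Local Notation Re := complex.Re.
Local Notation Im := complex.Im.
Local Notation mu := (@lebesgue_measure R).
Local Notation aeq := (@Defs.ae_eq R).
Variables (L : R) (g : R -> R -> R[i]).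
Local Notation I := `]0, L[%classic.
Hypothesis L0 : 0 < L.
Hypothesis gN : nice_kernel L g.
Local Notation cE := (cE L g).
Local Notation back := (back L g).
Local Notation ext := (ext L).
Variable bk : (R -> R[i]) -> R -> R -> R[i].
Hypothesis bkP : forall be, cL2 I be -> back (ext be) (bk be).

Let LL : 0 <= L <= L. Proof. by rewrite lexx ltW. Qed.
Let L00 : 0 <= (0 : R) <= L. Proof. by rewrite lexx ltW. Qed.

(** The operator [K], defined at every label: on [(0, L)] it corrects [be] into the initial state,
    and on [(L, 2L)] it is the control of the trajectory at time [c - L]. *)
Definition kk (be : R -> R[i]) (c : R) : R[i] := - cE L (bk be) 0 L c.

Lemma kk_back be u (c : R) : cL2 I be -> back (ext be) u -> kk be c = - cE L u 0 L c.
Proof.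
move=> beL ub; congr (- _); have [bC _] := bkP beL; have [uC _] := ub.
apply: (cE_congr gN) => s /andP[s0 sL]; have sI : 0 <= s <= L by rewrite !ltW.
split=> //; [exact: C0L2_cL2 bC sI|exact: C0L2_cL2 uC sI|].
exact: (back_unique L0 gN (bkP beL) ub).
Qed.

Lemma kk_lin (al ga : R[i]) be de (c : R) : cL2 I be -> cL2 I de ->
  kk (fun x => al * be x + ga * de x) c = al * kk be c + ga * kk de c.
Proof.
move=> beL deL; have bb := bkP beL; have bd := bkP deL.
have := back_lin L0 gN al ga bb bd; rewrite -ext_lin => b.
rewrite (kk_back c _ b); last by apply: cL2D; exact: cL2M.
rewrite (cE_lin L0 gN _ _ _ _ _ (ltW L0) bb.1 bd.1) /kk.
by move: (cE _ _ _ _ _) (cE _ _ _ _ _) => p q; ring.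
Qed.

(** Being pointwise in [c], it serves three times: for the Hilbert-Schmidt bound, for uniform
    convergence in [K_complete], and at [c = L] for the feedback. *)
Lemma kk_bound : exists2 C : R, 0 <= C & forall be (c : R), cL2 I be -> cnorm2 (kk be c) <= C * l2n L be.
Proof.
have [A A0 HA] := back_bound L0 gN; have c0 : 0 <= C0 g by exact: C0_ge0.
exists (C0 g * A * L); first exact: mulr_ge0 (mulr_ge0 c0 A0) (ltW L0).
move=> be c beL; have bb := bkP beL; have n0 := l2n_ge0 L be.
rewrite cnorm2N; apply: le_trans (cE_le (e := fun=> 1) (M := A * l2n L be) L0 gN c (ltW L0) bb.1 (lexx 0) (lexx L) _ _ _ _) _.
- exact: continuous_cstR.
- by [].
- exact: mulr_ge0.
- move=> s /andP[s0 sL]; have sI : 0 <= s <= L by rewrite !ltW.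
  by rewrite mulr1 -(nb_ext beL); exact: (HA _ _ (ext_cL2r beL) bb).
have -> : RI (fun s => ind 0 L s * 1) = L.
  by rewrite -[RHS](subr0 L) -(RI_ind (ltW L0)); apply: eq_RI => s; rewrite mulr1.
by rewrite le_eqVlt; apply/orP; left; apply/eqP; ring.
Qed.

Lemma kk_cL2 be : cL2 I be -> cL2 I (kk be).
Proof.
move=> beL; have [bC _] := bkP beL.
have h := cL2M (-1) (cL2r_cL2 L (cE_L2r L0 gN 0 L (ltW L0) bC)).
by rewrite (_ : kk be = (fun x => -1 * cE L (bk be) 0 L x))//; apply/funext => x; rewrite mulN1r.
Qed.

Lemma kk_trace be u : cL2 I be -> back (ext be) u -> aeq L (u 0) (fun x => be x + kk be x).
Proof.
move=> beL ub; have [uC uE] := ub; apply: aeS (uE 0 L00) => x h xI; rewrite (h xI) addr0 (kk_back x beL ub).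
by rewrite extE//; move: xI; rewrite /= in_itv.
Qed.

(** Complex functions as a real vector space, with the real part of the Hermitian product;
    surjectivity and norm estimates are the same over the reals. *)
Let V := (R -> Rcomplex R).
Let S (x : V) := cL2 I (x : R -> R[i]).
Let ip (x y : V) : R := RI (fun s => er L x s * er L y s) + RI (fun s => ei L x s * ei L y s).

Lemma RcomplexZ (a : R) (z : Rcomplex R) : a *: z = Complex a 0 * (z : R[i]) :> R[i].
Proof. by case: z => p q; apply: cplx_eq; rewrite ?ReM ?ImM /=; ring. Qed.

Let VZ (a : R) (x : V) : a *: x = (fun s => Complex a 0 * (x s : R[i])) :> (R -> R[i]).
Proof. by apply/funext => s; exact: RcomplexZ. Qed.

Let VD (x y : V) : x + y = (fun s => (x s : R[i]) + y s) :> (R -> R[i]).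
Proof. by []. Qed.

Let VB (x y : V) : x - y = (fun s => (x s : R[i]) - y s) :> (R -> R[i]).
Proof. by []. Qed.

Let SD x y : S x -> S y -> S (x + y).
Proof. exact: cL2D. Qed.
Let SZ a x : S x -> S (a *: x).
Proof. by rewrite /S VZ; exact: cL2M. Qed.
Let S0 : S 0.
Proof. exact: cL20. Qed.
Let ipC x y : ip x y = ip y x.
Proof. by rewrite /ip; congr (_ + _); apply: eq_RI => s; rewrite mulrC. Qed.
Let ipDl x y z : S x -> S y -> S z -> ip (x + y) z = ip x z + ip y z.
Proof.
move=> /cL2P[xr xi] /cL2P[yr yi] /cL2P[zr zi]; rewrite /ip.
rewrite [RHS]addrACA -(RID (L2r_Li xr zr) (L2r_Li yr zr)) -(RID (L2r_Li xi zi) (L2r_Li yi zi)).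
by congr (_ + _); apply: eq_RI => s; rewrite VD ?erD ?eiD mulrDl.
Qed.
Let ipZl a x z : S x -> S z -> ip (a *: x) z = a * ip x z.
Proof.
move=> /cL2P[xr xi] /cL2P[zr zi]; rewrite /ip mulrDr -(RIZ a (L2r_Li xr zr)) -(RIZ a (L2r_Li xi zi)).
by congr (_ + _); apply: eq_RI => s; rewrite VZ ?erM ?eiM /=; ring.
Qed.
Let ipE x : S x -> ip x x = l2n L x.
Proof. by move=> xS; rewrite l2nE. Qed.
Let ip_ge0 x : S x -> 0 <= ip x x.
Proof. by move=> xS; rewrite ipE// l2n_ge0. Qed.

Let K (x : V) : V := kk x.
Let KS x : S x -> S (K x).
Proof. exact: kk_cL2. Qed.
Let KD x y : S x -> S y -> K (x + y) = K x + K y.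
Proof.
move=> xS yS; apply/funext => s; have h := etrans (kk_lin 1 1 s xS yS) (congr2 +%R (mul1r _) (mul1r _)).
apply: (etrans _ h); rewrite /K VD; congr (kk _ s); apply/funext => t.
by rewrite (mul1r (x t : R[i])) (mul1r (y t : R[i])).
Qed.
Let KZ a x : S x -> K (a *: x) = a *: K x.
Proof.
move=> xS; apply/funext => s; have := kk_lin (Complex a 0) 0 s xS xS; rewrite mul0r addr0 => h.
apply: (etrans _ (esym (RcomplexZ a (K x s)))); rewrite -[RHS]h /K VZ.
by congr (kk _ s); apply/funext => t; rewrite mul0r addr0.
Qed.

(** At each point [s] Bessel's inequality bounds by [C] the sums of the squares of the real and of
    the imaginary parts of [K (e i) s]. Integration over [(0, L)] gives [2 * C * L]. *)
Let kappa : exists kap : R, (forall x, S x -> ip (K x) (K x) <= kap * ip x x) /\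
  (forall n e, orthonormal S ip e n -> \sum_(i < n) ip (K (e i)) (K (e i)) <= kap).
Proof.
have [C C0 HC] := kk_bound; exists (2 * C * L).
have CL : 0 <= C * L by exact: mulr_ge0 C0 (ltW L0).
split=> [x xS|n e eo].
  rewrite !ipE//; last exact: KS.
  apply: le_trans (l2n_bound (ltW L0) (KS xS) (fun s _ => HC x s xS)) _.
  by have := mulr_ge0 CL (l2n_ge0 L x); move: (l2n L x) => q; lra.
have eS i : (i < n)%N -> S (e i) by case: eo => + _; apply.
have bR (s : R) : \sum_(i < n) Re (K (e i) s) ^+ 2 <= C.
  apply: (@bessel_functional R V S ip SD SZ S0 ipC ipDl ipZl (fun x => Re (K x s))) => //.
  - by move=> x y xS yS; rewrite KD//; exact: ReD.
  - by move=> a x xS; rewrite KZ//; apply: (etrans (congr1 (@complex.Re R) (RcomplexZ a (K x s)))); rewrite ReM /= mul0r subr0.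
  - by move=> x xS; rewrite ipE//; apply: le_trans (Re_sqr_le _) (HC x s xS).
have bI (s : R) : \sum_(i < n) Im (K (e i) s) ^+ 2 <= C.
  apply: (@bessel_functional R V S ip SD SZ S0 ipC ipDl ipZl (fun x => Im (K x s))) => //.
  - by move=> x y xS yS; rewrite KD//; exact: ImD.
  - by move=> a x xS; rewrite KZ//; apply: (etrans (congr1 (@complex.Im R) (RcomplexZ a (K x s)))); rewrite ImM /= mul0r addr0.
  - by move=> x xS; rewrite ipE//; apply: le_trans (Im_sqr_le _) (HC x s xS).
have sumE (m : nat) : (m <= n)%N -> Li (fun s => \sum_(i < m) (ind 0 L s * cnorm2 (K (e i) s))) /\
   \sum_(i < m) ip (K (e i)) (K (e i)) = RI (fun s => \sum_(i < m) (ind 0 L s * cnorm2 (K (e i) s))).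
  elim: m => [|m IH] mn.
    split; first by apply: eq_Li (Li0 R) => s; rewrite big_ord0.
    by rewrite big_ord0; apply/esym; apply: (etrans _ (RI0 R)); apply: eq_RI => s; rewrite big_ord0.
  have [i1 i2] := IH (ltnW mn); have Km := KS (eS m mn); have l := l2n_Li Km.
  split; first by apply: eq_Li (LiD i1 l) => s; rewrite big_ord_recr.
  rewrite big_ord_recr /= i2 (ipE Km) /l2n Rintegral_ind -(RID i1 l).
  by apply: eq_RI => s; rewrite big_ord_recr.
have [i1 ->] := sumE n (leqnn n).
have -> : 2 * C * L = RI (fun s => 2 * C * ind 0 L s) by rewrite (RIZ (2 * C) (Li_ind 0 L)) (RI_ind (ltW L0)) subr0.
apply: RI_le => //; first exact: (LiZ (2 * C) (Li_ind 0 L)).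
move=> s; rewrite -mulr_sumr mulrC; apply: ler_wpM2r; first exact: ind_ge0.
by rewrite big_split /=; have := bR s; have := bI s; move: (\sum_(i < n) _) (\sum_(i < n) _) => p q; lra.
Qed.

Let K_complete (v : nat -> V) : (forall n, S (v n)) ->
  (forall eps : R, 0 < eps -> exists N : nat, forall m n, (N <= m)%N -> (N <= n)%N ->
    ip (v m - v n) (v m - v n) < eps) ->
  exists2 h, S h & forall eps : R, 0 < eps -> exists N : nat, forall n, (N <= n)%N ->
    ip (K (v n) - h) (K (v n) - h) < eps.
Proof.
move=> vS vc; have [C C0 HC] := kk_bound.
have C1 : 0 < C + 1 by rewrite ltr_wpDl.
have Kc (eps : R) : 0 < eps -> exists N, forall m n (s : R), (N <= m)%N -> (N <= n)%N ->
    cnorm2 (kk (v m) s - kk (v n) s) <= eps ^+ 2.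
  move=> eps0; have e0 : 0 < eps ^+ 2 / (C + 1) by rewrite divr_gt0// exprn_gt0.
  have [N HN] := vc _ e0; exists N => m n s Nm Nn.
  have d := cL2B (vS m) (vS n).
  have := HN m n Nm Nn; rewrite ipE// VB ltr_pdivlMr// => h.
  have := kk_lin 1 (-1) s (vS m) (vS n).
  rewrite (_ : (fun x => _ + _) = (fun x => (v m x : R[i]) - v n x)); last by apply/funext => x; ring.
  rewrite mul1r mulN1r => <-; apply: le_trans (HC _ s d) _.
  by have := l2n_ge0 L (fun x => (v m x : R[i]) - v n x); move: (l2n L _) h => q h q0; nra.
have [lr Hr] : exists l : R -> R, forall eps : R, 0 < eps -> exists N, forall n p, (N <= n)%N -> `|Re (kk (v n) p) - l p| <= eps.
  apply: uniform_limit => eps eps0; have [N HN] := Kc eps eps0; exists N => m n p Nm Nn.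
  by rewrite -ReB; apply: Re_le (ltW eps0) (HN m n p Nm Nn).
have [li Hi] : exists l : R -> R, forall eps : R, 0 < eps -> exists N, forall n p, (N <= n)%N -> `|Im (kk (v n) p) - l p| <= eps.
  apply: uniform_limit => eps eps0; have [N HN] := Kc eps eps0; exists N => m n p Nm Nn.
  by rewrite -ImB; apply: Im_le (ltW eps0) (HN m n p Nm Nn).
pose h (s : R) : R[i] := Complex (lr s) (li s).
have near (eps : R) : 0 < eps -> exists N, forall n (s : R), (N <= n)%N -> cnorm2 (kk (v n) s - h s) <= eps.
  move=> eps0; pose e := Num.min 1 (eps / 2).
  have e0 : 0 < e by rewrite lt_min ltr01 divr_gt0.
  have [N1 H1] := Hr e e0; have [N2 H2] := Hi e e0; exists (maxn N1 N2) => n s; rewrite geq_max => /andP[n1 n2].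
  apply: (@le_trans _ _ (2 * e ^+ 2)).
    by apply: cnorm2_le; rewrite ?ReB ?ImB; [exact: H1|exact: H2].
  have h1 : e <= 1 by rewrite ge_min lexx.
  have h2 : e <= eps / 2 by rewrite ge_min lexx orbT.
  by nra.
(* A trajectory on the degenerate time interval [[0, 0]], so that [C0L2_limit] yields the square
   integrability of the uniform limit. *)
have hC : C0L2 L 0 (fun=> h).
  apply: (C0L2_limit L0 (v := fun n _ => kk (v n))) => [n|eps eps0].
    apply: C0L2P => [t _|t _ e e0]; first exact: (KS (vS n)).
    exists 1 => // t' _ _; rewrite (_ : (fun x => _) = (fun=> 0)) ?l2n0//.
    by apply/funext => x; rewrite subrr.
  by have [N HN] := near eps eps0; exists N => n t x Nn _; exact: HN.
have hS : S h by apply: (C0L2_cL2 hC (t := 0)); rewrite lexx.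
exists h => // eps eps0; have e0 : 0 < eps / (2 * L) by rewrite divr_gt0// mulr_gt0.
have [N HN] := near _ e0; exists N => n Nn.
have d : S (K (v n) - h) by exact: (cL2B (KS (vS n)) hS).
rewrite ipE// VB; apply: le_lt_trans (l2n_bound (ltW L0) d (fun s _ => HN n s Nn)) _.
have -> : eps / (2 * L) * L = eps / 2 by field; rewrite gt_eqF.
lra.
Qed.

Hypothesis ctrl : exactly_controllable L g L.

(** Steer [u0] to zero and read the trajectory backwards: being null at time [L], it has a backward
    datum that vanishes almost everywhere on [(L, 2L)]. The identity holds at every [x] since [be]
    is defined pointwise from the same integral as [kk be]. *)
Lemma trace_surjective u0 : cL2 I u0 -> exists2 be, cL2 I be & forall x, be x + kk be x = u0 x.
Proof.
move=> u0L; have [U [UL [u [uw uz]]]] := ctrl u0L (cL20 L).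
have um := weak_to_mild L0 gN (ltW L0) uw u0L UL.
have [uC dr di uE] := um; set d := dat L L u0 U in dr di uE.
pose be x := u0 x + cE L u 0 L x.
have beL : cL2 I be by apply: cL2D => //; apply: cL2r_cL2; exact: (cE_L2r L0 gN 0 L (ltW L0) uC).
have key : {ae mu, forall c : R, 0 < c -> c < 2 * L -> d c + cE L u 0 L c = ext be c}.
  have h1 : {ae mu, forall x, I x -> 0 = d (x + L) + cE L u 0 L (x + L)}.
    by apply: aeS (aeI (uE L LL) uz) => x [a b] xI; rewrite -(b xI) (a xI) cwaveE.
  apply: aeS (aeI (ae_neq L) (ae_shift (- L) h1)) => c [cL h] c0 c2.
  have [lt|ge] := ltP c L.
    by rewrite extE ?c0// /be /d datE ?c0.
  have gt : L < c by rewrite lt_neqAle eq_sym cL.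
  rewrite ext0 ?(le_gtF ge) ?andbF//; rewrite subrK in h; rewrite h//= in_itv/=.
  by apply/andP; split; lra.
have ub : back (ext be) u.
  split=> // t tL; have /andP[t0 t1] := tL.
  apply: aeS (aeI (uE t tL) (ae_shift t key)) => x [a b] xI.
  rewrite (a xI) cwaveE -b.
  - by rewrite -(cE_split L0 gN (x + t) (ltW L0) uC t0 t1); move: (cE _ _ _ _ _) (cE _ _ _ _ _) => p q; ring.
  - by move: xI; rewrite /= in_itv/= => /andP[x0 _]; lra.
  - by move: xI; rewrite /= in_itv/= => /andP[_ x0]; lra.
by exists be => // x; rewrite (kk_back x beL ub) /be addrK.
Qed.

(** Makes the datum of a state unique up to null functions and bounded by the state; the feedback
    inherits both. *)
Lemma trace_bounded_below : exists2 M : R, 0 <= M & forall be, cL2 I be -> l2n L be <= M * l2n L (fun x => be x + kk be x).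
Proof.
have [kap [K_bounded K_hs]] := kappa.
have T_surj h : S h -> exists f, S f /\ ip ((fun x : V => x + K x) f - h) ((fun x : V => x + K x) f - h) = 0.
  move=> hS; have [be beL beE] := trace_surjective hS; exists be; split=> //.
  rewrite ipE; last by apply: cL2B => //; exact: (cL2D beL (kk_cL2 beL)).
  rewrite -(l2n0 L); congr (l2n L _); apply/funext => s.
  by apply: (etrans (VB _ _ s)) || (rewrite VB; rewrite /K; apply/eqP; rewrite subr_eq0; apply/eqP; exact: beE).
have T_inj := @T_injective R V S ip SD SZ ipC ipDl ipZl ip_ge0 K kap KS KD KZ K_bounded K_hs T_surj.
have [M HM] := T_bounded_below SD SZ ipC ipDl ipZl ip_ge0 KS KD KZ K_bounded K_hs T_inj K_complete S0.
exists `|M|; first exact: normr_ge0.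
move=> be beL; have := HM be beL; rewrite !ipE//; last exact: (cL2D beL (kk_cL2 beL)).
move=> /le_trans; apply; apply: ler_wpM2r; [exact: l2n_ge0|exact: ler_norm].
Qed.

End feedback.

(** * The backward trajectories as closed-loop solutions *)

Lemma min_lipschitz (R : realType) (a b c : R) : `|Num.min a c - Num.min b c| <= `|a - b|.
Proof.
have h1 := ler_norm (a - b); have h2 := ler_norm (b - a); rewrite distrC in h2.
by case: (leP a c) => ac; case: (leP b c) => bc; rewrite ?subrr ?normr0//;
  rewrite ler_norml; apply/andP; split; lra.
Qed.

Section closed_loop.
Variable R : realType.
Local Notation aeq := (@Defs.ae_eq R).
Variables (L : R) (g : R -> R -> R[i]).
Local Notation I := `]0, L[%classic.
Hypothesis L0 : 0 < L.
Hypothesis gN : nice_kernel L g.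
Local Notation mild := (mild L g).
Local Notation cE := (cE L g).
Local Notation back := (back L g).
Local Notation ext := (ext L).

Let LL : 0 <= L <= L. Proof. by rewrite lexx ltW. Qed.

Section existence.
Variable bk : (R -> R[i]) -> R -> R -> R[i].
Hypothesis bkP : forall be, cL2 I be -> back (ext be) (bk be).
Local Notation kk := (kk L g bk).
Variable Gam : (R -> R[i]) -> R[i].
Hypothesis GamB : bounded_linear_functional L Gam.
(** On the initial state of the trajectory with datum [be], the functional returns the control at
    time zero, carried by the label [L]. *)
Hypothesis GamV : forall be u0, cL2 I be -> cL2 I u0 -> aeq L (fun x => be x + kk be x) u0 -> Gam u0 = kk be L.

(* The backward solution with data [be] on [(0, L)], stopped at time [L], is a closed-loop
   trajectory: restarting it at time [t] gives the backward solution with data [be (_ + t)]. *)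
Lemma closed_loop_exists be u0 : cL2 I be -> cL2 I u0 -> aeq L (fun x => be x + kk be x) u0 ->
  exists2 u, closed_loop_sol L g Gam u0 u & forall t : R, L <= t -> aeq L (u t) (fun=> 0).
Proof.
move=> beL u0L tr; pose w := bk be; have wb : back (ext be) w := bkP beL; have [wC wE] := wb.
have wm := back_mild L0 gN (ext_cL2r beL) wb.
pose d c := ext be c - cE L w 0 L c; rewrite -/d in wm.
have [_ dr di wmE] := wm.
have beyond (c : R) : L <= c -> ext be c = 0 by move=> Lc; rewrite ext0// (le_gtF Lc) andbF.
have wL : aeq L (w L) (fun=> 0).
  apply: aeS (wE L LL) => x h xI; rewrite (h xI) (cE_refl L0 gN _ (ltW L0) wC LL) beyond ?subr0//.
  by move: xI; rewrite /= in_itv/= => /andP[x0 _]; lra.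
pose u (t : R) := w (Num.min t L).
have mI (t : R) : 0 <= t -> 0 <= Num.min t L <= L.
  by move=> t0; rewrite le_min t0 (ltW L0) ge_min lexx orbT.
have uz (t : R) : L <= t -> aeq L (u t) (fun=> 0) by move=> Lt; rewrite /u min_r.
have us (t : R) : t <= L -> u t = w t by move=> Lt; rewrite /u min_l.
have uC (T : R) : C0L2 L T u.
  apply: C0L2P => [t /andP[t0 _]|t0 /andP[t00 _] e e0]; first exact: C0L2_cL2 wC (mI t t0).
  have [dl dl0 H] := C0L2_continuous wC (mI t0 t00) e0; exists dl => // t /andP[t1 _] td.
  by apply: H (mI t t1) _; apply: le_lt_trans td; exact: min_lipschitz.
have uw (T t c : R) : 0 <= t <= T -> t <= L -> cE T u 0 t c = cE L w 0 t c.
  move=> /andP[t0 tT] tL; apply: (cE_congr gN) => s /andP[s0 st].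
  have sL : 0 <= s <= L by apply/andP; split; lra.
  have sT : 0 <= s <= T by apply/andP; split; lra.
  rewrite us; last by case/andP: sL.
  by split=> //; [exact: C0L2_cL2 wC sL|exact: C0L2_cL2 wC sL|apply: aeW].
have uw' (T t c : R) : 0 <= t <= T -> L <= t -> cE T u 0 t c = cE L w 0 L c.
  move=> /andP[t0 tT] Lt; have T0 : 0 <= T by lra.
  rewrite -(cE_split L0 gN c T0 (uC T) (ltW L0) Lt) uw ?lexx//; last by rewrite ltW// (le_trans Lt).
  rewrite (cE_null L0 gN c T0 (uC T) (ltW L0) tT) ?addr0// => s /andP[Ls _].
  exact: uz (ltW Ls).
have umild (T : R) : 0 <= T -> mild T d u.
  move=> T0; split; [exact: uC|exact: dr|exact: di|] => t tT; have /andP[t0 _] := tT.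
  have [tL|Lt] := leP t L.
    have tI : 0 <= t <= L by rewrite t0.
    by apply: aeS (wmE t tI) => x h xI; rewrite us// (h xI) !cwaveE uw.
  apply: aeS (uz t (ltW Lt)) => x h xI; rewrite (h xI) cwaveE (uw' _ _ _ tT (ltW Lt)) /d beyond.
    by rewrite sub0r addNr.
  by move: xI; rewrite /= in_itv/= => /andP[x0 _]; lra.
have [m m0 Hm] := functional_bound GamB.
have dG (t : R) : 0 < t -> d (t + L) = Gam (u t).
  move=> t0; rewrite {1}/d beyond ?sub0r; last by rewrite lerDr ltW.
  have ut : cL2 I (u t) by exact: C0L2_cL2 wC (mI t (ltW t0)).
  have [Lt|tL] := leP L t.
    rewrite (cE_supp L0 gN (ltW L0) wC) ?oppr0; last by rewrite negb_and -!leNgt lerD2r Lt orbT.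
    apply/esym/cnorm2_eq0/le_anti; rewrite cnorm2_ge0 andbT; apply: le_trans (Hm _ ut) _.
    by rewrite (l2n_ae ut (cL20 L) (uz t Lt)) l2n0 mulr0.
  (* Restarted at a time [t < L], the trajectory is followed up to [t + L], which is below
     [2 * L]. *)
  have LL0 : 0 <= 2 * L by rewrite mulr_ge0// ltW.
  have u2C := uC (2 * L).
  pose v (s : R) := u (s + t); pose bt x := ext be (x + t).
  have btL : cL2 I bt by exact: cL2r_cL2 (cL2r_shift t (ext_cL2r beL)).
  (* The integral over [(s + t, L + t)] is the one up to [L + t] minus its part up to [s + t]; the
     former stops at [L], as the state is null afterwards. *)
  have vE (s c : R) : 0 <= s <= L -> cE L v s L c = cE L w 0 L (c + t) - cE (2 * L) u 0 (s + t) (c + t).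
    move=> /andP[s0 sL].
    have h1 : 0 <= s + t by lra.
    have h2 : L + t <= 2 * L by lra.
    have h3 : s + t <= L + t by lra.
    have h4 : 0 <= L + t <= 2 * L by apply/andP; split; lra.
    have h5 : L <= L + t by lra.
    rewrite (cE_shift L0 gN _ u2C LL0 s0 (lexx L) h1 h2).
    rewrite -(uw' (2 * L) (L + t) (c + t) h4 h5) -(cE_split L0 gN (c + t) LL0 u2C h1 h3).
    by rewrite [RHS]addrC addKr.
  have vb : back (ext bt) v.
    split.
      have sh (s : R) : 0 <= s <= L -> 0 <= s + t <= 2 * L by move=> /andP[h1 h2]; apply/andP; split; lra.
      apply: C0L2P => [s sL|s0 s0L e e0]; first exact: C0L2_cL2 u2C (sh s sL).
      have [dl dl0 H] := C0L2_continuous u2C (sh s0 s0L) e0; exists dl => // s sL sd.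
      by apply: H (sh s sL) _; rewrite (_ : s + t - (s0 + t) = s - s0)//; ring.
    move=> s sL; have stL : 0 <= s + t <= 2 * L by case/andP: sL => h1 h2; apply/andP; split; lra.
    have [_ _ _ h] := umild (2 * L) LL0; apply: aeS (h (s + t) stL) => x {}h xI.
    rewrite /v (h xI) cwaveE -/v (vE s (x + s) sL) addrA /d.
    have -> : ext bt (x + s) = ext be (x + s + t).
      have xs : 0 < x + s by move: xI sL; rewrite /= in_itv/= => /andP[h1 h2] /andP[h3 h4]; lra.
      have [sl|sl] := ltP (x + s) L; first by rewrite extE// xs.
      by rewrite ext0 ?(le_gtF sl) ?andbF// beyond//; lra.
    by move: (cE _ _ _ _ _) (cE _ _ _ _ _) => p q; ring.
  have -> : Gam (u t) = kk bt L.
    apply: GamV => //; have := kk_trace L0 gN bkP btL vb; rewrite /v add0r; exact: aeq_sym.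
  rewrite (kk_back L0 gN bkP L btL vb) vE; last by rewrite lexx ltW.
  (* The characteristic [c = L + t] enters through [x = L] at time [t] and collects nothing
     before. *)
  rewrite (cE_supp L0 gN LL0 u2C (a := 0) (b := 0 + t) (c := L + t)); last first.
    by rewrite negb_and -!leNgt add0r [t + L]addrC lexx orbT.
  by rewrite subr0 [t + L]addrC.
exists u => // T T0; have /cL2P[[m1 _] [m2 _]] := functional_cL2 GamB T0 (uC T).
apply: (mild_to_weak L0 gN T0 (umild T T0) u0L m1 m2).
  by apply: aeS tr => x h xI; rewrite -(h xI) /d extE.
by apply: aeW => t /andP[t0 _]; exact: dG.
Qed.

End existence.

(** [trace_bounded_below] makes the functional independent of the chosen datum, hence linear. One
    closed-loop trajectory vanishes from time [L] on, and uniqueness extends this to any other with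
    the same initial state. *)
Lemma controllable_stabilizable : exactly_controllable L g L -> stabilizable_in_finite_time L g L.
Proof.
move=> ctrl.
have /choice[bk bkP] : forall be, exists w, cL2 I be -> back (ext be) w.
  move=> be; have [beL|nb] := pselect (cL2 I be); last by exists (fun _ _ => 0).
  by have [w wb] := back_exists L0 gN (ext_cL2r beL); exists w.
pose k := kk L g bk.
have [M M0 HM] := trace_bounded_below L0 gN bkP ctrl.
have [C C0 HC] := kk_bound L0 gN bkP.
have lin (al ga : R[i]) be de (c : R) (bL : cL2 I be) (dL : cL2 I de) := kk_lin L0 gN bkP al ga c bL dL.
have /choice[bt btP] : forall u0, exists be, cL2 I u0 -> cL2 I be /\ forall x, be x + k be x = u0 x.
  move=> u0; have [uL|nu] := pselect (cL2 I u0); last by exists (fun=> 0).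
  by have [be beL beE] := trace_surjective L0 gN bkP ctrl uL; exists be.
(* The characteristic [c = L] enters through [x = L] at time zero: this is the control at the start
   of the trajectory issued from [u0]. *)
pose Gam u0 := k (bt u0) L.
have GamV be u0 : cL2 I be -> cL2 I u0 -> aeq L (fun x => be x + k be x) u0 -> Gam u0 = k be L.
  move=> beL u0L tr; have [tL tE] := btP u0 u0L.
  pose de x := 1 * bt u0 x + -1 * be x.
  have deL : cL2 I de by apply: cL2D; exact: cL2M.
  have kd x : k de x = k (bt u0) x - k be x by rewrite /k /de lin// mul1r mulN1r.
  have z : l2n L (fun x => de x + k de x) = 0.
    rewrite -(l2n0 L); apply: l2n_ae; [exact: (cL2D deL (kk_cL2 L0 gN bkP deL))|exact: cL20|].
    apply: aeS tr => x h xI; rewrite kd /de.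
    have -> : 1 * bt u0 x + -1 * be x + (k (bt u0) x - k be x) = (bt u0 x + k (bt u0) x) - (be x + k be x).
      by move: (k _ _) (k _ _) (bt u0 x) => p q r; ring.
    by rewrite tE (h xI) subrr.
  apply/eqP; rewrite -subr_eq0 /Gam -kd; apply/eqP/cnorm2_eq0/le_anti; rewrite cnorm2_ge0 andbT.
  apply: le_trans (HC _ L deL) _.
  have := HM de deL; rewrite z mulr0 => l0.
  by have -> : l2n L de = 0; [apply/le_anti; rewrite l0 l2n_ge0|rewrite mulr0].
have GamB : bounded_linear_functional L Gam.
  split; [move=> f h fL hL|split; [move=> c f fL|exists (C * M) => f fL]].
  - have [fT fE] := btP f fL; have [hT hE] := btP h hL.
    rewrite (GamV (fun x => 1 * bt f x + 1 * bt h x) _ (cL2D (cL2M 1 fT) (cL2M 1 hT)) (cL2D fL hL)).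
      by rewrite /k (lin _ _ _ _ _ fT hT); congr (_ + _); exact: mul1r.
    apply: aeW => x _; rewrite -(fE x) -(hE x) /k (lin _ _ _ _ _ fT hT).
    by move: (kk _ _ _ _ _) (kk _ _ _ _ _) (bt f x) (bt h x) => p q r s; ring.
  - have [fT fE] := btP f fL.
    rewrite (GamV (fun x => c * bt f x + 0 * bt f x) _ (cL2D (cL2M c fT) (cL2M 0 fT)) (cL2M c fL)).
      by rewrite /k lin// mul0r addr0.
    apply: aeW => x _; rewrite -(fE x) /k (lin _ _ _ _ _ fT fT).
    by move: (kk _ _ _ _ _) (bt f x) => p r; ring.
  have [fT fE] := btP f fL; apply: le_trans (HC _ L fT) _.
  rewrite -mulrA; apply: ler_wpM2l => //; apply: le_trans (HM _ fT) _.
  rewrite le_eqVlt; apply/orP; left; apply/eqP; congr (_ * l2n L _).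
  by apply/funext => x; exact: fE.
exists Gam; split=> // u0 u0L; have [tL tE] := btP u0 u0L.
have [u uc uz] := closed_loop_exists bkP GamB GamV tL u0L (aeW (fun x _ => tE x)).
split; first by exists u.
split=> [v1 v2 c1 c2 t t0|v vc t Lt]; first exact: (closed_loop_unique L0 gN GamB u0L c1 c2).
have t0 : 0 <= t by exact: le_trans (ltW L0) Lt.
exact: aeq_trans (closed_loop_unique L0 gN GamB u0L vc uc t0) (uz t Lt).
Qed.

End closed_loop.

(** * Reduction to square integrable rows *)

Section truncation.
Variable R : realType.
Local Notation Re := complex.Re.
Local Notation Im := complex.Im.
Local Notation mu := (@lebesgue_measure R).
Local Notation mu2 := ((@lebesgue_measure R) \x (@lebesgue_measure R))%E.
Variables (L : R) (g : R -> R -> R[i]).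
Local Notation I := `]0, L[%classic.
Hypothesis gL2 : cL2_sq L g.

Let e (y x : R) : R[i] := if (0 < y < L) && (0 < x < L) then g y x else 0.
Let F (y x : R) := cnorm2 (e y x).

Let square_measurable : measurable (square L).
Proof.
rewrite (_ : square L = `]0, L[%classic `*` `]0, L[%classic); first exact: measurableX.
by apply/seteqP; split => -[y x]; rewrite /square /= !in_itv.
Qed.

Let square_patch (f : R * R -> R) (p : R * R) :
  (f \_ (square L)) p = if (0 < p.1 < L) && (0 < p.2 < L) then f p else 0.
Proof.
rewrite patchE; case: (boolP ((0 < p.1 < L) && (0 < p.2 < L))) => h.
  by rewrite mem_set//; apply/andP.
by rewrite memNset// => /andP; exact/negP.
Qed.

Let e_mf2 : mf2 (fun y x => Re (e y x)) /\ mf2 (fun y x => Im (e y x)).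
Proof.
have [[mr _] [mi _]] := gL2; split.
  have /(measurable_restrictT _ square_measurable) := mr; apply: eq_measurable_fun => p _.
  by rewrite square_patch /e; case: ifP.
have /(measurable_restrictT _ square_measurable) := mi; apply: eq_measurable_fun => p _.
by rewrite square_patch /e; case: ifP.
Qed.

Let F_Li2 : Li2 F.
Proof.
have [[_ ir] [_ ii]] := gL2.
have {}ir := (@integrable_mkcond _ _ _ mu2 (square L) _ square_measurable).1 ir.
have {}ii := (@integrable_mkcond _ _ _ mu2 (square L) _ square_measurable).1 ii.
have := integrableD measurableT ir ii; apply: eq_integrable => // p _ /=.
rewrite !patchE /F /e; case: (boolP ((0 < p.1 < L) && (0 < p.2 < L))) => h.
  by rewrite mem_set//; apply/andP.
rewrite memNset; last by move=> /andP; exact/negP.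
by rewrite adde0 /cnorm2 Re0 Im0 expr0n addr0.
Qed.

Let A := [set y | Li (F y)].

Let A_measurable : measurable A.
Proof.
have Fm : measurable_fun setT (fun p : R * R => (F p.1 p.2)%:E) by exact: measurable_int F_Li2.
have H : measurable_fun setT (fun y => (\int[mu]_x (F y x)%:E)%E).
  apply: (measurable_fun_fubini_tonelli_F (m2 := mu) (fun p : R * R => (F p.1 p.2)%:E)) => // p.
  by rewrite lee_fin cnorm2_ge0.
rewrite (_ : A = setT `&` [set y | (\int[mu]_x (F y x)%:E < +oo)%E]).
  by apply: emeasurable_fun_infty_o.
rewrite setTI; apply/seteqP; split => y /=.
  move=> /integrableP[_]; apply: le_lt_trans; rewrite le_eqVlt; apply/orP; left; apply/eqP.
  by apply: eq_integral => x _; rewrite /= ger0_norm// cnorm2_ge0.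
move=> h; apply/integrableP; split.
  have m : mf2 F by move: Fm => /measurable_EFinP.
  by apply/measurable_EFinP; apply: (@mf2_comp _ _ _ _ (fun=> y) id m).
apply: le_lt_trans h; rewrite le_eqVlt; apply/orP; left; apply/eqP.
by apply: eq_integral => x _; rewrite /= ger0_norm// cnorm2_ge0.
Qed.

(** Rows are kept or discarded as a whole, and Fubini makes the discarded ones a null set. *)
Definition truncated_kernel (y x : R) : R[i] := if `[< A y >] then e y x else 0.
Local Notation g0 := truncated_kernel.

Let g0_mf2 (p : R[i] -> R) : p 0 = 0 -> mf2 (fun y x => p (e y x)) -> mf2 (fun y x => p (g0 y x)).
Proof.
move=> p0 m.
have AT : measurable (A `*` setT : set (R * R)) by exact: measurableX.
have /(measurable_restrictT _ AT) := measurable_funTS (D := A `*` setT) m.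
apply: eq_measurable_fun => q _; rewrite patchE /g0; case: asboolP => h.
  by rewrite mem_set.
by rewrite memNset// => -[].
Qed.

Lemma truncated_kernel_nice : nice_kernel L g0.
Proof.
have [mr mi] := e_mf2.
have [nr ni] := (g0_mf2 (p := @complex.Re R) erefl mr, g0_mf2 (p := @complex.Im R) erefl mi).
have z0 : cnorm2 (0 : R[i]) = 0 by rewrite /cnorm2 Re0 Im0 expr0n addr0.
split=> //.
- by move=> y x /negbTE h; rewrite /g0 /e h if_same.
- move=> y; rewrite /g0; case: asboolP => h; first exact: h.
  by apply: eq_Li (Li0 R) => x; rewrite z0.
apply: Li2_Li; apply: (le_integrable _ _ _ F_Li2) => //.
  apply/measurable_EFinP; apply: measurable_funD; exact: measurable_funX.
move=> p _ /=; rewrite lee_fin !ger0_norm ?cnorm2_ge0// /g0; case: ifP => // _.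
by rewrite z0 cnorm2_ge0.
Qed.

Let A_ae : {ae mu, forall y, A y}.
Proof. exact: (ae_integrable1 F_Li2). Qed.

(** The weak form integrates over the row index [y], so a null set of discarded rows leaves the
    integral unchanged for every [x], not only almost every one. *)
Lemma truncated_kernel_adjoint (x : R) (ph : R -> R[i]) : 0 < x < L ->
  continuous (fun y => Re (ph y)) -> continuous (fun y => Im (ph y)) ->
  cint I (fun y => conjc (g y x) * ph y) = cint I (fun y => conjc (g0 y x) * ph y).
Proof.
move=> xI cr ci; have [mr mi] := e_mf2.
have [nr ni] := (g0_mf2 (p := @complex.Re R) erefl mr, g0_mf2 (p := @complex.Im R) erefl mi).
have sec (k : R -> R -> R) : mf2 k -> mf (fun y => k y x) by move=> m; apply: (@mf2_comp _ _ _ _ id (fun=> x) m).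
have [pr pi] := (continuous_mf cr, continuous_mf ci).
have ge y : ind 0 L y * Re (g y x) = Re (e y x) /\ ind 0 L y * Im (g y x) = Im (e y x).
  by rewrite /e xI andbT ind_ifE; case: ifP => _; rewrite ?mul1r ?mul0r.
have g0e y : ind 0 L y * Re (g0 y x) = Re (g0 y x) /\ ind 0 L y * Im (g0 y x) = Im (g0 y x).
  rewrite ind_ifE; case: ifPn => [_|/negbTE h]; rewrite ?mul1r// !mul0r /g0 /e h.
  by rewrite if_same.
have E (k : R -> R -> R[i]) (y : R) : ind 0 L y * Re (conjc (k y x) * ph y) =
      (ind 0 L y * Re (k y x)) * Re (ph y) + (ind 0 L y * Im (k y x)) * Im (ph y) /\
    ind 0 L y * Im (conjc (k y x) * ph y) =
      (ind 0 L y * Re (k y x)) * Im (ph y) - (ind 0 L y * Im (k y x)) * Re (ph y).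
  by rewrite ReM ImM ReJ ImJ; split; ring.
apply: cplx_eq; rewrite ?cintRe ?cintIm; apply: RI_ae.
- apply: (eq_mf (f := fun y => Re (e y x) * Re (ph y) + Im (e y x) * Im (ph y))).
    by move=> y; rewrite (E g y).1 (ge y).1 (ge y).2.
  by apply: mfD; apply: mfM => //; [exact: sec mr|exact: sec mi].
- apply: (eq_mf (f := fun y => Re (g0 y x) * Re (ph y) + Im (g0 y x) * Im (ph y))).
    by move=> y; rewrite (E g0 y).1 (g0e y).1 (g0e y).2.
  by apply: mfD; apply: mfM => //; [exact: sec nr|exact: sec ni].
- apply: aeS A_ae => y Ay; rewrite (E g y).1 (E g0 y).1 (ge y).1 (ge y).2 (g0e y).1 (g0e y).2.
  by rewrite /g0 asboolT.
- apply: (eq_mf (f := fun y => Re (e y x) * Im (ph y) - Im (e y x) * Re (ph y))).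
    by move=> y; rewrite (E g y).2 (ge y).1 (ge y).2.
  by apply: mfB; apply: mfM => //; [exact: sec mr|exact: sec mi].
- apply: (eq_mf (f := fun y => Re (g0 y x) * Im (ph y) - Im (g0 y x) * Re (ph y))).
    by move=> y; rewrite (E g0 y).2 (g0e y).1 (g0e y).2.
  by apply: mfB; apply: mfM => //; [exact: sec nr|exact: sec ni].
- apply: aeS A_ae => y Ay; rewrite (E g y).2 (E g0 y).2 (ge y).1 (ge y).2 (g0e y).1 (g0e y).2.
  by rewrite /g0 asboolT.
Qed.

Lemma eq_cint (a b : R) (f h : R -> R[i]) : (forall x : R, a < x < b -> f x = h x) ->
  cint `]a, b[%classic f = cint `]a, b[%classic h.
Proof.
move=> fh; apply: cplx_eq; rewrite ?cintRe ?cintIm; apply: eq_RI => x; rewrite ind_ifE.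
  by case: ifPn => [/fh ->|_] //; rewrite !mul0r.
by case: ifPn => [/fh ->|_] //; rewrite !mul0r.
Qed.

Lemma weak_sol_truncated : weak_sol L g = weak_sol L g0.
Proof.
apply/funext => T; apply/funext => u0; apply/funext => U; apply/funext => u; apply/propext.
have E phi (tau : R) : cC1 phi ->
   cint `]0, tau[%classic (fun t => cint `]0, L[%classic (fun x =>
        u t x * conjc (- dt phi t x + dx phi t x
                       - cint `]0, L[%classic (fun y => conjc (g y x) * phi t y)))) =
   cint `]0, tau[%classic (fun t => cint `]0, L[%classic (fun x =>
        u t x * conjc (- dt phi t x + dx phi t x
                       - cint `]0, L[%classic (fun y => conjc (g0 y x) * phi t y)))).
  move=> [pr pi]; apply: eq_cint => t _; apply: eq_cint => x xI.
  by rewrite (truncated_kernel_adjoint xI (continuous_f2 pr (t := t)) (continuous_f2 pi (t := t))).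
split=> -[uC W]; (split; first exact: uC) => tau tT phi pC p0; have w := W tau tT phi pC p0.
  by rewrite (E phi tau pC) in w; exact: w.
by rewrite (E phi tau pC); exact: w.
Qed.

End truncation.

Theorem theorem1 (R : realType) (L : R) (g : R -> R -> R[i]) :
  0 < L ->
  cL2_sq L g ->
  cH1 (Tminus L) g ->
  cH1 (Tplus L) g ->
  (stabilizable_in_finite_time L g L <-> exactly_controllable L g L).
Proof.
move=> L0 gL2 _ _; have gN := truncated_kernel_nice gL2.
(* Both notions see the kernel only through [weak_sol], so one rewriting passes to the truncated
   kernel on both sides. *)
rewrite /stabilizable_in_finite_time /exactly_controllable /closed_loop_sol (weak_sol_truncated gL2).
by split; [exact: (stabilizable_controllable L0 gN)|exact: (controllable_stabilizable L0 gN)].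
Qed.
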